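(* Let $a<b$, $\mu\in\mathbb{R}$, and let $(u,\theta)$ be the weak solution of the heated string system with initial data $(u_0,v_0,\theta_0)$, where $u_0\in H^2(a,b)\cap H^1_0(a,b)$, $v_0\in H^1_0(a,b)$, $\theta_0\in H^1(a,b)$ and $\theta_0\ge\tilde\theta$ on $[a,b]$ for some constant $\tilde\theta>0$. Then $$\theta\in L^\infty((0,\infty)\times(a,b)).$$
   Context: The heated string system with constant $\mu\in\mathbb{R}$ on the bounded interval $(a,b)$ is $$\begin{cases}u_{tt}-u_{xx}=\mu\theta_x,&\text{in }(0,\infty)\times(a,b),\\ \theta_t-\theta_{xx}=\mu\theta u_{tx},&\text{in }(0,\infty)\times(a,b),\\ u(\cdot,a)=u(\cdot,b)=\theta_x(\cdot,a)=\theta_x(\cdot,b)=0,&\text{on }(0,\infty),\\ u(0,\cdot)=u_0,\ u_t(0,\cdot)=v_0,\ \theta(0,\cdot)=\theta_0>0.\end{cases}$$ Weak solution: $(u,\theta)$ is a (weak) solution with initial data $(u_0,v_0,\theta_0)$ if (i) $u_0\in H^2(a,b)\cap H^1_0(a,b)$, $v_0\in H^1_0(a,b)$, $\theta_0\in H^1(a,b)$, and there is $\tilde\theta>0$ with $\theta_0\geq\tilde\theta$ on $[a,b]$; (ii) $u\in L^\infty_{loc}(0,\infty;H^2(a,b))\cap W^{1,\infty}_{loc}(0,\infty;H^1_0(a,b))\cap W^{2,\infty}_{loc}(0,\infty;L^2(a,b))$ and $\theta\in L^\infty_{loc}(0,\infty;H^1(a,b))\cap H^1_{loc}(0,\infty;L^2(a,b))$,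 where the subscript $loc$ means that the membership holds on $(0,T)$ for every $T>0$; (iii) $u_{tt}-u_{xx}=\mu\theta_x$ for almost all $(t,x)\in(0,\infty)\times(a,b)$; (iv) $\int_a^b\theta_t\psi\,dx+\int_a^b\theta_x\psi_x\,dx=\mu\int_a^b\theta u_{tx}\psi\,dx$ for all $\psi\in C^\infty[a,b]$ and almost all $t\in(0,\infty)$; (v) the initial conditions are attained in the sense $\theta\in C([0,\infty);L^2(a,b))$, $u\in C([0,\infty);H^1_0(a,b))$, $u_t\in C([0,\infty);L^2(a,b))$, with $u(0)=u_0$, $u_t(0)=v_0$, $\theta(0)=\theta_0$. It is known that for every $\mu\in\mathbb{R}$ and all data as in (i) there is exactly one such solution, that its temperature $\theta$ is positive, and that for each $T>0$ there is $m_T>0$ with $\theta\ge m_T$ on $(0,T)$. *)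

(* Defs.v *)
From HB Require Import structures.
From mathcomp Require Import all_boot all_order all_algebra.
From mathcomp Require Import all_classical all_reals all_analysis.

Set Implicit Arguments.
Unset Strict Implicit.
Unset Printing Implicit Defensive.

Import Order.TTheory GRing.Theory Num.Theory.
Import numFieldNormedType.Exports.

Local Open Scope classical_set_scope.
Local Open Scope ring_scope.

Section HeatedString.
Context {R : realType}.
Implicit Types (a b T : R) (f g phi : R -> R) (F G : R -> R -> R).

Local Notation leb := (@lebesgue_measure R).

(* Classes of functions modulo null sets are represented by (Borel) functions;
   a function on an interval is a function on R whose values outside that
   interval are irrelevant. *)

Definition smooth phi := forall (n : nat) (x : R), derivable (derive1n n phi) x 1.

(* C_c^oo(a, b), extended by zero *)
Definition test_function a b phi :=
  smooth phi /\
  exists c d : R, [/\ a < c, d < b & forall x, x \notin `[c, d] -> phi x = 0].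

(* the norm of L^p(a, b) *)
Definition Lp_norm a b (p : \bar R) f : \bar R :=
  'N[leb]_p[EFin \o (f \_ `]a, b[)]%E.

Definition Lp a b (p : \bar R) : set (R -> R) :=
  [set f | f \_ `]a, b[ \in Lfun leb p].

Definition weak_derivative a b f g :=
  [/\ locally_integrable `]a, b[ f, locally_integrable `]a, b[ g &
   forall phi, test_function a b phi ->
     \int[leb]_(x in `]a, b[) (f x * derive1 phi x) =
     - \int[leb]_(x in `]a, b[) (g x * phi x)].

(* some version of the weak derivative, and 0 if there is none *)
Definition wderiv a b f : R -> R :=
  xget (cst 0) [set g | weak_derivative a b f g].

(* H^k(a, b) *)
Fixpoint Sobolev a b (k : nat) : set (R -> R) :=
  [set f | Lp a b 2%:E f /\
    if k is k'.+1 then exists2 g, weak_derivative a b f g & Sobolev a b k' g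
    else True].

Definition Sobolev_norm a b (k : nat) f : \bar R :=
  ((\sum_(i < k.+1) Lp_norm a b 2%:E (iter i (wderiv a b) f) `^ 2)
     `^ 2^-1)%E.

(* H^1_0(a, b), the closure of C_c^oo(a, b) in H^1(a, b) *)
Definition Sobolev10 a b : set (R -> R) :=
  [set f | Sobolev a b 1 f /\
    exists2 phi_ : nat -> R -> R, (forall n, test_function a b (phi_ n)) &
      (fun n => Sobolev_norm a b 1 (phi_ n \- f)) @ \oo --> 0%E].

Record function_space := FunctionSpace {
  fs_mem : set (R -> R);
  fs_norm : (R -> R) -> \bar R }.

Definition L2_space a b := FunctionSpace (Lp a b 2%:E) (Lp_norm a b 2%:E).
Definition H_space a b k := FunctionSpace (Sobolev a b k) (Sobolev_norm a b k).
Definition H10_space a b := FunctionSpace (Sobolev10 a b) (Sobolev_norm a b 1).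

(* L^p(0, T; X).  A function of time with values in a space X of functions of
   x is represented by a jointly measurable function of (t, x); as the spaces
   X used below are separable Hilbert spaces continuously embedded in
   L^2(a, b), such a function is strongly measurable in X as soon as almost
   all its values lie in X, and every strongly measurable function has such a
   representative. *)
Definition jointly_measurable T a b F :=
  measurable_fun (`]0, T[ `*` `]a, b[ : set (measurableTypeR R * measurableTypeR R))
    (fun p => F p.1 p.2 : R).

Definition Bochner a b T (p : \bar R) (X : function_space) F :=
  [/\ jointly_measurable T a b F,
      {ae leb, forall t, t \in `]0, T[ -> fs_mem X (F t)} &
      ('N[leb]_p[(fun t => fs_norm X (F t)) \_ `]0%R, T[] < +oo)%E].

(* G is the weak time derivative of F on (0, T): the Bochner integrals
   \int F phi' and - \int G phi are the same element of L^2(a, b). *)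
Definition weak_dt a b T F G :=
  [/\ Bochner a b T 1%E (L2_space a b) F, Bochner a b T 1%E (L2_space a b) G &
   forall phi, test_function 0 T phi ->
     {ae leb, forall x, x \in `]a, b[ ->
       \int[leb]_(t in `]0, T[) (F t x * derive1 phi t) =
       - \int[leb]_(t in `]0, T[) (G t x * phi t)}].

Definition weak_dx a b T F G :=
  jointly_measurable T a b G /\
  {ae leb, forall t, t \in `]0, T[ -> weak_derivative a b (F t) (G t)}.

(* W^{k,p}(0, T; X) *)
Fixpoint BochnerSobolev a b T (k : nat) (p : \bar R) (X : function_space) F :=
  Bochner a b T p X F /\
  if k is k'.+1 then
    exists2 G, weak_dt a b T F G & BochnerSobolev a b T k' p X G
  else True.

Definition loc (P : R -> Prop) := forall T, 0 < T -> P T.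

(* C([0, oo); X) *)
Definition continuous_in (X : function_space) F :=
  (forall t, 0 <= t -> fs_mem X (F t)) /\
  forall t0, 0 <= t0 ->
    (fun t => fs_norm X (F t \- F t0)) @ within `[0, +oo[ (nbhs t0) --> 0%E.

Definition admissible_data a b (u0 v0 theta0 : R -> R) :=
  [/\ Sobolev a b 2 u0 /\ Sobolev10 a b u0,
      Sobolev10 a b v0,
      Sobolev a b 1 theta0 &
      exists2 c : R, 0 < c & forall x, x \in `[a, b] -> c <= theta0 x].

Definition solution_regularity a b (u theta : R -> R -> R) :=
  loc (fun T =>
    [/\ Bochner a b T +oo%E (H_space a b 2) u,
        BochnerSobolev a b T 1 +oo%E (H10_space a b) u,
        BochnerSobolev a b T 2 +oo%E (L2_space a b) u,
        Bochner a b T +oo%E (H_space a b 1) theta &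
        BochnerSobolev a b T 1 2%:E (L2_space a b) theta]).

(* The functions u, theta and ut are the representatives that are continuous in
   time, so that their values at t = 0 make sense.  The space C^oo[a, b] of the
   functions psi consists of the restrictions of smooth functions on R. *)
Definition weak_solution (a b mu : R) (u0 v0 theta0 : R -> R)
    (u theta : R -> R -> R) :=
  [/\ admissible_data a b u0 v0 theta0,
      solution_regularity a b u theta &
      exists ut utt utx ux uxx thetat thetax : R -> R -> R,
      [/\ loc (fun T => [/\ weak_dt a b T u ut, weak_dt a b T ut utt,
                            weak_dx a b T ut utx &
                            weak_dt a b T theta thetat]),
          loc (fun T => [/\ weak_dx a b T u ux, weak_dx a b T ux uxx &
                            weak_dx a b T theta thetax]),
          {ae (leb \x leb)%E, forall p : R * R,
            0 < p.1 -> p.2 \in `]a, b[ ->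
            utt p.1 p.2 - uxx p.1 p.2 = mu * thetax p.1 p.2},
          (forall psi, smooth psi ->
            {ae leb, forall t, 0 < t ->
              \int[leb]_(x in `]a, b[) (thetat t x * psi x) +
              \int[leb]_(x in `]a, b[) (thetax t x * derive1 psi x) =
              mu * \int[leb]_(x in `]a, b[) (theta t x * utx t x * psi x)}) &
          [/\ continuous_in (L2_space a b) theta,
              continuous_in (H10_space a b) u,
              continuous_in (L2_space a b) ut &
              {ae leb, forall x, x \in `]a, b[ ->
                [/\ u 0 x = u0 x, ut 0 x = v0 x & theta 0 x = theta0 x]}]]].

End HeatedString.

(* Main.v *)
Require Import Defs.
From HB Require Import structures.
From mathcomp Require Import all_boot all_order all_algebra.
From mathcomp Require Import all_classical all_reals all_analysis.
From mathcomp Require Import measurable_realfun ess_sup_inf ring lra.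

Set Implicit Arguments.
Unset Strict Implicit.
Unset Printing Implicit Defensive.

Import Order.TTheory GRing.Theory Num.Theory.
Import numFieldNormedType.Exports.

Local Open Scope classical_set_scope.
Local Open Scope ring_scope.

(** The energy [1/2 \int u_t^2 + 1/2 \int u_x^2 + \int theta] is conserved; since
    [theta] stays nonnegative, [\int u_t^2] and [\int theta] are bounded uniformly
    in time, and no further information on [u] is needed.  Put [m = theta^q] and
    test the heat equation with [theta^(2q - 1)].  In [\int u_tx m^2] the
    x-derivative is moved to [m^2], which costs no boundary term because [u_t]
    vanishes at the end points; then [\int u_t m m_x] is absorbed by the
    dissipation [\int m_x^2] after interpolating [sup |m|] between [m_x] in [L^2]
    and [m] in [L^1].  This gives [y' <= - k y + k C q^4 (\int m)^2] for
    [y = \int m^2], with [C] independent of [q] and of time.  Hence the supremum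
    over time of [\int theta^(2q)] is controlled by its initial value and by
    [C q^4] times the square of the supremum of [\int theta^q], and the
    Alikakos-Moser iteration along [q = 2^k] yields the uniform bound.  The same
    estimate for the fourth power of the negative part of [theta], with Gronwall's
    lemma, gives [theta >= 0].

    The equations hold for almost every time only once the test function is fixed.
    They are therefore tested on countably many smooth functions, which by
    du Bois-Reymond's lemma is enough to recover absolutely continuous
    representatives of almost every slice, and to differentiate
    [\int Phi(theta(t, x)) dx] in time by the chain rule at almost every fixed [x]. *)

(** * Smooth cut-off functions *)

(** Two kinds of constants have to be kept apart. The regularity of a solution gives bounds on []0,
    T[] that may grow with [T]; they justify the manipulations, and enter the final bound only for
    [T = 1], where they control the initial values of all powers of [theta] at once. What is
    propagated to all times is the energy alone. Young's inequality is used with a parameter [c]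
    proportional to [q], so that the damping rate is [c^2 / (b - a)] while the source carries [c^2]
    times a factor of order [q^4]; the common [c^2] cancels in the balance of the two, which leaves
    [q^4] and no dependence on time. Along [q = 2^k] this factor grows like [16^k], slowly enough to
    be absorbed after the exponent [2^k] is divided out. The fourth power of the negative part
    appears because the method needs [Phi = rho^2] with [rho] differentiable and [rho'] locally
    Lipschitz, which fails for [rho] equal to the negative part itself. *)

Section Smooth.
Context {R : realType}.
Implicit Types (f g : R -> R) (x : R).

(** Off by one: level [n] makes the derivatives of orders [0] to [n] all differentiable, so level
    [0] already means differentiable everywhere. Recursion on the derivative lets the sum, product
    and quotient rules go by induction on [n]. *)
Fixpoint differentiable_upto (n : nat) f : Prop :=
  (forall x, derivable f x 1) /\
  (if n is n'.+1 then differentiable_upto n' (derive1 f) else True).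

Local Notation Cn := differentiable_upto.

Lemma smoothP f : smooth f <-> forall n, Cn n f.
Proof.
split=> [sf n|Cf].
  have H k : (forall m x, derivable (derive1n m f) x 1) ->
    forall i, Cn k (derive1n i f).
    by move=> d; elim: k => [|k IH] i; split => //; rewrite -derive1nS; exact: IH.
  by have := H n sf 0%N; rewrite derive1n0.
move=> n; elim: n f Cf => [|n IH] f Cf x.
  by rewrite derive1n0; have [] := Cf 0%N.
by rewrite /derive1n iterSr; apply: IH => m; have [] := Cf m.+1.
Qed.

Lemma Cn_der n f g : (forall x, is_derive x 1 f (g x)) -> Cn n g -> Cn n.+1 f.
Proof.
move=> df Cg; split=> [x|]; first by have [] := df x.
suff -> : (derive1 f) = g by [].
by apply/funext => x; rewrite derive1E; exact: derive_val.
Qed.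

Lemma CnS n f : Cn n.+1 f -> Cn n f.
Proof.
elim: n f => [|n IH] f [df Cf]; first by split.
by split => //; apply: IH.
Qed.

Lemma Cn_deriv n f : Cn n f -> forall x, is_derive x 1 f ((derive1 f) x).
Proof. by case: n => [|n] [df _] x; apply: DeriveDef => //; rewrite derive1E. Qed.

Lemma is_derive_add f g x (df dg : R) : is_derive x 1 f df ->
  is_derive x 1 g dg -> is_derive x 1 (f \+ g) (df + dg).
Proof. exact: is_deriveD. Qed.

Lemma is_derive_mul f g x (df dg : R) : is_derive x 1 f df ->
  is_derive x 1 g dg -> is_derive x 1 (f \* g) (f x * dg + g x * df).
Proof. exact: is_deriveM. Qed.

Lemma CnD n f g : Cn n f -> Cn n g -> Cn n (f \+ g).
Proof.
elim: n f g => [|n IH] f g Cf Cg.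
  have df := Cn_deriv Cf; have dg := Cn_deriv Cg.
  by split => // x; have [] := is_derive_add (df x) (dg x).
apply: (@Cn_der _ _ ((derive1 f) \+ (derive1 g))) => [x|].
  have df := Cn_deriv Cf; have dg := Cn_deriv Cg.
  exact: is_derive_add.
by case: Cf => _ Cf; case: Cg => _ Cg; exact: IH.
Qed.

Lemma CnM n f g : Cn n f -> Cn n g -> Cn n (f \* g).
Proof.
elim: n f g => [|n IH] f g Cf Cg.
  split => // x; have df := Cn_deriv Cf; have dg := Cn_deriv Cg.
  by have [] := is_derive_mul (df x) (dg x).
apply: (@Cn_der _ _ ((f \* (derive1 g)) \+ (g \* (derive1 f)))) => [x|].
  have df := Cn_deriv Cf; have dg := Cn_deriv Cg.
  exact: is_derive_mul.
have [_ Cf'] := Cf; have [_ Cg'] := Cg.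
by apply: CnD; apply: IH => //; exact: CnS.
Qed.

Lemma Cn_cst n c : Cn n (cst c : R -> R).
Proof.
elim: n c => [|n IH] c; first by split.
by apply: (@Cn_der _ _ (cst 0)) ; exact: IH.
Qed.

Lemma Cn_id n : Cn n (id : R -> R).
Proof.
case: n => [|n]; first by split.
apply: (@Cn_der _ _ (cst 1)) ; exact: Cn_cst.
Qed.

Lemma is_derive_affine (k c : R) f x l : is_derive (k * x + c) 1 f l ->
  is_derive x 1 (fun y => f (k * y + c)) (k * l).
Proof.
move=> df.
have d1 : is_derive x 1 (fun y : R => k * y + c) k.
  have := is_derive_add (is_derive_mul (is_derive_cst k x 1) (is_derive_id x 1))
    (is_derive_cst c x 1).
  by rewrite mulr1 mulr0 !addr0.
have := @is_derive1_comp _ f (fun y => k * y + c) x _ _ df d1.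
by rewrite mulrC.
Qed.

Lemma Cn_affine n (k c : R) f : Cn n f -> Cn n (fun x => f (k * x + c)).
Proof.
elim: n f => [|n IH] f Cf.
  split => // x; have df := Cn_deriv Cf.
  by have [] := is_derive_affine (df (k * x + c)).
apply: (@Cn_der _ _ (cst k \* (fun x => (derive1 f) (k * x + c)))) => [x|].
  by apply: is_derive_affine; apply: Cn_deriv Cf _.
by apply: CnM; [exact: Cn_cst|apply: IH; case: Cf].
Qed.

Lemma CnV n f : (forall x, 0 < f x) -> Cn n f -> Cn n (fun x => (f x)^-1).
Proof.
move=> f0; have dV m : Cn m f -> forall x,
    is_derive x 1 (fun x => (f x)^-1) (- ((f x)^-1 ^+ 2 * (derive1 f) x)).
  move=> Cf x; have df := Cn_deriv Cf x.
  have := @is_deriveV _ f x _ 1 (lt0r_neq0 (f0 x)) df.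
  by rewrite /GRing.scale/= -exprVn mulNr.
elim: n => [|n IH] Cf; first by split => // x; have [] := dV _ Cf x.
(* The derivative of [1 / f] is a polynomial in [1 / f] and [f'], so the induction hypothesis for
   [1 / f] itself closes the induction. *)
apply: (@Cn_der _ _ (cst (-1) \* (((fun x => (f x)^-1) \* (fun x => (f x)^-1)) \* (derive1 f)))).
  by move=> x; have H := dV _ Cf x; apply: is_derive_eq; rewrite /= mulN1r expr2.
have Cf' := CnS Cf.
apply: CnM; first exact: Cn_cst.
by apply: CnM; [apply: CnM; exact: IH|case: Cf].
Qed.

End Smooth.

Section Bump.
Context {R : realType}.
Implicit Types (f g : R -> R) (x : R).
Local Notation Cn := differentiable_upto.

(** [flat 0] is the classical function [exp (- 1 / x)], flat at [0]. The exponent [k] is there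
    because the family is closed under differentiation, so smoothness follows without computing
    higher derivatives. *)
Definition flat (k : nat) : R -> R :=
  fun x => if 0 < x then x ^- k * expR (- x^-1) else 0.

(** Comes from [exp y >= 1 + y^(k+1) / (k+1)!] at [y = 1 / x]. A bound linear in [x] is what makes
    the difference quotients at [0] tend to [0]. *)
Lemma flat_le k x : 0 < x -> flat k x <= (k.+1)`!%:R * x.
Proof.
move=> x0; rewrite /flat x0 expRN.
have := expR_ge1Dxn k (ltW (_ : 0 < x^-1)); rewrite invr_gt0 => /(_ x0) H.
rewrite ler_pdivrMr ?expR_gt0//.
apply: (le_trans _ (ler_wpM2l _ H)); last by rewrite mulr_ge0// ?ler0n// ltW.
rewrite mulrDr mulr1 exprVn.
have f0 : (k.+1)`!%:R != 0 :> R by rewrite pnatr_eq0 -lt0n fact_gt0.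
have -> : (k.+1)`!%:R * x * (x ^- k.+1 / (k.+1)`!%:R) = x ^- k.
  by rewrite exprS; field; rewrite f0 expf_neq0 ?gt_eqF.
by rewrite lerDr mulr_ge0// ?ler0n// ltW.
Qed.

Lemma flat_ge0 k x : 0 <= flat k x.
Proof.
rewrite /flat; case: ifPn => // x0.
by rewrite mulr_ge0 ?expR_ge0 ?invr_ge0 ?exprn_ge0// ltW.
Qed.

Lemma flat_derive k x :
  is_derive x 1 (flat k) (- k%:R * flat k.+1 x + flat k.+2 x).
Proof.
have [x0|x0|->] := ltgtP x 0.
- have -> : - k%:R * flat k.+1 x + flat k.+2 x = 0.
    by rewrite /flat ltNge (ltW x0)/= mulr0 addr0.
  apply: (@near_eq_is_derive _ _ _ (cst 0 : R -> R)) => //.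
  near=> y; rewrite /flat ltNge ltW//.
  by near: y; exact: lt_nbhsl.
- have e : is_derive x 1 (fun y : R => y ^- k * expR (- y^-1))
    (- k%:R * flat k.+1 x + flat k.+2 x).
    have xn0 : x != 0 by rewrite gt_eqF.
    have d1 : is_derive x 1 (fun y : R => y^-1) (- x ^- 2).
      have := @is_deriveV _ id x _ 1 xn0 (is_derive_id _ _).
      by rewrite /GRing.scale/= mulr1.
    have d2 : is_derive x 1 (fun y : R => expR (- y^-1)) (x ^- 2 * expR (- x^-1)).
      have dN : is_derive x 1 (fun y : R => - y^-1) (x ^- 2).
        have := is_deriveN d1; rewrite opprK; exact.
      have := @is_derive1_comp _ expR (fun y => - y^-1) x _ _ (is_derive_expR _) dN.
      by rewrite mulrC.
    have d3 : is_derive x 1 (fun y : R => y ^- k) (- k%:R * x ^- k.+1).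
      have dk : is_derive x 1 (fun y : R => y ^+ k) (k%:R * x ^+ k.-1).
        split; first exact: exprn_derivable.
        by rewrite exp_derive [LHS]mulr1.
      have := @is_deriveV _ (fun y : R => y ^+ k) x _ 1 (expf_neq0 k xn0) dk.
      move=> H; apply: (is_derive_eq H); rewrite /GRing.scale/=.
      case: k {dk H} => [|k]; first by rewrite mul0r mulr0 oppr0 mul0r.
      by rewrite /= !exprS; field; rewrite xn0 expf_neq0.
    have := is_derive_mul d3 d2 => H; apply: (is_derive_eq H).
    rewrite /flat x0 /GRing.scale/= !exprS; field.
    by rewrite xn0 expf_neq0.
  apply: (near_eq_is_derive _ e).
  near=> y; rewrite /flat ifT//.
  by near: y; exact: lt_nbhsr.
- have -> : - k%:R * flat k.+1 0 + flat k.+2 0 = 0.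
    by rewrite /flat ltxx mulr0 addr0.
  have c : h^-1 *: (flat k (h + 0) - flat k 0) @[h --> 0^'] --> (0 : R).
    apply/cvgrPdist_le => e e0; near=> h.
    rewrite /flat ltxx addr0 subr0 sub0r normrN /GRing.scale/=.
    case: ifPn => h0; last by rewrite mulr0 normr0 ltW.
    (* The difference quotient of [flat k] at [0] is [flat k.+1], to which the linear bound
       applies. *)
    have -> : h^-1 * (h ^- k * expR (- h^-1)) = flat k.+1 h.
      by rewrite /flat h0 exprS invfM mulrA.
    rewrite ger0_norm ?flat_ge0// (le_trans (flat_le _ h0))//.
    rewrite -ler_pdivlMl ?ltr0n ?fact_gt0// ltW//.
    have : `|h| < (k.+2)`!%:R^-1 * e.
      near: h; apply: dnbhs0_lt; by rewrite mulr_gt0// invr_gt0 ltr0n fact_gt0.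
    by rewrite gtr0_norm.
  apply: DeriveDef.
    by apply/cvg_ex; exists 0; under eq_fun do rewrite [_%:A]mulr1; exact: c.
  rewrite /derive; under eq_fun do rewrite [_%:A]mulr1.
  exact/cvg_lim.
Unshelve. all: by end_near. Qed.

Lemma Cn_flat n k : Cn n (flat k).
Proof.
elim: n k => [|n IH] k; first by split => // x; have [] := flat_derive k x.
apply: (@Cn_der _ _ _ ((cst (- k%:R) \* flat k.+1) \+ flat k.+2)).
  by move=> x; exact: flat_derive.
by apply: CnD => //; apply: CnM => //; exact: Cn_cst.
Qed.

Definition smoothstep : R -> R :=
  flat 0 \* (fun x => (flat 0 x + flat 0 (-1 * x + 1))^-1).

Lemma smoothstep_denom x : 0 < flat 0 x + flat 0 (-1 * x + 1).
Proof.
have f0 y : 0 < y -> 0 < flat 0 y.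
  by move=> y0; rewrite /flat y0 invr1 mul1r expR_gt0.
have [x0|x0] := ltP 0 x; first by rewrite ltr_pwDl ?f0 ?flat_ge0.
by rewrite ltr_wpDl ?flat_ge0// f0// mulN1r; lra.
Qed.

Lemma Cn_smoothstep n : Cn n smoothstep.
Proof.
apply: CnM; first exact: Cn_flat.
apply: CnV; first exact: smoothstep_denom.
by apply: CnD; [exact: Cn_flat|apply: Cn_affine; exact: Cn_flat].
Qed.

Lemma smoothstep0 x : x <= 0 -> smoothstep x = 0.
Proof. by move=> x0; rewrite /smoothstep/= {1}/flat ltNge x0/= mul0r. Qed.

Lemma smoothstep1 x : 1 <= x -> smoothstep x = 1.
Proof.
move=> x1; have := smoothstep_denom x; rewrite /smoothstep/=.
have -> : flat 0 (-1 * x + 1) = 0.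
  by rewrite /flat ltNge; have -> : -1 * x + 1 <= 0 by rewrite mulN1r; lra.
by rewrite addr0 => f0; rewrite divff ?gt_eqF.
Qed.

(** Multiplying by [x] replaces taking a primitive of [smoothstep]. The price is a derivative that
    need not stay in [[0, 1]]; [dramp_bounded] supplies the bound for dominated convergence. *)
Definition ramp : R -> R := id \* smoothstep.

Lemma Cn_ramp n : Cn n ramp.
Proof. by apply: CnM; [exact: Cn_id|exact: Cn_smoothstep]. Qed.

Lemma ramp0 x : x <= 0 -> ramp x = 0.
Proof. by move=> x0; rewrite /ramp/= smoothstep0 ?mulr0. Qed.

Lemma ramp1 x : 1 <= x -> ramp x = x.
Proof. by move=> x1; rewrite /ramp/= smoothstep1 ?mulr1. Qed.

Lemma is_derive_ramp x : is_derive x 1 ramp (derive1 ramp x).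
Proof. exact: (Cn_deriv (Cn_ramp 0)). Qed.

Lemma continuous_dramp : continuous (derive1 ramp).
Proof.
move=> x; apply/differentiable_continuous/derivable1_diffP.
by have [_ [+ _]] := Cn_ramp 1; apply.
Qed.

Lemma dramp_lt0 x : x < 0 -> derive1 ramp x = 0.
Proof.
move=> x0; have H : is_derive x 1 ramp 0.
  apply: (@near_eq_is_derive _ _ _ (cst 0 : R -> R)).
  near=> y; rewrite ramp0//.
  by near: y; exact: lt_le_nbhsl.
by rewrite derive1E; exact: derive_val.
Unshelve. all: by end_near. Qed.

Lemma dramp_gt1 x : 1 < x -> derive1 ramp x = 1.
Proof.
move=> x0; have H : is_derive x 1 ramp 1.
  apply: (@near_eq_is_derive _ _ _ id).
  near=> y; rewrite ramp1//.
  by near: y; exact: lt_le_nbhsr.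
by rewrite derive1E; exact: derive_val.
Unshelve. all: by end_near. Qed.

Lemma dramp_bounded : exists2 C, 0 <= C & forall x, `|derive1 ramp x| <= C.
Proof.
have [||c _ cP] := @EVT_max R (fun x => `|derive1 ramp x|) (-1) 2.
- by lra.
- apply: continuous_subspaceT => x.
  by apply: continuous_comp; [exact: continuous_dramp|exact: norm_continuous].
exists (Num.max 1 `|derive1 ramp c|); first by rewrite le_max ler01.
move=> x; rewrite le_max.
have [x0|x0] := ltP x 0; first by rewrite dramp_lt0// normr0 ler01.
have [x1|x1] := ltP 1 x; first by rewrite dramp_gt1// normr1 lexx.
by rewrite cP ?orbT// in_itv/=; apply/andP; split; lra.
Qed.

End Bump.

(** * Absolutely continuous functions *)

Section AbsolutelyContinuous.
Context {R : realType}.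
Local Notation leb := (@lebesgue_measure R).
Local Notation itg D f := (leb.-integrable D (EFin \o f)).
Implicit Types (a b x y : R) (f g F G : R -> R).

(** Absolute continuity on [[a, b]] in integral form, carrying one fixed representative [f] of the
    derivative. Half-open intervals make the integrals additive over adjacent intervals, and [F] is
    unconstrained outside [[a, b]]. *)
Definition antiderivative a b F f :=
  itg `]a, b] f /\
  forall x, a <= x <= b -> F x = F a + \int[leb]_(t in `]a, x]) f t.
Local Notation AC := antiderivative.

(** The regularity asked of outer derivatives in the chain rule: stable under products and powers
    and, unlike continuous differentiability, shared by the negative part. *)
Definition locally_lipschitz f :=
  forall M : R, exists2 K : R, 0 <= K &
    forall r s, `|r| <= M -> `|s| <= M -> `|f r - f s| <= K * `|r - s|.

Lemma le_Rint_subset (A B : set R) f : measurable A -> measurable B ->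
  A `<=` B -> itg B f -> (forall x, B x -> 0 <= f x) ->
  \int[leb]_(x in A) f x <= \int[leb]_(x in B) f x.
Proof.
move=> mA mB AB fB f0; rewrite /Rintegral; apply: fine_le.
- by apply: integrable_fin_num => //; exact: integrableS fB.
- exact: integrable_fin_num.
- apply: ge0_subset_integral => //; first by case/integrableP: fB.
Qed.

Lemma integrable_bounded_mul (D : set R) (h : R -> R) f (c : R) : measurable D ->
  measurable_fun D h -> (forall x, D x -> `|h x| <= c) -> itg D f ->
  itg D (fun x => h x * f x).
Proof.
move=> mD mh hc fi.
rewrite (_ : _ \o _ = (EFin \o h) \* (EFin \o f))%E; last by apply/funext.
apply: integrableMr => //; exists c; split; first exact: num_real.
by move=> d cd x Dx; apply: ltW; apply: le_lt_trans cd; exact: hc.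
Qed.

Lemma integrable_scale (D : set R) f (c : R) : measurable D -> itg D f ->
  itg D (fun x => c * f x).
Proof.
move=> mD fi; apply: (integrable_bounded_mul (c := `|c|)) => //.
Qed.

Lemma AC_sub a b F f x y : AC a b F f -> a <= x -> x <= y -> y <= b ->
  F y - F x = \int[leb]_(t in `]x, y]) f t.
Proof.
move=> [fi FE] ax xy yb.
rewrite FE ?(le_trans ax xy)// (FE x) ?ax ?(le_trans xy yb)//.
rewrite opprD addrACA subrr add0r Rintegral_itvB//.
by apply: integrableS fi => //; apply: subset_itvl; rewrite bnd_simp.
Qed.

Lemma AC_itg a b F f x y : AC a b F f -> a <= x -> y <= b -> itg `]x, y] f.
Proof.
move=> [fi _] ax yb; apply: integrableS fi => //.
by apply: subset_itv; rewrite bnd_simp.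
Qed.

Lemma AC_dist a b F f x y : AC a b F f -> a <= x -> x <= y -> y <= b ->
  `|F y - F x| <= \int[leb]_(t in `]x, y]) `|f t|.
Proof.
move=> acF ax xy yb; rewrite (AC_sub acF)//.
by apply: le_normr_Rintegral => //; exact: AC_itg acF _ _.
Qed.

Lemma AC_uniform a b F f (e : R) : AC a b F f -> 0 < e ->
  exists2 d : R, 0 < d & forall x y, a <= x -> x <= y -> y <= b -> y - x < d ->
    \int[leb]_(t in `]x, y]) `|f t| <= e.
Proof.
move=> acF e0; have [fi _] := acF.
have : itg setT (f \_ `]a, b]).
  by rewrite -restrict_EFin; apply/(integrable_mkcond _ _).1.
move=> /integral_normr_continuous -/(_ _ e0)[d [d0 H]].
exists d => // x y ax xy yb yxd.
have : \int[leb]_(t in `]x, y]) `|(f \_ `]a, b]) t| < e.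
  apply: H => //=; rewrite lebesgue_measure_itv/= lte_fin.
  by case: ifPn => // _; rewrite -EFinD lte_fin.
move=> /ltW; congr (_ <= _); apply: eq_Rintegral => t; rewrite inE/= => txy.
rewrite patchE mem_set//=; move: t txy; apply: subset_itv; rewrite bnd_simp//.
Qed.

(** Both sides are additive over adjacent intervals, so the inequality is summed over steps of
    length [d / 2], half of [d] because the local hypothesis needs lengths strictly below [d]. *)
Lemma step_partition a b (H W : R -> R) d : 0 < d ->
  (forall x y, a <= x -> x <= y -> y <= b -> y - x < d ->
    H y - H x <= W y - W x) ->
  forall x y, a <= x -> x <= y -> y <= b -> H y - H x <= W y - W x.
Proof.
move=> d0 loc x y ax xy yb.
have [n yxn] : exists n, y - x < n%:R * (d / 2).
  exists (Num.bound ((y - x) / (d / 2))).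
  rewrite -ltr_pdivrMr ?divr_gt0// archi_boundP// divr_ge0 ?subr_ge0//.
  by rewrite divr_ge0// ltW.
elim: n x ax xy yxn => [|n IH] x ax xy yxn.
  by move: yxn; rewrite mul0r subr_lt0 ltNge xy.
have [yxd|yxd] := ltP (y - x) d; first exact: loc.
have h : x + d / 2 <= y by lra.
have h1 : H (x + d / 2) - H x <= W (x + d / 2) - W x.
  apply: loc => //; try lra.
have h2 : H y - H (x + d / 2) <= W y - W (x + d / 2).
  apply: IH => //; first by lra.
  by move: yxn; rewrite -natr1 mulrDl mul1r; lra.
lra.
Qed.

Lemma AC_bounded a b F f : a <= b -> AC a b F f ->
  exists2 M : R, 0 <= M & forall x, a <= x <= b -> `|F x| <= M.
Proof.
move=> ab acF; exists (`|F a| + \int[leb]_(t in `]a, b]) `|f t|).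
  by rewrite addr_ge0// Rintegral_ge0.
move=> x /andP[ax xb]; have -> : F x = F a + (F x - F a) by ring.
rewrite (le_trans (ler_normD _ _))// lerD2l//.
apply: (le_trans (AC_dist acF (lexx _) ax xb)).
have fi : itg `]a, b] (fun t => `|f t|) by apply: integrable_norm; case: acF.
rewrite -subr_ge0 Rintegral_itvB ?bnd_simp//.
exact: Rintegral_ge0.
Qed.

Lemma integrable_obnd_cbnd x (c : itv_bound R) f :
  itg [set` Interval (BRight x) c] f <-> itg [set` Interval (BLeft x) c] f.
Proof.
split=> /integrableP[mf foo]; apply/integrableP; split.
- exact/emeasurable_fun_itv_obnd_cbndP.
- by rewrite -integral_itv_obnd_cbnd//; apply: measurableT_comp.
- exact/emeasurable_fun_itv_obnd_cbndP.
- rewrite integral_itv_obnd_cbnd//; apply: measurableT_comp => //.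
  exact/emeasurable_fun_itv_obnd_cbndP.
Qed.

Lemma integrable_bndo_bndc x (c : itv_bound R) f :
  itg [set` Interval c (BLeft x)] f <-> itg [set` Interval c (BRight x)] f.
Proof.
split=> /integrableP[mf foo]; apply/integrableP; split.
- exact/emeasurable_fun_itv_bndo_bndcP.
- by rewrite -integral_itv_bndo_bndc//; apply: measurableT_comp.
- exact/emeasurable_fun_itv_bndo_bndcP.
- rewrite integral_itv_bndo_bndc//; apply: measurableT_comp => //.
  exact/emeasurable_fun_itv_bndo_bndcP.
Qed.

Lemma AC_continuous a b F f : a <= b -> AC a b F f ->
  {within `[a, b], continuous F}.
Proof.
move=> ab [fi FE].
have fc : itg `[a, b] f by exact/integrable_obnd_cbnd.
apply: (@subspace_eq_continuous _ _ _
    (fun x => F a + parameterized_integral leb a x f)).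
  move=> x; rewrite inE/= in_itv/= => xab.
  rewrite [RHS](FE x xab) /parameterized_integral Rintegral_itv_obnd_cbnd//.
  by apply: integrableS fi => //; apply: subset_itvl; case/andP: xab.
move=> x; apply: cvgD; first exact: cvg_cst.
exact: (parameterized_integral_continuous ab fc).
Qed.

Lemma AC_measurable a b F f : a <= b -> AC a b F f ->
  measurable_fun `[a, b] F.
Proof.
move=> ab acF; apply: subspace_continuous_measurable_fun => //.
exact: AC_continuous acF.
Qed.

Lemma locally_lipschitz_continuous f : locally_lipschitz f -> continuous f.
Proof.
move=> lf x; have [K K0 KP] := lf (`|x| + 1).
have K1 : 0 < K + 1 by rewrite ltr_wpDl.
apply/cvgrPdist_le => e e0; near=> y.
have : `|x - y| < Num.min 1 (e / (K + 1)).
  near: y; exists (Num.min 1 (e / (K + 1))) => //=.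
  by rewrite lt_min ltr01 divr_gt0.
rewrite lt_min => /andP[yx1 yxe].
apply: le_trans (KP x y _ _) _; first by rewrite lerDl.
- rewrite -[y](subrK x) (le_trans (ler_normD _ _))// addrC lerD2l distrC.
  exact: ltW.
- move: yxe; rewrite ltr_pdivlMr// => /ltW; apply: le_trans.
  by rewrite mulrC ler_wpM2l// lerDl.
Unshelve. all: by end_near. Qed.

Lemma Rint_cst x y c : x <= y -> \int[leb]_(_ in `]x, y]) c = c * (y - x).
Proof.
move=> xy; rewrite Rintegral_cst//= lebesgue_measure_itv/= lte_fin.
have [xy'|yx] := ltP x y; first by rewrite -EFinD.
by have -> : x = y; [lra|rewrite subrr].
Qed.

(* On a short interval [Phi (F y) - Phi (F x)] is [Phi' (F xi) * (F y - F x)] by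
   the mean and intermediate value theorems, which differs from the integral of
   [Phi' (F t) * f t] by at most [e] times the integral of [|f|]. *)
Lemma AC_chain_step a b F f (Phi Phi' : R -> R) (e : R) : a <= b -> AC a b F f ->
  (forall r : R, is_derive r 1 Phi (Phi' r)) -> locally_lipschitz Phi' -> 0 < e ->
  exists2 d : R, 0 < d & forall x y, a <= x -> x <= y -> y <= b -> y - x < d ->
    `|Phi (F y) - Phi (F x) - \int[leb]_(t in `]x, y]) (Phi' (F t) * f t)|
      <= e * \int[leb]_(t in `]x, y]) `|f t|.
Proof.
move=> ab acF dPhi lPhi e0; have [M M0 FM] := AC_bounded ab acF.
have [K K0 KP] := lPhi M.
have K1 : 0 < K + 1 by rewrite ltr_wpDl.
(* [d] makes [F] oscillate by at most [e / (K + 1)], hence [Phi' \o F] by at most [e]; [K + 1]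
   avoids dividing by a zero Lipschitz constant. *)
have [d d0 dP] := AC_uniform acF (divr_gt0 e0 K1).
exists d => // x y ax xy yb yxd.
have acxy := AC_itg acF ax yb.
have inx t : x <= t -> t <= y -> a <= t <= b.
  by move=> xt ty; rewrite (le_trans ax xt) (le_trans ty yb).
have nxy : itg `]x, y] (fun t => `|f t|) by exact: integrable_norm.
have osc s t : x <= s -> s <= t -> t <= y -> `|F t - F s| <= e / (K + 1).
  move=> xs st ty; apply: le_trans (dP _ _ ax xy yb yxd).
  apply: le_trans (AC_dist acF (le_trans ax xs) st (le_trans ty yb)) _.
  by apply: le_Rint_subset => //; apply: subset_itv; rewrite bnd_simp.
have osc2 s t : x <= s <= y -> x <= t <= y -> `|F t - F s| <= e / (K + 1).
  move=> /andP[xs sy] /andP[xt ty]; have [st|/ltW ts] := leP s t; first exact: osc.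
  by rewrite distrC; exact: osc.
have cPhi r : {for r, continuous Phi}.
  by apply/differentiable_continuous/derivable1_diffP; have [] := dPhi r.
have [xi /andP[x1 x2] xiE] : exists2 xi, x <= xi <= y &
    Phi (F y) - Phi (F x) = Phi' (F xi) * (F y - F x).
  have cF : {within `[x, y], continuous F}.
    apply: continuous_subspaceW (AC_continuous ab acF).
    by apply: subset_itv; rewrite bnd_simp.
  have mvt u v : u < v -> exists2 c, u < c < v & Phi v - Phi u = Phi' c * (v - u).
    move=> uv; have [|c cuv cE] := @MVT _ Phi Phi' _ _ uv; last by exists c.
    by apply: continuous_subspaceT => r; exact: cPhi.
  have ivt c : Num.min (F x) (F y) <= c <= Num.max (F x) (F y) ->
      exists2 xi, x <= xi <= y & F xi = c.
    by move=> /(IVT xy cF)[xi xiP <-]; exists xi.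
  have [Fxy|Fyx|Fxy] := ltgtP (F x) (F y); last first.
  - by exists x; rewrite ?lexx// Fxy !subrr mulr0.
  - have [c /andP[c1 c2] cE] := mvt _ _ Fyx.
    have [|xi xiP xiE] := ivt c; last first.
      by exists xi => //; rewrite xiE -opprB cE -mulrN opprB.
    by rewrite ge_min le_max (ltW c1) (ltW c2) !orbT.
  - have [c /andP[c1 c2] cE] := mvt _ _ Fxy.
    have [|xi xiP xiE] := ivt c; last by exists xi => //; rewrite xiE.
    by rewrite ge_min le_max (ltW c1) (ltW c2) orbT.
have mPF : measurable_fun `]x, y] (fun t => Phi' (F t)).
  apply: (measurableT_comp (continuous_measurable_fun (locally_lipschitz_continuous lPhi))).
  apply: measurable_funS (AC_measurable ab acF) => //.
  by apply: subset_itv; rewrite bnd_simp.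
have bPF t : `]x, y]%classic t -> `|Phi' (F t) - Phi' (F xi)| <= e.
  rewrite /= in_itv/= => /andP[xt ty].
  apply: le_trans (KP _ _ (FM _ (inx _ (ltW xt) ty)) (FM _ (inx _ x1 x2))) _.
  apply: le_trans (ler_wpM2l K0 (osc2 _ _ _ _)) _; rewrite ?x1 ?x2 ?(ltW xt) ?ty//.
  by rewrite mulrCA ler_piMr ?(ltW e0)// ler_pdivrMr// mul1r lerDl.
have i1 : itg `]x, y] (fun t => (Phi' (F t) - Phi' (F xi)) * f t).
  by apply: (integrable_bounded_mul (c := e)) => //; apply: measurable_funB.
have i2 : itg `]x, y] (fun t => Phi' (F xi) * f t).
  exact: integrable_scale.
have -> : Phi (F y) - Phi (F x) - \int[leb]_(t in `]x, y]) (Phi' (F t) * f t)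
  = - \int[leb]_(t in `]x, y]) ((Phi' (F t) - Phi' (F xi)) * f t).
  rewrite xiE (AC_sub acF ax xy yb) -RintegralZl//.
  have -> : \int[leb]_(t in `]x, y]) (Phi' (F t) * f t) =
      \int[leb]_(t in `]x, y]) ((Phi' (F t) - Phi' (F xi)) * f t) +
      \int[leb]_(t in `]x, y]) (Phi' (F xi) * f t).
    rewrite -RintegralD//; apply: eq_Rintegral => t _; ring.
  ring.
rewrite normrN; apply: le_trans (le_normr_Rintegral _ _) _ => //.
rewrite -RintegralZl//; apply: le_Rintegral => //.
- exact: integrable_norm.
- exact: integrable_scale.
by move=> t txy; rewrite normrM ler_wpM2r// bPF.
Qed.

(** The error in [AC_chain_step] is at most [e] times the integral of [|f|], which is additive, so
    [step_partition] sums the errors to [e * V x]; as [e] is arbitrary, the total error vanishes. *)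
Lemma AC_chain a b F f (Phi Phi' : R -> R) : a <= b -> AC a b F f ->
  (forall r : R, is_derive r 1 Phi (Phi' r)) -> locally_lipschitz Phi' ->
  AC a b (Phi \o F) (fun t => Phi' (F t) * f t).
Proof.
move=> ab acF dPhi lPhi.
have [M M0 FM] := AC_bounded ab acF.
have [K K0 KP] := lPhi M.
have int : itg `]a, b] (fun t => Phi' (F t) * f t).
  apply: (integrable_bounded_mul (c := K * (M + M) + `|Phi' (F a)|)) => //;
    last by case: acF.
    apply: (measurableT_comp (continuous_measurable_fun (locally_lipschitz_continuous lPhi))).
    apply: measurable_funS (AC_measurable ab acF) => //.
    by apply: subset_itv; rewrite bnd_simp.
  move=> t /=; rewrite in_itv/= => /andP[xt ty].
  rewrite -[Phi' _](subrK (Phi' (F a))) (le_trans (ler_normD _ _))// lerD2r.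
  have Ft : `|F t| <= M by rewrite FM// (ltW xt).
  have Fa : `|F a| <= M by rewrite FM// lexx.
  apply: le_trans (KP _ _ Ft Fa) _; rewrite ler_wpM2l//.
  by rewrite (le_trans (ler_normB _ _))// lerD.
split=> // x /andP[ax xb] /=.
apply/eqP; rewrite -subr_eq0 opprD addrA; apply/eqP.
have fi : itg `]a, b] (fun t => `|f t|) by apply: integrable_norm; case: acF.
set I := fun x => \int[leb]_(t in `]a, x]) (Phi' (F t) * f t).
set V := fun x => \int[leb]_(t in `]a, x]) `|f t|.
have key e : 0 < e -> `|Phi (F x) - Phi (F a) - I x| <= e * V x.
  move=> e0; have [d d0 dP] := AC_chain_step ab acF dPhi lPhi e0.
  (* [step_partition] handles one-sided inequalities; the signs [s = 1] and [s = -1] together give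
     the absolute value. *)
  have aux s : `|s| = 1 -> s * (Phi (F x) - Phi (F a) - I x) <= e * V x.
    move=> s1.
    have := @step_partition a b (fun x => s * (Phi (F x) - I x)) (fun x => e * V x)
      d d0 _ a x (lexx _) ax xb.
    have -> : I a = 0 by rewrite /I set_itv_ge ?Rintegral_set0// bnd_simp ltxx.
    have -> : V a = 0 by rewrite /V set_itv_ge ?Rintegral_set0// bnd_simp ltxx.
    rewrite mulr0 !subr0 => H; apply: le_trans (H _); first lra.
    move=> u v au uv vb vud; rewrite -mulrBr -mulrBr.
    have -> : V v - V u = \int[leb]_(t in `]u, v]) `|f t|.
      rewrite /V Rintegral_itvB//.
      by apply: integrableS fi => //; apply: subset_itvl; rewrite bnd_simp.
    have -> : Phi (F v) - I v - (Phi (F u) - I u) =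
        Phi (F v) - Phi (F u) - (I v - I u) by ring.
    have -> : I v - I u = \int[leb]_(t in `]u, v]) (Phi' (F t) * f t).
      rewrite /I Rintegral_itvB//.
      by apply: integrableS int => //; apply: subset_itvl; rewrite bnd_simp.
    apply: le_trans (dP u v au uv vb vud).
    by apply: le_trans (ler_norm _) _; rewrite normrM s1 mul1r.
  rewrite ler_norml; have := aux 1 (normr1 _); have := aux (-1) (normrN1 _).
  by move=> h1 h2; apply/andP; split; lra.
have V0 : 0 <= V x by exact: Rintegral_ge0.
apply/eqP; rewrite -normr_le0; apply/ler_addgt0Pl => e e0; rewrite addr0.
apply: le_trans (key _ (divr_gt0 e0 (ltr_wpDl V0 ltr01))) _.
by rewrite -mulrA ler_piMr ?(ltW e0)// mulrC ler_pdivrMr ?ltr_wpDl// mul1r lerDl.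
Qed.

End AbsolutelyContinuous.

Local Notation AC := antiderivative.
Local Notation jm := jointly_measurable.

(** * Calculus of absolutely continuous functions modulo null sets *)

Section AbsolutelyContinuousCalculus.
Context {R : realType}.
Local Notation leb := (@lebesgue_measure R).
Local Notation itg D f := (leb.-integrable D (EFin \o f)).
Implicit Types (a b x y : R) (f g F G : R -> R).

Lemma ae_imp (P Q : R -> Prop) : {ae leb, forall x, P x} ->
  (forall x, P x -> Q x) -> {ae leb, forall x, Q x}.
Proof.
by move=> aP PQ; apply: (@filterS _ _ (ae_filter_ringOfSetsType leb)) aP.
Qed.

Lemma ae_imp2 (P1 P2 Q : R -> Prop) : {ae leb, forall x, P1 x} ->
  {ae leb, forall x, P2 x} -> (forall x, P1 x -> P2 x -> Q x) ->
  {ae leb, forall x, Q x}.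
Proof.
move=> a1 a2 H.
by apply: (@filterS2 _ _ (ae_filter_ringOfSetsType leb)) a1 a2.
Qed.

Lemma ae_and (P Q : R -> Prop) : {ae leb, forall x, P x} -> {ae leb, forall x, Q x} ->
  {ae leb, forall x, P x /\ Q x}.
Proof. by move=> HP HQ; apply: ae_imp2 HP HQ _. Qed.

Lemma ae_true (P : R -> Prop) : (forall x, P x) -> {ae leb, forall x, P x}.
Proof. exact: (@aeW _ _ _ leb). Qed.

Lemma ae_count (I : countType) (P : I -> R -> Prop) :
  (forall i, {ae leb, forall x, P i x}) -> {ae leb, forall x, forall i, P i x}.
Proof.
move=> aP; pose P' n x := if @unpickle I n is Some i then P i x else True.
have : {ae leb, forall x, forall n, P' n x}.
  by apply: ae_foralln => n; rewrite /P'; case: unpickle => [i|]; [exact: aP|exact: ae_true].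
move/ae_imp; apply=> x H i; have := H (pickle i); by rewrite /P' pickleK.
Qed.

Lemma ae_neq b : {ae leb, forall x, x <> b}.
Proof.
exists [set b]; split => //; first by rewrite lebesgue_measure_set1.
by move=> x /= /contrapT.
Qed.

Lemma ae_itv_point (P : R -> Prop) x y : x < y -> {ae leb, forall t, P t} ->
  exists2 t, x < t < y & P t.
Proof.
move=> xy [N [mN N0 PN]]; apply: contrapT => nP.
have : (leb `]x, y[ <= leb N)%E.
  apply: le_measure; rewrite ?inE// => t /= txy; apply: PN => /= Pt.
  by apply: nP; exists t => //; move: txy; rewrite in_itv.
by rewrite N0 lebesgue_measure_itv/= lte_fin xy -EFinD lee_fin leNgt subr_gt0 xy.
Qed.

Lemma ae_Rint_eq (D : set R) f g : measurable D ->
  measurable_fun D f -> measurable_fun D g ->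
  {ae leb, forall x, D x -> f x = g x} ->
  \int[leb]_(x in D) f x = \int[leb]_(x in D) g x.
Proof.
move=> mD mf mg fg; rewrite /Rintegral; congr fine.
apply: ae_eq_integral => //; try exact/measurable_EFinP.
by apply: (ae_imp fg) => x /= H /H ->.
Qed.

Lemma itg_measurable (D : set R) f : itg D f -> measurable_fun D f.
Proof. by move=> /integrableP[/measurable_EFinP]. Qed.

Lemma ae_integrable (D : set R) f g : measurable D -> measurable_fun D g ->
  {ae leb, forall x, D x -> f x = g x} -> itg D f -> itg D g.
Proof.
move=> mD mg fg fi; have [mf foo] := integrableP _ _ _ fi.
apply/integrableP; split; first exact/measurable_EFinP.
have <- : (\int[leb]_(x in D) `|(EFin \o f) x| =
    \int[leb]_(x in D) `|(EFin \o g) x|)%E => //.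
apply: ae_eq_integral => //.
- exact: measurableT_comp.
- by apply: measurableT_comp => //; exact/measurable_EFinP.
- by apply: (ae_imp fg) => x /= H /H ->.
Qed.

Lemma AC_ae a b F f g : measurable_fun `]a, b] g ->
  {ae leb, forall x, x \in `]a, b[ -> f x = g x} -> AC a b F f -> AC a b F g.
Proof.
move=> mg fg [fi FE].
have fg' : {ae leb, forall x, `]a, b]%classic x -> f x = g x}.
  apply: ae_imp2 (ae_neq b) fg _ => x xb H /=; rewrite in_itv/= => /andP[ax xb'].
  by apply: H; rewrite in_itv/= ax lt_neqAle xb' andbT; exact/eqP.
split; first exact: ae_integrable fg' fi.
move=> x xab; rewrite FE//; congr (_ + _).
have sub : `]a, x] `<=` `]a, b].
  by apply: subset_itvl; rewrite bnd_simp; case/andP: xab.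
apply: ae_Rint_eq => //.
- by apply: measurable_funS sub _ => //; exact: itg_measurable fi.
- exact: measurable_funS sub mg.
- by apply: (ae_imp fg') => y H /sub /H.
Qed.

Lemma AC_eq a b F f g : {in `]a, b], f =1 g} -> AC a b F f -> AC a b F g.
Proof.
move=> fg [fi FE]; split.
  by apply: eq_integrable fi => // x xab /=; rewrite fg//; move: xab; rewrite inE.
move=> x /andP[ax xb]; rewrite FE ?ax//; congr (_ + _).
apply: eq_Rintegral => t; rewrite inE/= => tx; apply: fg.
by move: tx; rewrite !in_itv/= => /andP[-> /le_trans->].
Qed.

Lemma AC_prim a b f c : itg `]a, b] f ->
  AC a b (fun x => c + \int[leb]_(t in `]a, x]) f t) f.
Proof.
move=> fi; split=> // x _; rewrite (_ : `]a, a]%classic = set0).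
  by rewrite Rintegral_set0 addr0.
by rewrite set_itv_ge// bnd_simp ltxx.
Qed.

Lemma integrable_add (D : set R) f g : measurable D -> itg D f -> itg D g ->
  itg D (fun x => f x + g x).
Proof.
move=> mD fi gi.
rewrite (_ : _ \o _ = (EFin \o f) \+ (EFin \o g))%E; last by apply/funext.
exact: integrableD.
Qed.

Lemma AC_add a b F f G g : AC a b F f -> AC a b G g ->
  AC a b (fun x => F x + G x) (fun x => f x + g x).
Proof.
move=> [fi FE] [gi GE]; split; first exact: integrable_add.
move=> x xab; rewrite FE// GE// RintegralD//; first by rewrite addrACA.
- by apply: integrableS fi => //; apply: subset_itvl; rewrite bnd_simp; case/andP: xab.
- by apply: integrableS gi => //; apply: subset_itvl; rewrite bnd_simp; case/andP: xab.
Qed.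

Lemma AC_scale a b F f (c : R) : AC a b F f ->
  AC a b (fun x => c * F x) (fun x => c * f x).
Proof.
move=> [fi FE]; split; first exact: integrable_scale.
move=> x xab; rewrite FE// mulrDr RintegralZl//.
by apply: integrableS fi => //; apply: subset_itvl; rewrite bnd_simp; case/andP: xab.
Qed.

Lemma locally_lipschitz_C1 f (f' : R -> R) :
  (forall x : R, is_derive x 1 f (f' x)) -> continuous f' -> locally_lipschitz f.
Proof.
move=> df cf' M.
have [M0|M0] := ltP M 0.
  exists 0 => // r s; have := normr_ge0 r; lra.
have [||c _ cP] := @EVT_max R (fun x => `|f' x|) (- M) M.
- lra.
- apply: continuous_subspaceT => x.
  by apply: continuous_comp; [exact: cf'|exact: norm_continuous].
exists `|f' c| => //.
have H r s : `|r| <= M -> `|s| <= M -> r <= s ->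
    `|f r - f s| <= `|f' c| * `|r - s|.
  move=> rM sM rs.
  have [|x xrs fE] := @MVT_segment _ f f' _ _ rs.
    apply: continuous_subspaceT => x.
    by apply/differentiable_continuous/derivable1_diffP; have [] := df x.
  rewrite distrC [`|r - s|]distrC fE normrM ler_wpM2r// cP//.
  move: xrs rM sM; rewrite !in_itv/= !ler_norml => /andP[r1 r2] /andP[r3 _] /andP[_ r4].
  by rewrite (le_trans r3)// (le_trans r2).
move=> r s rM sM; have [rs|/ltW sr] := leP r s; first exact: H.
by rewrite distrC [`|r - s|]distrC; exact: H.
Qed.

(** Polarization: [F G] is half of [(F + G)^2 - F^2 - G^2], so the product rule is the chain rule
    for squaring. *)
Lemma AC_mul a b F f G g : a <= b -> AC a b F f -> AC a b G g ->
  AC a b (fun x => F x * G x) (fun x => f x * G x + F x * g x).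
Proof.
move=> ab acF acG.
have sq H h : AC a b H h -> AC a b (fun x => H x ^+ 2) (fun x => 2 * H x * h x).
  move=> acH; apply: (AC_chain (Phi := fun r => r ^+ 2) (Phi' := fun r => 2 * r) ab acH).
    move=> r; split; first exact: exprn_derivable.
    by rewrite exp_derive [LHS]mulr1 expr1.
  move=> M; exists 2 => // r s _ _.
  by rewrite -mulrBr normrM ger0_norm.
have := AC_scale 2^-1 (AC_add (sq _ _ (AC_add acF acG))
  (AC_scale (-1) (AC_add (sq _ _ acF) (sq _ _ acG)))).
set H := (H in AC _ _ H _) => acH.
have -> : (fun x => F x * G x) = H by apply/funext => x; rewrite /H; field.
by apply: AC_eq acH => t _; field.
Qed.

Lemma AC_ibp a b F f G g : a <= b -> AC a b F f -> AC a b G g ->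
  \int[leb]_(t in `]a, b]) (f t * G t + F t * g t) = F b * G b - F a * G a.
Proof.
move=> ab acF acG; have [_ ->] := AC_mul ab acF acG.
  by rewrite addrC addKr.
by rewrite lexx ab.
Qed.

Lemma AC_C1 a b F (F' : R -> R) : a <= b ->
  (forall x : R, is_derive x 1 F (F' x)) -> locally_lipschitz F' -> AC a b F F'.
Proof.
move=> ab dF lF.
have acid : AC a b id (cst 1).
  have c1 : itg `]a, b] (cst 1).
    apply/integrable_obnd_cbnd; apply: continuous_compact_integrable.
      exact: segment_compact.
    by apply: continuous_subspaceT => x; exact: cvg_cst.
  split => // x /andP[ax xb]; rewrite Rint_cst// mul1r; lra.
apply: AC_eq (AC_chain ab acid dF lF).
by move=> x _ /=; rewrite mulr1.
Qed.

Lemma AC_limit_point a b x d : a < b -> a <= x <= b -> 0 < d ->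
  exists c e, [/\ a <= c, c < e, e <= b & forall y, c < y < e -> `|y - x| < d].
Proof.
move=> ab /andP[ax xb] d0.
exists (Num.max a (x - d)), (Num.min b (x + d)).
split; rewrite ?le_max ?ge_min ?lexx//.
  by rewrite gt_max !lt_min ab/=; apply/andP; split; [|apply/andP; split]; lra.
move=> y; rewrite gt_max lt_min => /andP[/andP[_ h1] /andP[_ h2]].
by rewrite ltr_norml; apply/andP; split; lra.
Qed.

Lemma AC_close a b F f x y e d : AC a b F f -> a <= x <= b -> a <= y <= b ->
  (forall x y, a <= x -> x <= y -> y <= b -> y - x < d ->
    \int[leb]_(t in `]x, y]) `|f t| <= e) ->
  `|y - x| < d -> `|F y - F x| <= e.
Proof.
move=> acF /andP[ax xb] /andP[ay yb] H; have [xy|/ltW yx] := leP x y.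
  rewrite ger0_norm ?subr_ge0// => yxd.
  by apply: le_trans (AC_dist acF ax xy yb) _; exact: H.
rewrite [X in X < _]distrC [`|F _ - _|]distrC.
rewrite ger0_norm ?subr_ge0// => yxd.
by apply: le_trans (AC_dist acF ay yx xb) _; exact: H.
Qed.

(** By uniform continuity a value taken on a dense set is taken everywhere, end points included;
    this exploits information at almost every point or at rational points. *)
Lemma AC_dense0 a b F f (c : R) : a < b -> AC a b F f ->
  (forall x y, a <= x -> x < y -> y <= b -> exists2 t, x < t < y & F t = c) ->
  forall x, a <= x <= b -> F x = c.
Proof.
move=> ab acF H x xab; apply/eqP; rewrite -subr_eq0 -normr_le0.
apply/ler_addgt0Pl => e e0; rewrite addr0.
have [d d0 dP] := AC_uniform acF e0.
have [y [z [ay yz zb yzP]]] := AC_limit_point ab xab d0.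
have [t /andP[yt tz] <-] := H _ _ ay yz zb.
rewrite distrC; apply: AC_close acF _ _ dP _ => //.
  by rewrite (le_trans ay (ltW yt)) (le_trans (ltW tz) zb).
by rewrite yzP// yt.
Qed.

Lemma AC_ae0 a b F f (c : R) : a < b -> AC a b F f ->
  {ae leb, forall x, x \in `]a, b[ -> F x = c} ->
  forall x, a <= x <= b -> F x = c.
Proof.
move=> ab acF H; apply: AC_dense0 acF _ => // x y ax xy yb.
have [t /andP[xt ty] tP] := ae_itv_point xy H.
exists t; rewrite ?xt// tP// in_itv/=.
by rewrite (le_lt_trans ax xt) (lt_le_trans ty yb).
Qed.

(** By Lebesgue's differentiation theorem ([FTC1]) the primitive has derivative [f] at almost every
    point, and near an interior point it is constant. *)
Lemma AC_cst_deriv0 a b F f (c : R) : a < b -> AC a b F f ->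
  (forall x, a < x < b -> F x = c) ->
  {ae leb, forall x, x \in `]a, b[ -> f x = 0}.
Proof.
move=> ab acF Fc; have [fi FE] := acF.
have fi' : itg setT (f \_ `]a, b]).
  by rewrite -restrict_EFin; apply/(integrable_mkcond _ _).1.
have fi2 y : itg [set` Interval (BRight a) (BRight y)] (f \_ `]a, b]).
  exact: integrableS fi'.
have FT := FTC1 fi2 (integrable_locally_restrict (measurable_itv _) fi).
apply: (ae_imp FT).
move=> x /= H xab; move: (xab); rewrite in_itv/= => /andP[ax xb].
have [|dF] := H; first exact: ax.
rewrite patchE mem_set/=; last by rewrite in_itv/= ax ltW.
move=> <-; rewrite derive1E.
suff H1 : is_derive x 1 (fun y => \int[leb]_(t in `]a, y]) (f \_ `]a, b]) t) 0.
  exact: derive_val.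
apply: (@near_eq_is_derive _ _ _ (cst (c - F a) : R -> R)).
near=> y => /=.
have ay : a < y by near: y; exact: lt_nbhsr.
have yb : y < b by near: y; exact: lt_nbhsl.
rewrite -(Fc y) ?ay// FE ?(ltW ay) ?(ltW yb)// addrC addKr.
apply: eq_Rintegral => t; rewrite inE/= in_itv/= => /andP[aat ty].
by rewrite patchE mem_set//= in_itv/= aat (le_trans ty)// ltW.
Unshelve. all: by end_near. Qed.

End AbsolutelyContinuousCalculus.

(** * Smooth tents and du Bois-Reymond's lemma *)

Section Tents.
Context {R : realType}.
Local Notation leb := (@lebesgue_measure R).
Local Notation itg D f := (leb.-integrable D (EFin \o f)).
Implicit Types (a b x y : R) (f g h F G : R -> R).

Lemma Rint_dominated (D : set R) (f_ : nat -> R -> R) f g : measurable D ->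
  (forall n, measurable_fun D (f_ n)) -> measurable_fun D f ->
  {ae leb, forall x, D x -> f_ ^~ x @ \oo --> f x} -> itg D g ->
  (forall n x, D x -> `|f_ n x| <= g x) ->
  (fun n => \int[leb]_(x in D) f_ n x) @ \oo --> \int[leb]_(x in D) f x.
Proof.
move=> mD mf_ mf f_f gi f_g.
have [||||| fi _ cv] := @dominated_convergence _ _ _ leb D mD
  (fun n x => (f_ n x)%:E) (EFin \o f) (EFin \o g).
- by move=> n; apply/measurable_EFinP; exact: mf_.
- exact/measurable_EFinP.
- by apply: (ae_imp f_f) => x /= H Dx; apply: cvg_EFin (H Dx); exact: nearW.
- exact: gi.
- by apply: ae_true => x n Dx /=; rewrite lee_fin f_g.
have fin : (\int[leb]_(x in D) (EFin \o f) x)%E \is a fin_num.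
  exact: integrable_fin_num.
by move: cv; rewrite -(fineK fin) => /fine_cvg.
Qed.

(* a smooth approximation of [max(x - s, 0)] *)
Definition rampn (n : nat) (s x : R) : R :=
  n.+1%:R^-1 * ramp (n.+1%:R * x + - (n.+1%:R * s)).
Definition drampn (n : nat) (s x : R) : R :=
  derive1 ramp (n.+1%:R * x + - (n.+1%:R * s)).

Let n1_gt0 n : 0 < n.+1%:R :> R. Proof. by rewrite ltr0n. Qed.

Lemma is_derive_rampn n s x : is_derive x 1 (rampn n s) (drampn n s x).
Proof.
have H := is_derive_affine (is_derive_ramp (n.+1%:R * x + - (n.+1%:R * s))).
have H2 := is_derive_mul (is_derive_cst (n.+1%:R^-1 : R) x 1) H.
by move: H2; rewrite /cst mulr0 addr0 mulrA mulVf ?mul1r ?gt_eqF.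
Qed.

Lemma differentiable_upto_rampn k n s : differentiable_upto k (rampn n s).
Proof. by apply: CnM; [exact: Cn_cst|apply: Cn_affine; exact: Cn_ramp]. Qed.

Lemma differentiable_upto_drampn k n s : differentiable_upto k (drampn n s).
Proof. by apply: Cn_affine; have [] := @Cn_ramp R k.+1. Qed.

Lemma locally_lipschitz_drampn n s : locally_lipschitz (drampn n s).
Proof.
have [_ H1] := differentiable_upto_drampn 1 n s.
apply: (@locally_lipschitz_C1 _ _ (derive1 (drampn n s))).
  exact: (Cn_deriv (differentiable_upto_drampn 0 n s)).
move=> x; apply/differentiable_continuous/derivable1_diffP.
by have [+ _] := H1; apply.
Qed.

Lemma rampn_le n s x : x <= s -> rampn n s x = 0.
Proof.
by move=> xs; rewrite /rampn ramp0 ?mulr0// -mulrBr pmulr_rle0// subr_le0.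
Qed.

Lemma rampn_ge n s x : s + n.+1%:R^-1 <= x -> rampn n s x = x - s.
Proof.
move=> xs; rewrite /rampn -mulrBr ramp1; first by rewrite mulKf// gt_eqF.
by rewrite -ler_pdivrMl// mulr1 lerBrDl.
Qed.

Lemma drampn_lt n s x : x < s -> drampn n s x = 0.
Proof.
by move=> xs; rewrite /drampn dramp_lt0// -mulrBr pmulr_rlt0// subr_lt0.
Qed.

Lemma drampn_gt n s x : s + n.+1%:R^-1 < x -> drampn n s x = 1.
Proof.
move=> xs; rewrite /drampn dramp_gt1// -mulrBr.
by rewrite -ltr_pdivrMl// mulr1 ltrBrDl.
Qed.

Lemma drampn_cvg s x : x <> s ->
  (fun n => drampn n s x) @ \oo --> ((if s < x then 1 else 0) : R).
Proof.
move=> /eqP xs; apply: cvg_near_cst; case: ifPn => [sx|].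
  have xs0 : 0 < x - s by rewrite subr_gt0.
  near=> n; rewrite /drampn dramp_gt1// -mulrBr -ltr_pdivrMl// mulr1.
  by near: n; exact: (near_infty_natSinv_lt (PosNum xs0)).
rewrite -leNgt => xs'; apply: nearW => n; rewrite /drampn dramp_lt0//.
by rewrite -mulrBr pmulr_rlt0// subr_lt0 lt_neqAle xs.
Unshelve. all: by end_near. Qed.

(** How primitives are recovered from smooth tests: the derivatives of the ramps converge to the
    indicator of []s, b]] off the single point [s], dominated through [dramp_bounded]. *)
Lemma cvg_Rint_drampn a b h s : itg `]a, b] h -> a <= s ->
  (fun n => \int[leb]_(x in `]a, b]) (h x * drampn n s x)) @ \oo -->
  \int[leb]_(x in `]s, b]) h x.
Proof.
move=> hi as_; have [C C0 CP] := @dramp_bounded R.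
have -> : \int[leb]_(x in `]s, b]) h x =
    \int[leb]_(x in `]a, b]) (h x * (if s < x then 1 else 0)).
  rewrite (_ : `]s, b]%classic = `]a, b] `&` `]s, b]); last first.
    apply/seteqP; split=> x /=; rewrite !in_itv/=; last by case.
    by move=> /andP[sx ->]; rewrite sx (le_lt_trans as_ sx).
  rewrite Rintegral_mkcondr; apply: eq_Rintegral => x; rewrite inE/= in_itv/=.
  move=> /andP[ax xb]; rewrite patchE; case: ifPn.
    by rewrite inE/= in_itv/= => /andP[->]; rewrite mulr1.
  rewrite notin_setE/= in_itv/= xb andbT => /negP/negbTE ->.
  by rewrite mulr0.
have mh := itg_measurable hi.
apply: (@Rint_dominated _ _ _ (fun x => C * `|h x|)) => //.
- move=> n; apply: measurable_funM => //.
  apply: (measurable_funS measurableT) => //; apply: continuous_measurable_fun.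
  exact/locally_lipschitz_continuous/locally_lipschitz_drampn.
- apply: measurable_funM => //; apply: measurable_fun_if => //.
  by apply: measurable_fun_ltr.
- apply: (ae_imp (ae_neq s)) => x xs _.
  by apply: cvgM; [exact: cvg_cst|exact: drampn_cvg].
- by apply: integrable_scale => //; exact: integrable_norm.
- by move=> n x _; rewrite normrM mulrC ler_wpM2r// CP.
Qed.

(* The primitive of a difference of normalized (smoothed) indicators of two
   intervals ]s, t[ and ]s', t'[. *)
Definition tent n (s t s' t' : R) x : R :=
  (t' - s') * (rampn n s x - rampn n t x) - (t - s) * (rampn n s' x - rampn n t' x).
Definition dtent n (s t s' t' : R) x : R :=
  (t' - s') * (drampn n s x - drampn n t x) - (t - s) * (drampn n s' x - drampn n t' x).

Lemma is_derive_tent n s t s' t' x :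
  is_derive x 1 (tent n s t s' t') (dtent n s t s' t' x).
Proof.
have H1 (u v w : R) := is_derive_mul (is_derive_cst w x 1)
   (is_derive_add (is_derive_rampn n u x)
   (is_derive_mul (is_derive_cst (-1 : R) x 1) (is_derive_rampn n v x))).
have := is_derive_add (H1 s t (t' - s')) (H1 s' t' (- (t - s))).
set f1 := (f in is_derive _ _ f _).
have -> : f1 = tent n s t s' t'.
  by apply/funext => y; rewrite /f1/= /tent/cst; ring.
move=> H; apply: (is_derive_eq H); rewrite /dtent/cst.
by rewrite !mulr0 !addr0 !mulN1r mulNr.
Qed.

Lemma derive1_tent n s t s' t' :
  derive1 (tent n s t s' t') = dtent n s t s' t'.
Proof.
by apply/funext => x; rewrite derive1E; have D := is_derive_tent n s t s' t' x;
  exact: derive_val.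
Qed.

Lemma smooth_tent n s t s' t' : smooth (tent n s t s' t').
Proof.
apply/smoothP => k.
have H1 (u v w : R) := CnM (Cn_cst k w) (CnD (differentiable_upto_rampn k n u)
   (CnM (Cn_cst k (-1 : R)) (differentiable_upto_rampn k n v))).
have := CnD (H1 s t (t' - s')) (H1 s' t' (- (t - s))).
set f1 := (f in differentiable_upto _ f).
suff -> : f1 = tent n s t s' t' by [].
by apply/funext => y; rewrite /f1/= /tent/cst; ring.
Qed.

(** A smoothed ramp starts at its knot and is known to be affine only from [n.+1%:R^-1] to the right
    of it, so a margin is needed at [b] and none at [a]. *)
Definition admissible_knots a b n (s t s' t' : R) :=
  [/\ a < s, s < t, t + n.+1%:R^-1 < b & [/\ a < s', s' < t' & t' + n.+1%:R^-1 < b]].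

(** To the right of all knots the two differences of ramps are the constants [t - s] and [t' - s'],
    and the cross weights make them cancel: a tent returns to zero because its derivative has mean
    zero. *)
Lemma tent_out a b n s t s' t' : admissible_knots a b n s t s' t' ->
  forall x, (x <= Num.min s s') || (Num.max t t' + n.+1%:R^-1 <= x) ->
  tent n s t s' t' x = 0.
Proof.
move=> [as_ st tb [as' st' tb']] x /orP[|].
  rewrite le_min => /andP[xs xs']; rewrite /tent !rampn_le//; first ring.
  - by rewrite ltW// (le_lt_trans xs').
  - by rewrite ltW// (le_lt_trans xs).
rewrite -lerBrDr ge_max !lerBrDr => /andP[tx tx']; rewrite /tent !rampn_ge//.
- ring.
- by rewrite (le_trans _ tx')// lerD2r ltW.
- by rewrite (le_trans _ tx)// lerD2r ltW.
Qed.

Lemma test_tent a b n s t s' t' : admissible_knots a b n s t s' t' ->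
  test_function a b (tent n s t s' t').
Proof.
move=> H; split; first exact: smooth_tent.
exists (Num.min s s'), (Num.max t t' + n.+1%:R^-1).
have [as_ st tb [as' st' tb']] := H.
split; first by rewrite lt_min as_.
  by rewrite -ltrBrDr gt_max !ltrBrDr tb.
move=> x; rewrite in_itv/= negb_and -!ltNge => xo; apply: (tent_out H).
by case/orP: xo => /ltW ->; rewrite ?orbT.
Qed.

(* The knots are rational: a statement that holds for almost every time for each
   tent then holds, for almost every time, for all tents at once. *)
Definition weak_on_tents a b f g := forall n (s t s' t' : rat),
  admissible_knots a b n (ratr s) (ratr t) (ratr s') (ratr t') ->
  \int[leb]_(x in `]a, b[) (f x * dtent n (ratr s) (ratr t) (ratr s') (ratr t') x) =
  - \int[leb]_(x in `]a, b[) (g x * tent n (ratr s) (ratr t) (ratr s') (ratr t') x).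

Lemma weak_derivative_tents a b f g : weak_derivative a b f g -> weak_on_tents a b f g.
Proof.
move=> [_ _ H] n s t s' t' adm.
by have := H _ (test_tent adm); rewrite derive1_tent.
Qed.

End Tents.

Global Opaque drampn rampn.

Section DuBoisReymond.
Context {R : realType}.
Local Notation leb := (@lebesgue_measure R).
Local Notation itg D f := (leb.-integrable D (EFin \o f)).
Implicit Types (a b x y : R) (f g h F G : R -> R).

Lemma integrable_cst a b (c : R) : itg `]a, b] (cst c).
Proof.
apply/integrable_obnd_cbnd; apply: continuous_compact_integrable.
  exact: segment_compact.
by apply: continuous_subspaceT => x; exact: cvg_cst.
Qed.

Lemma AC_measurable_oc a b F f : a <= b -> AC a b F f ->
  measurable_fun `]a, b] F.
Proof.
move=> ab acF; apply: measurable_funS (AC_measurable ab acF) => //.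
by apply: subset_itv; rewrite bnd_simp.
Qed.

Lemma AC_mul_integrable a b F f g : a <= b -> AC a b F f -> itg `]a, b] g ->
  itg `]a, b] (fun x => F x * g x).
Proof.
move=> ab acF gi; have [M M0 FM] := AC_bounded ab acF.
apply: (integrable_bounded_mul (c := M)) => //; first exact: AC_measurable_oc acF.
by move=> x /=; rewrite in_itv/= => /andP[ax xb]; rewrite FM// ltW.
Qed.

Lemma AC_integrable a b F f : a <= b -> AC a b F f -> itg `]a, b] F.
Proof.
move=> ab acF; apply: eq_integrable (AC_mul_integrable ab acF (integrable_cst a b 1)) => //.
by move=> x _ /=; rewrite mulr1.
Qed.

Lemma Rint_addZ (D : set R) f g (c : R) : measurable D -> itg D f -> itg D g ->
  \int[leb]_(x in D) (f x + c * g x) =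
  \int[leb]_(x in D) f x + c * \int[leb]_(x in D) g x.
Proof.
move=> mD fi gi; rewrite RintegralD//; last exact: integrable_scale.
by rewrite RintegralZl.
Qed.

Lemma Rint_lin4 (D : set R) f1 f2 f3 f4 (c1 c2 c3 c4 : R) : measurable D ->
  itg D f1 -> itg D f2 -> itg D f3 -> itg D f4 ->
  \int[leb]_(x in D) (c1 * f1 x + c2 * f2 x + (c3 * f3 x + c4 * f4 x)) =
  c1 * \int[leb]_(x in D) f1 x + c2 * \int[leb]_(x in D) f2 x +
  (c3 * \int[leb]_(x in D) f3 x + c4 * \int[leb]_(x in D) f4 x).
Proof.
move=> mD i1 i2 i3 i4.
have z f c : itg D f -> itg D (fun x => c * f x) by move=> fi; exact: integrable_scale.
by rewrite !RintegralD ?RintegralZl//; try exact: z; apply: integrable_add => //; exact: z.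
Qed.

Lemma locally_lipschitz_lin f g (c d : R) : locally_lipschitz f ->
  locally_lipschitz g -> locally_lipschitz (fun x => c * f x + d * g x).
Proof.
move=> lf lg M; have [K K0 KP] := lf M; have [L L0 LP] := lg M.
exists (`|c| * K + `|d| * L); first by rewrite addr_ge0// mulr_ge0.
move=> r s rM sM.
have -> : c * f r + d * g r - (c * f s + d * g s) = c * (f r - f s) + d * (g r - g s).
  by ring.
rewrite (le_trans (ler_normD _ _))// !normrM mulrDl -!mulrA.
by apply: lerD; apply: ler_wpM2l => //; [exact: KP|exact: LP].
Qed.

Lemma locally_lipschitz_dtent n (s t s' t' : R) : locally_lipschitz (dtent n s t s' t').
Proof.
pose l := locally_lipschitz_lin (t' - s') (- (t' - s'))
  (locally_lipschitz_drampn n s) (locally_lipschitz_drampn n t).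
pose l' := locally_lipschitz_lin (t - s) (- (t - s))
  (locally_lipschitz_drampn n s') (locally_lipschitz_drampn n t').
have := locally_lipschitz_lin 1 (-1) l l'.
set k := (k in locally_lipschitz k); suff -> : k = dtent n s t s' t' by [].
apply/funext => x; rewrite /k /dtent.
move: (drampn n s x) (drampn n t x) (drampn n s' x) (drampn n t' x) => u v w z.
by ring.
Qed.

Lemma AC_tent a b n (s t s' t' : R) : a <= b ->
  AC a b (tent n s t s' t') (dtent n s t s' t').
Proof.
move=> ab.
exact: AC_C1 ab (is_derive_tent n s t s' t') (locally_lipschitz_dtent n s t s' t').
Qed.

Lemma continuous_mul_integrable a b h f : continuous h -> itg `]a, b] f ->
  itg `]a, b] (fun x => h x * f x).
Proof.
move=> ch fi; have [ab|ba] := leP a b; last first.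
  rewrite set_itv_ge; first exact: integrable_set0.
  by rewrite bnd_simp -leNgt ltW.
have [||c _ cP] := @EVT_max R (fun x => `|h x|) a b.
- by [].
- apply: continuous_subspaceT => x.
  by apply: continuous_comp; [exact: ch|exact: norm_continuous].
apply: (integrable_bounded_mul (c := `|h c|)) => //.
  by apply: (measurable_funS measurableT) => //; exact: continuous_measurable_fun.
by move=> x /=; rewrite in_itv/= => /andP[ax xb]; rewrite cP// in_itv/= xb ltW.
Qed.

(** Integration by parts replaces [g] by its primitive [G]; the boundary terms vanish because a tent
    is zero at both end points. What remains is orthogonality of [f - G] to the derivatives of
    tents. *)
Lemma weak_on_tents_corr a b f g G : a < b -> itg `]a, b[ f -> itg `]a, b[ g ->
  weak_on_tents a b f g -> AC a b G g ->
  forall n (s t s' t' : rat),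
  admissible_knots a b n (ratr s) (ratr t) (ratr s') (ratr t') ->
  \int[leb]_(x in `]a, b]) ((f x - G x) * dtent n (ratr s) (ratr t) (ratr s') (ratr t') x) = 0.
Proof.
move=> ab fi gi H acG n s t s' t' adm.
move/integrable_bndo_bndc in fi; move/integrable_bndo_bndc in gi.
have acT := AC_tent n (ratr s) (ratr t) (ratr s') (ratr t') (ltW ab).
have [dT _] := acT.
have cT : continuous (dtent n (ratr s) (ratr t) (ratr s') (ratr t') : R -> R).
  exact/locally_lipschitz_continuous/locally_lipschitz_dtent.
set T := tent _ _ _ _ _ in acT H *; set T' := dtent _ _ _ _ _ in acT H cT dT *.
have i1 : itg `]a, b] (fun x => f x * T' x).
  by apply: eq_integrable (continuous_mul_integrable cT fi) => // x _ /=; rewrite mulrC.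
have i2 := AC_mul_integrable (ltW ab) acG dT.
have i3 : itg `]a, b] (fun x => g x * T x).
  apply: eq_integrable (AC_mul_integrable (ltW ab) acT gi) => // x _ /=.
  by rewrite mulrC.
have -> : \int[leb]_(x in `]a, b]) ((f x - G x) * T' x) =
  \int[leb]_(x in `]a, b]) (f x * T' x) + (-1) * \int[leb]_(x in `]a, b]) (G x * T' x).
  by rewrite -Rint_addZ//; apply: eq_Rintegral => x _; ring.
have := H _ _ _ _ _ adm; rewrite -/T -/T'.
rewrite !Rintegral_itv_bndo_bndc; [|exact/integrable_bndo_bndc..] => ->.
have := AC_ibp (ltW ab) acG acT.
have -> : T b = 0.
  apply: (tent_out adm); apply/orP; right; case: adm => _ _ tb [_ _ tb'].
  by rewrite -lerBrDr ge_max !lerBrDr !ltW.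
have -> : T a = 0.
  apply: (tent_out adm); apply/orP; left; case: adm => sa _ _ [sa' _ _].
  by rewrite le_min !ltW.
rewrite (@RintegralD _ _ _ leb)// !mulr0 subrr; lra.
Qed.

(** With [h = f - G] and [Hh] a primitive of [h], removing the smoothing of the tents shows that
    [Hh] has the same difference quotient over any two rational intervals. Hence [Hh] is affine, [h]
    is a constant [k] almost everywhere, and [k + G] is the representative. *)
Lemma du_bois_reymond a b f g : a < b -> itg `]a, b[ f -> itg `]a, b[ g ->
  weak_on_tents a b f g ->
  exists2 F, AC a b F g & {ae leb, forall x, x \in `]a, b[ -> f x = F x}.
Proof.
move=> ab fi gi H.
have gi' : itg `]a, b] g by exact/integrable_bndo_bndc.
have fi' : itg `]a, b] f by exact/integrable_bndo_bndc.
have acG := AC_prim 0 gi'; set G := (G in AC _ _ G) in acG.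
have corr := weak_on_tents_corr ab fi gi H acG.
pose h x := f x + (-1) * G x.
have hi : itg `]a, b] h.
  apply: integrable_add => //; apply: integrable_scale => //.
  by apply: AC_integrable acG; exact: ltW.
have acH := AC_prim 0 hi; set Hh := (G in AC _ _ G) in acH.
have alg (c1 c2 B S T S' T' : R) :
    c1 * ((B - S) - (B - T)) - c2 * ((B - S') - (B - T')) = 0 ->
    c1 * (T - S) = c2 * (T' - S').
  by move=> e; lra.
have key (s t s' t' : rat) : a < ratr s -> ratr s < ratr t :> R -> ratr t < b ->
    a < ratr s' -> ratr s' < ratr t' :> R -> ratr t' < b ->
    (ratr t' - ratr s') * (Hh (ratr t) - Hh (ratr s)) =
    (ratr t - ratr s) * (Hh (ratr t') - Hh (ratr s')).
  move=> as_ st tb as' st' tb'.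
  have cv (u : rat) : a < ratr u -> ratr u < b ->
      (fun n => \int[leb]_(x in `]a, b]) (h x * drampn n (ratr u) x)) @ \oo -->
      Hh b - Hh (ratr u).
    move=> au ub; rewrite (AC_sub acH (ltW au) (ltW ub) (lexx _)).
    by apply: cvg_Rint_drampn => //; exact: ltW.
  have at_ := lt_trans as_ st; have at' := lt_trans as' st'.
  have sb := lt_trans st tb; have sb' := lt_trans st' tb'.
  pose J (u : rat) n := \int[leb]_(x in `]a, b]) (h x * drampn n (ratr u) x).
  have cv4 : (fun n => (ratr t' - ratr s') * (J s n - J t n) -
      (ratr t - ratr s) * (J s' n - J t' n)) @ \oo -->
      (ratr t' - ratr s') * ((Hh b - Hh (ratr s)) - (Hh b - Hh (ratr t))) -
      (ratr t - ratr s) * ((Hh b - Hh (ratr s')) - (Hh b - Hh (ratr t'))).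
    by apply: cvgB; apply: cvgM; (try exact: cvg_cst); apply: cvgB; exact: cv.
  have cv0 : (fun n => \int[leb]_(x in `]a, b])
      (h x * dtent n (ratr s) (ratr t) (ratr s') (ratr t') x)) @ \oo --> (0 : R).
    (* For large [n] the margin [n.+1%:R^-1] fits before [b], so the tents are admissible and the
       integrals vanish from some rank on. *)
    apply: cvg_near_cst; near=> n.
    rewrite -[RHS](corr n s t s' t'); last first.
      split => //; last split => //.
      + rewrite -ltrBrDl; near: n.
        have xs0 : 0 < b - ratr t by rewrite subr_gt0.
        exact: (near_infty_natSinv_lt (PosNum xs0)).
      + rewrite -ltrBrDl; near: n.
        have xs0 : 0 < b - ratr t' by rewrite subr_gt0.
        exact: (near_infty_natSinv_lt (PosNum xs0)).
    by apply: eq_Rintegral => x _; rewrite /h mulN1r.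
  have id n (u : rat) : itg `]a, b] (fun x => h x * drampn n (ratr u) x).
    apply: eq_integrable (continuous_mul_integrable (h := drampn n (ratr u)) _ hi) => //.
      by move=> x _ /=; rewrite mulrC.
    exact/locally_lipschitz_continuous/locally_lipschitz_drampn.
  have E : (fun n => \int[leb]_(x in `]a, b])
      (h x * dtent n (ratr s) (ratr t) (ratr s') (ratr t') x)) =
    (fun n => (ratr t' - ratr s') * (J s n - J t n) -
     (ratr t - ratr s) * (J s' n - J t' n)).
    apply/funext => n.
    set c1 := ratr t' - ratr s'; set c2 := ratr t - ratr s.
    have := Rint_lin4 c1 (- c1) (- c2) c2 (measurable_itv _)
      (id n s) (id n t) (id n s') (id n t').
    move=> E4; transitivity (\int[leb]_(x in `]a, b])
      (c1 * (h x * drampn n (ratr s) x) + - c1 * (h x * drampn n (ratr t) x) +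
      (- c2 * (h x * drampn n (ratr s') x) + c2 * (h x * drampn n (ratr t') x)))).
      apply: eq_Rintegral => x _; rewrite /dtent -/c1 -/c2.
      move: (h x) (drampn n _ x) (drampn n _ x) (drampn n _ x) (drampn n _ x).
      by move=> v0 v1 v2 v3 v4; ring.
    by rewrite E4 !mulNr 2!mulrBr opprB [- _ + c2 * _]addrC.
  rewrite E in cv0.
  by apply: alg; exact: (cvg_unique (@Rhausdorff R) cv4 cv0).
have [q1 /[!in_itv]/= /andP[aq1 q1b]] := rat_in_itvoo ab.
have [q2 /[!in_itv]/= /andP[q12 q2b]] := rat_in_itvoo q1b.
(* The common slope, computed on one fixed rational interval; subtracting it from [Hh] leaves a
   function constant at rational points. *)
pose k : R := (Hh (ratr q2) - Hh (ratr q1)) / (ratr q2 - ratr q1).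
have acK := AC_add acH (AC_prim 0 (integrable_cst a b (- k))).
set K := (K in AC _ _ K) in acK.
have KE x : a <= x -> K x = Hh x - k * (x - a).
  by move=> ax; rewrite /K Rint_cst// add0r mulNr.
have q21 : ratr q2 - ratr q1 != 0 :> R by rewrite subr_eq0 gt_eqF.
have KK (s t : rat) : a < ratr s -> ratr s < ratr t :> R -> ratr t < b ->
    K (ratr t) = K (ratr s).
  move=> as_ st tb; have := key s t q1 q2 as_ st tb aq1 q12 q2b.
  rewrite !KE ?ltW ?(lt_trans as_ st)// => e.
  have : Hh (ratr t) - Hh (ratr s) = k * (ratr t - ratr s).
    by apply: (mulfI q21); rewrite e /k; field.
  lra.
have Kc : forall x, a <= x <= b -> K x = K (ratr q1).
  apply: AC_dense0 acK _ => // x y ax xy yb.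
  have [q /[!in_itv]/= /andP[xq qy]] := rat_in_itvoo xy.
  exists (ratr q); first by rewrite xq.
  have aq := le_lt_trans ax xq; have qb := lt_le_trans qy yb.
  have [q1q|qq1|->//] := ltgtP (ratr q1 : R) (ratr q); first exact: KK.
  by rewrite (KK q q1).
have H0 := AC_cst_deriv0 ab acK (fun x (h : a < x < b) => Kc x ltac:(by case/andP: h => /ltW -> /ltW ->)).
exists (fun x => k + \int[leb]_(t in `]a, x]) g t); first exact: AC_prim.
apply: (ae_imp H0) => x /= H1 /H1; rewrite /h /G add0r; lra.
Unshelve. all: by end_near. Qed.

Lemma weak_on_tents0 a b g : a < b -> itg `]a, b[ g ->
  weak_on_tents a b (cst 0) g -> {ae leb, forall x, x \in `]a, b[ -> g x = 0}.
Proof.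
move=> ab gi H; have i0 : itg `]a, b[ (cst 0) by exact: integrable0.
have [F acF F0] := du_bois_reymond ab i0 gi H.
have F0' : {ae leb, forall x, x \in `]a, b[ -> F x = 0}.
  by apply: (ae_imp F0) => x H1 /H1.
have Fz := AC_ae0 ab acF F0'.
apply: (AC_cst_deriv0 ab acF (c := 0)) => x /andP[ax xb].
by apply: Fz; rewrite !ltW.
Qed.

End DuBoisReymond.

(** * The weak Neumann problem tested on rational ramps *)

Section Neumann.
Context {R : realType}.
Local Notation leb := (@lebesgue_measure R).
Local Notation itg D f := (leb.-integrable D (EFin \o f)).
Implicit Types (a b x y : R) (f g h F G : R -> R).

(** Ramps do not vanish at [b], and the first clause is the test with the constant [1]: this is the
    weak form of [k' = f] with zero flux at both ends, restricted to countably many tests. *)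
Definition weak_on_ramps a b f k :=
  \int[leb]_(x in `]a, b[) f x = 0 /\
  forall n (s : rat), a < ratr s < b ->
  \int[leb]_(x in `]a, b[) (f x * rampn n (ratr s) x) +
  \int[leb]_(x in `]a, b[) (k x * drampn n (ratr s) x) = 0.

Lemma AC_rampn a b n (s : R) : a <= b -> AC a b (rampn n s) (drampn n s).
Proof.
move=> ab; exact: AC_C1 ab (is_derive_rampn n s) (locally_lipschitz_drampn n s).
Qed.

(** [P] is the primitive of [f] vanishing at [a]; the test with [1] makes it vanish at [b].
    Integrating by parts against ramps and removing the smoothing gives [\int (k - P) = 0] over []s,
    b]] for every rational [s], hence [k = P] almost everywhere. *)
Lemma neumann_flux a b f k : a < b -> itg `]a, b] f -> itg `]a, b] k ->
  weak_on_ramps a b f k ->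
  exists P, [/\ AC a b P f, P a = 0, P b = 0 &
    {ae leb, forall x, x \in `]a, b[ -> k x = P x}].
Proof.
move=> ab fi ki [f0 H]; have acP := AC_prim 0 fi; set P := (G in AC _ _ G) in acP.
have Pa : P a = 0.
  by rewrite /P set_itv_ge ?bnd_simp ?ltxx// Rintegral_set0 addr0.
have Pb : P b = 0.
  by rewrite /P add0r -f0 Rintegral_itv_bndo_bndc//; exact/integrable_bndo_bndc.
exists P; split => //.
pose h x := k x + (-1) * P x.
have hi : itg `]a, b] h.
  apply: integrable_add => //; apply: integrable_scale => //.
  by apply: AC_integrable acP; exact: ltW.
have acH := AC_prim 0 hi; set Hh := (G in AC _ _ G) in acH.
have cont n (s : R) : continuous (drampn n s : R -> R).
  exact/locally_lipschitz_continuous/locally_lipschitz_drampn.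
have key (s : rat) : a < ratr s -> ratr s < b -> Hh (ratr s) = Hh b.
  move=> as_ sb.
  have cv : (fun n => \int[leb]_(x in `]a, b]) (h x * drampn n (ratr s) x)) @ \oo -->
      Hh b - Hh (ratr s).
    rewrite (AC_sub acH (ltW as_) (ltW sb) (lexx _)).
    by apply: cvg_Rint_drampn => //; exact: ltW.
  have z n : \int[leb]_(x in `]a, b]) (h x * drampn n (ratr s) x) = 0.
    have acR := AC_rampn n (ratr s) (ltW ab).
    have [dR _] := acR.
    have i1 : itg `]a, b] (fun x => k x * drampn n (ratr s) x).
      apply: eq_integrable (continuous_mul_integrable (cont n (ratr s)) ki) => //.
      by move=> x _ /=; rewrite mulrC.
    have i2 := AC_mul_integrable (ltW ab) acP dR.
    have i3 : itg `]a, b] (fun x => f x * rampn n (ratr s) x).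
      apply: eq_integrable (AC_mul_integrable (ltW ab) acR fi) => // x _ /=.
      by rewrite mulrC.
    have e1 : \int[leb]_(x in `]a, b]) (h x * drampn n (ratr s) x) =
        \int[leb]_(x in `]a, b]) (k x * drampn n (ratr s) x) +
        (-1) * \int[leb]_(x in `]a, b]) (P x * drampn n (ratr s) x).
      rewrite -Rint_addZ//; apply: eq_Rintegral => x _; rewrite /h.
      by move: (k x) (P x) (drampn _ _ _) => u v w; ring.
    have := H n s; rewrite as_ sb => /(_ isT).
    rewrite !Rintegral_itv_bndo_bndc; [|exact/integrable_bndo_bndc..].
    have := AC_ibp (ltW ab) acP acR; rewrite Pa Pb !mul0r subrr.
    rewrite (@RintegralD _ _ _ leb)// => /eqP; rewrite addr_eq0 => /eqP ->.
    by rewrite e1 addrC mulN1r.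
  have cv0 : (fun n => \int[leb]_(x in `]a, b]) (h x * drampn n (ratr s) x)) @ \oo -->
      (0 : R).
    by apply: cvg_near_cst; apply: nearW => n; exact: z.
  by apply/esym/subr0_eq; exact: (cvg_unique (@Rhausdorff R) cv cv0).
have Hc : forall x, a <= x <= b -> Hh x = Hh b.
  apply: AC_dense0 acH _ => // x y ax xy yb.
  have [q /[!in_itv]/= /andP[xq qy]] := rat_in_itvoo xy.
  exists (ratr q); first by rewrite xq.
  by apply: key; [exact: le_lt_trans xq|exact: lt_le_trans yb].
have H0 := AC_cst_deriv0 ab acH (fun x (h : a < x < b) => Hc x ltac:(by case/andP: h => /ltW -> /ltW ->)).
apply: (ae_imp H0) => x /= H1 /H1; rewrite /h mulN1r => /subr0_eq; exact.
Qed.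

Lemma ae_oo_oc a b (Q : R -> Prop) : {ae leb, forall x, x \in `]a, b[ -> Q x} ->
  {ae leb, forall x, `]a, b]%classic x -> Q x}.
Proof.
move=> H; apply: ae_imp2 (ae_neq b) H _ => x xb Hx /=.
rewrite in_itv/= => /andP[ax xb'].
by apply: Hx; rewrite in_itv/= ax lt_neqAle xb' andbT; exact/eqP.
Qed.

(** Enlarges the class of tests from countably many ramps to every absolutely continuous function,
    powers of the temperature included, by integrating by parts with the flux [P], which is zero at
    both ends. *)
Lemma neumann_test a b f k F G : a < b -> itg `]a, b] f -> itg `]a, b] k ->
  weak_on_ramps a b f k -> AC a b F G ->
  \int[leb]_(x in `]a, b]) (f x * F x) + \int[leb]_(x in `]a, b]) (k x * G x) = 0.
Proof.
move=> ab fi ki H acF; have [P [acP Pa Pb kP]] := neumann_flux ab fi ki H.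
have [Gi _] := acF.
have i2 := AC_mul_integrable (ltW ab) acP Gi.
have i3 : itg `]a, b] (fun x => f x * F x).
  apply: eq_integrable (AC_mul_integrable (ltW ab) acF fi) => // x _ /=.
  by rewrite mulrC.
have -> : \int[leb]_(x in `]a, b]) (k x * G x) = \int[leb]_(x in `]a, b]) (P x * G x).
  apply: ae_Rint_eq => //.
  - by apply: measurable_funM; apply: itg_measurable.
  - exact: itg_measurable i2.
  - by apply: (ae_imp (ae_oo_oc kP)) => x /= Hx /Hx ->.
by rewrite -RintegralD// (AC_ibp (ltW ab) acP acF) Pa Pb !mul0r subrr.
Qed.

End Neumann.

(** * The dissipation inequality at a fixed time *)

Section Absorption.
Context {R : realType}.
Local Notation leb := (@lebesgue_measure R).
Local Notation itg D f := (leb.-integrable D (EFin \o f)).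
Implicit Types (a b x y : R) (f g h F G : R -> R).

Lemma integrable_le (D : set R) f g : measurable D -> measurable_fun D f ->
  (forall x, D x -> `|f x| <= g x) -> itg D g -> itg D f.
Proof.
move=> mD mf fg gi; apply: le_integrable gi => //; first exact/measurable_EFinP.
move=> x Dx /=; rewrite lee_fin; apply: le_trans (fg x Dx) _.
exact: ler_norm.
Qed.

Lemma integrable_mul_sqr (D : set R) f g : measurable D ->
  measurable_fun D f -> measurable_fun D g ->
  itg D (fun x => f x ^+ 2) -> itg D (fun x => g x ^+ 2) ->
  itg D (fun x => f x * g x).
Proof.
move=> mD mf mg fi gi; apply: integrable_le (integrable_add mD fi gi) => //.
  exact: measurable_funM.
move=> x Dx /=; rewrite normrM -[f x ^+ 2]real_normK ?num_real// -[g x ^+ 2]real_normK ?num_real//.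
have := sqr_ge0 (`|f x| - `|g x|); have := sqr_ge0 (`|f x| + `|g x|); nra.
Qed.

Lemma integrable_sqr_scale (D : set R) f g (c : R) : measurable D ->
  measurable_fun D f -> (forall x, D x -> `|f x| <= c) ->
  measurable_fun D g -> itg D (fun x => g x ^+ 2) ->
  itg D (fun x => (f x * g x) ^+ 2).
Proof.
move=> mD mf fc mg gi.
have fc2 x : D x -> `|f x ^+ 2| <= c ^+ 2.
  move=> Dx; rewrite normrX ler_pXn2r// ?nnegrE ?fc//.
  by apply: le_trans (fc _ Dx).
apply: eq_integrable (integrable_bounded_mul mD (measurable_funX 2 mf) fc2 gi) => //.
by move=> x _ /=; rewrite exprMn.
Qed.

(** In [absorption], [L] is the length, [X = max |m|], [S = \int |m|], [V = \int |m m'|],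
    [G = \int m'^2], [Y = \int m^2], and [B] is the coupling term. One copy of [G] pays for [B] at
    the price of [c^2 X^2]; the other pays for [2 c^2 X^2], that is for this price and for the
    damping of [Y]. *)
Lemma interpolation_algebra (c L X S G B Y V : R) : 0 < c -> 0 < L -> 0 <= X ->
  L * X ^+ 2 <= X * S + 2 * L * V ->
  2 * c ^+ 2 * V <= G / 4 + 4 * c ^+ 4 * (X * S) ->
  Y <= L * X ^+ 2 -> B <= G + c ^+ 2 * X ^+ 2 ->
  - 2 * G + B <=
    - (c ^+ 2 / L) * Y + 2 * c ^+ 2 * (4 * c ^+ 2 + L^-1) ^+ 2 * S ^+ 2.
Proof.
move=> c0 L0 X0 h1 h2 h3 h4.
have c20 : 0 < c ^+ 2 by rewrite exprn_gt0.
have Li : 0 < L^-1 by rewrite invr_gt0.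
have k1 : c ^+ 2 * X ^+ 2 <= c ^+ 2 / L * (X * S) + 2 * c ^+ 2 * V.
  have : c ^+ 2 / L * (L * X ^+ 2) <= c ^+ 2 / L * (X * S + 2 * L * V).
    by rewrite ler_wpM2l// ltW// mulr_gt0.
  have -> : c ^+ 2 / L * (L * X ^+ 2) = c ^+ 2 * X ^+ 2 by field; rewrite gt_eqF.
  by have -> : c ^+ 2 / L * (X * S + 2 * L * V) =
    c ^+ 2 / L * (X * S) + 2 * c ^+ 2 * V by field; rewrite gt_eqF.
have k2 : c ^+ 2 * X ^+ 2 <=
    G / 4 + c ^+ 2 * (4 * c ^+ 2 + L^-1) * S * X.
  apply: le_trans k1 _.
  have -> : c ^+ 2 * (4 * c ^+ 2 + L^-1) * S * X =
    c ^+ 2 / L * (X * S) + 4 * c ^+ 4 * (X * S) by ring.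
  lra.
set E := 4 * c ^+ 2 + L^-1 in k2 *.
have k3 : c ^+ 2 * E * S * X <= c ^+ 2 * X ^+ 2 / 2 + c ^+ 2 * E ^+ 2 * S ^+ 2 / 2.
  have : 0 <= c ^+ 2 * (X - E * S) ^+ 2 by rewrite mulr_ge0 ?sqr_ge0 ?ltW.
  have -> : c ^+ 2 * (X - E * S) ^+ 2 =
    c ^+ 2 * X ^+ 2 + c ^+ 2 * E ^+ 2 * S ^+ 2 - 2 * (c ^+ 2 * E * S * X) by ring.
  lra.
have k4 : c ^+ 2 / L * Y <= c ^+ 2 * X ^+ 2.
  have : c ^+ 2 / L * Y <= c ^+ 2 / L * (L * X ^+ 2).
    by rewrite ler_wpM2l// ltW// mulr_gt0.
  by have -> : c ^+ 2 / L * (L * X ^+ 2) = c ^+ 2 * X ^+ 2 by field; rewrite gt_eqF.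
have -> : 2 * c ^+ 2 * E ^+ 2 * S ^+ 2 = 2 * (c ^+ 2 * E ^+ 2 * S ^+ 2) by ring.
lra.
Qed.

(* One-dimensional interpolation: with [X = max |m|] one has
   [(b - a) X^2 <= X \int |m| + 2 (b - a) \int |m m'|], and every product is
   absorbed by Young's inequality. *)
Lemma absorption a b m m' (v : R -> R) (nu c : R) : a < b -> AC a b m m' ->
  itg `]a, b] (fun x => m' x ^+ 2) ->
  measurable_fun `]a, b] v -> itg `]a, b] (fun x => v x ^+ 2) ->
  0 < c -> nu ^+ 2 * \int[leb]_(x in `]a, b]) v x ^+ 2 <= c ^+ 2 ->
  - 2 * \int[leb]_(x in `]a, b]) m' x ^+ 2 +
    2 * nu * \int[leb]_(x in `]a, b]) (m x * m' x * v x) <=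
  - (c ^+ 2 / (b - a)) * \int[leb]_(x in `]a, b]) m x ^+ 2 +
  2 * c ^+ 2 * (4 * c ^+ 2 + (b - a)^-1) ^+ 2 *
    (\int[leb]_(x in `]a, b]) `|m x|) ^+ 2.
Proof.
move=> ab acm m2i mv vi c0 cv; have lab := ltW ab.
have [m'i _] := acm; have mm' := itg_measurable m'i.
have mi := AC_integrable lab acm; have mm := itg_measurable mi.
have [||x0 x0ab x0P] := @EVT_max R (fun x => `|m x|) a b.
- by [].
- move=> x; apply: continuous_comp; last exact: norm_continuous.
  exact: (AC_continuous lab acm).
have mX x : a <= x <= b -> `|m x| <= `|m x0| by move=> xab; apply: x0P.
move: x0ab; rewrite in_itv/= => x0ab.
set X := `|m x0| in mX *.
have mX' x : `]a, b]%classic x -> `|m x| <= X.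
  by rewrite /= in_itv/= => /andP[ax xb]; rewrite mX// xb ltW.
have mmi := AC_mul_integrable lab acm m'i.
have nmmi : itg `]a, b] (fun x => `|m x * m' x|) by exact: integrable_norm.
have sqi : itg `]a, b] (fun x => m x ^+ 2).
  by apply: eq_integrable (AC_mul_integrable lab acm mi) => // x _ /=; rewrite expr2.
have nmi : itg `]a, b] (fun x => `|m x|) by exact: integrable_norm.
have acsq : AC a b (fun x => m x ^+ 2) (fun x => 2 * (m x * m' x)).
  by apply: AC_eq (AC_mul lab acm acm) => x _; ring.
pose V := \int[leb]_(x in `]a, b]) `|m x * m' x|.
have X0 : 0 <= X by exact: normr_ge0.
apply: (interpolation_algebra (X := X) (V := V)) => //; rewrite ?subr_gt0//.
(* [m^2] has derivative [2 m m'], so its maximum exceeds any other value by at most [2 V];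
   integrating over [y] gives the interpolation inequality. *)
- have key y : a <= y <= b -> X ^+ 2 <= m y ^+ 2 + 2 * V.
    move=> yab; rewrite -lerBlDl /X real_normK ?num_real//.
    have D u w : a <= u -> u <= w -> w <= b -> `|m w ^+ 2 - m u ^+ 2| <= 2 * V.
      move=> au uw wb; apply: le_trans (AC_dist acsq au uw wb) _.
      rewrite /V -RintegralZl//.
      have -> : \int[leb]_(t in `]u, w]) `|2 * (m t * m' t)| =
          \int[leb]_(t in `]u, w]) (2 * `|m t * m' t|).
        by apply: eq_Rintegral => t _; rewrite normrM ger0_norm.
      apply: le_Rint_subset => //.
      + by apply: subset_itv; rewrite bnd_simp.
      + exact: integrable_scale.
    have /andP[ay yb] := yab; have /andP[ax0 x0b] := x0ab.
    have [yx|/ltW xy] := leP y x0.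
      exact: (le_trans (ler_norm _) (D y x0 ay yx x0b)).
    apply: (le_trans (ler_norm _)); rewrite distrC; exact: (D x0 y ax0 xy yb).
  have -> : (b - a) * X ^+ 2 = \int[leb]_(_ in `]a, b]) X ^+ 2.
    by rewrite Rint_cst// mulrC.
  have -> : X * \int[leb]_(x in `]a, b]) `|m x| + 2 * (b - a) * V =
      \int[leb]_(x in `]a, b]) (2 * V + X * `|m x|).
    rewrite Rint_addZ//; last exact: integrable_cst.
    by rewrite Rint_cst//; ring.
  apply: le_Rintegral => //.
  + exact: integrable_cst.
  + apply: integrable_add => //; first exact: integrable_cst.
    exact: integrable_scale.
  move=> x /= ; rewrite in_itv/= => /andP[ax xb].
  have xab : a <= x <= b by rewrite xb ltW.
  apply: le_trans (key x xab) _; rewrite addrC lerD2l.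
  by rewrite -real_normK ?num_real// expr2 ler_wpM2r// mX.
- have -> : (\int[leb]_(x in `]a, b]) m' x ^+ 2) / 4 + 4 * c ^+ 4 *
      (X * \int[leb]_(x in `]a, b]) `|m x|) =
      4^-1 * \int[leb]_(x in `]a, b]) m' x ^+ 2 +
      4 * c ^+ 4 * X * \int[leb]_(x in `]a, b]) `|m x| by ring.
  rewrite /V -!RintegralZl// -RintegralD//; try exact: integrable_scale.
  apply: le_Rintegral => //; first exact: integrable_scale.
    by apply: integrable_add => //; exact: integrable_scale.
  move=> x Dx; rewrite normrM -(real_normK (num_real (m' x))).
  (* Bounding one factor [|m|] by [X] turns [\int m^2] into [X \int |m|], so that the [L^1] norm
     appears on the right. *)
  have h1 : 4 * c ^+ 4 * (`|m x| * `|m x|) <= 4 * c ^+ 4 * X * `|m x|.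
    by rewrite mulrA ler_wpM2r// ler_wpM2l ?mX'// mulr_ge0// exprn_ge0// ltW.
  have := sqr_ge0 (2^-1 * `|m' x| - 2 * c ^+ 2 * `|m x|).
  have -> : (2^-1 * `|m' x| - 2 * c ^+ 2 * `|m x|) ^+ 2 = 4^-1 * `|m' x| ^+ 2 +
    4 * c ^+ 4 * (`|m x| * `|m x|) - 2 * c ^+ 2 * (`|m x| * `|m' x|) by field.
  lra.
- have -> : (b - a) * X ^+ 2 = \int[leb]_(_ in `]a, b]) X ^+ 2.
    by rewrite Rint_cst// mulrC.
  apply: le_Rintegral => //; first exact: integrable_cst.
  move=> x Dx; rewrite -(real_normK (num_real (m x))) ler_pXn2r// ?nnegrE//.
  exact: mX'.
- apply: (@le_trans _ _ (\int[leb]_(x in `]a, b]) m' x ^+ 2 +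
      X ^+ 2 * (nu ^+ 2 * \int[leb]_(x in `]a, b]) v x ^+ 2))); last first.
    by rewrite lerD2l [leRHS]mulrC ler_wpM2l// sqr_ge0.
  rewrite [X ^+ 2 * _]mulrA -!RintegralZl//; last first.
    have := integrable_mul_sqr (measurable_itv _) mm' mv m2i vi.
    move=> /(integrable_bounded_mul (measurable_itv _) mm mX').
    by apply: eq_integrable => // x _ /=; rewrite mulrA.
  rewrite -RintegralD//; last exact: integrable_scale.
  apply: le_Rintegral => //.
  + apply: integrable_scale => //.
    have := integrable_mul_sqr (measurable_itv _) mm' mv m2i vi.
    move=> /(integrable_bounded_mul (measurable_itv _) mm mX').
    by apply: eq_integrable => // x _ /=; rewrite mulrA.
  + by apply: integrable_add => //; exact: integrable_scale.
  move=> x Dx; have h0 : m x ^+ 2 <= X ^+ 2.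
    by rewrite -(real_normK (num_real (m x))) ler_pXn2r// ?nnegrE// mX'.
  have h1 : nu ^+ 2 * v x ^+ 2 * m x ^+ 2 <= nu ^+ 2 * v x ^+ 2 * X ^+ 2.
    by rewrite ler_wpM2l// mulr_ge0 ?sqr_ge0.
  have := sqr_ge0 (m' x - nu * m x * v x).
  have -> : (m' x - nu * m x * v x) ^+ 2 = m' x ^+ 2 +
    nu ^+ 2 * v x ^+ 2 * m x ^+ 2 - 2 * nu * (m x * m' x * v x) by ring.
  have -> : X ^+ 2 * nu ^+ 2 * v x ^+ 2 = nu ^+ 2 * v x ^+ 2 * X ^+ 2 by ring.
  lra.
Qed.

End Absorption.

(** * Testing the heat equation with power-like functions *)

Section Dissipation.
Context {R : realType}.
Local Notation leb := (@lebesgue_measure R).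
Local Notation itg D f := (leb.-integrable D (EFin \o f)).
Implicit Types (a b x y p : R) (f g h F G : R -> R).

(* [Phi = rho^2] is a generalized power of exponent [p]: Euler's identity
   [r * Phi' r = p * Phi r] and the convexity bound [Phi'' >= 2 rho'^2]. *)
Record power_like p (rho rho' Phi' Phi'' : R -> R) : Prop := PowerLike {
  pl_rho : forall r : R, is_derive r 1 rho (rho' r);
  pl_rho' : locally_lipschitz rho';
  pl_Phi : forall r : R, is_derive r 1 (fun r => rho r ^+ 2) (Phi' r);
  pl_Phi' : forall r : R, is_derive r 1 Phi' (Phi'' r);
  pl_Phi'l : locally_lipschitz Phi';
  pl_Phi'' : locally_lipschitz Phi'';
  pl_euler : forall r, r * Phi' r = p * rho r ^+ 2;
  pl_convex : forall r, 2 * rho' r ^+ 2 <= Phi'' r }.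

(** The heat equation at one time, with [f] for [theta_t] and [w] for [u_tx]. Admitting test
    functions without boundary conditions encodes the Neumann condition on [theta_x]. *)
Definition heat_slice a b (mu : R) (th thx f w : R -> R) :=
  forall F G, AC a b F G ->
    \int[leb]_(x in `]a, b]) (f x * F x) + \int[leb]_(x in `]a, b]) (thx x * G x) =
    mu * \int[leb]_(x in `]a, b]) (th x * w x * F x).

(* [v F] has the weak derivative [w F + v G], whose integral is the boundary term *)
Definition vanishing_trace a b (v w : R -> R) :=
  forall F G, AC a b F G -> itg `]a, b] (fun x => G x ^+ 2) ->
    \int[leb]_(x in `]a, b]) (w x * F x) + \int[leb]_(x in `]a, b]) (v x * G x) = 0.

(** Here [v] stands for [u_t], and the test function is [Phi' (th)]. With [m = rho (th)], Euler's
    identity turns the source [th Phi'(th) w] into [p m^2 w], the vanishing trace moves the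
    derivative onto [m^2], and convexity bounds the dissipation below by [2 m_x^2]; [absorption]
    then applies with [nu = - (mu * p)]. *)
Lemma slice_dissipation a b (mu p c : R) (rho rho' Phi' Phi'' th thx f w v : R -> R) :
  a < b -> power_like p rho rho' Phi' Phi'' ->
  AC a b th thx -> itg `]a, b] (fun x => thx x ^+ 2) ->
  measurable_fun `]a, b] v -> itg `]a, b] (fun x => v x ^+ 2) ->
  measurable_fun `]a, b] w -> itg `]a, b] (fun x => w x ^+ 2) ->
  heat_slice a b mu th thx f w -> vanishing_trace a b v w ->
  0 < c -> (mu * p) ^+ 2 * \int[leb]_(x in `]a, b]) v x ^+ 2 <= c ^+ 2 ->
  \int[leb]_(x in `]a, b]) (f x * Phi' (th x)) <=
  - (c ^+ 2 / (b - a)) * \int[leb]_(x in `]a, b]) rho (th x) ^+ 2 +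
  2 * c ^+ 2 * (4 * c ^+ 2 + (b - a)^-1) ^+ 2 *
    (\int[leb]_(x in `]a, b]) `|rho (th x)|) ^+ 2.
Proof.
move=> ab [d1 l1 d2 d3 l2 l3 eu cv] acth thx2 mv v2 mw w2 heat tr c0 cP.
have lab := ltW ab; have [thxi _] := acth; have mthx := itg_measurable thxi.
have acm := AC_chain lab acth d1 l1.
have acP := AC_chain lab acth d3 l3.
set m := (m in AC _ _ m _) in acm; set m' := (m' in AC _ _ m m') in acm.
have mth := AC_measurable_oc lab acth.
have [Mth Mth0 MthP] := AC_bounded lab acth.
have MthP' x : `]a, b]%classic x -> `|th x| <= Mth.
  by rewrite /= in_itv/= => /andP[ax xb]; rewrite MthP// xb ltW.
have bd g (lg : locally_lipschitz g) : exists k : R, forall x, `]a, b]%classic x -> `|g (th x)| <= k.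
  have [K K0 KP] := lg Mth; exists (K * (Mth + Mth) + `|g (th b)|) => x xab.
  rewrite -[g (th x)](subrK (g (th b))) (le_trans (ler_normD _ _))// lerD2r.
  have tb : `|th b| <= Mth by rewrite MthP// lexx lab.
  apply: le_trans (KP _ _ (MthP' x xab) tb) _; rewrite ler_wpM2l//.
  by rewrite (le_trans (ler_normB _ _))// lerD// MthP'.
have mc g (lg : locally_lipschitz g) : measurable_fun `]a, b] (fun x => g (th x)).
  exact: (measurableT_comp (continuous_measurable_fun (locally_lipschitz_continuous lg))).
have [k1 k1P] := bd _ l1.
have m2 : itg `]a, b] (fun x => m' x ^+ 2).
  by apply: integrable_sqr_scale k1P _ _ => //; exact: mc.
have [k3 k3P] := bd _ l3.
have i1 : itg `]a, b] (fun x => thx x * (Phi'' (th x) * thx x)).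
  apply: eq_integrable (integrable_bounded_mul _ (mc _ l3) k3P thx2) => //.
  by move=> x _ /=; congr EFin; ring.
have acmm := AC_mul lab acm acm.
have [km km0 kmP] := AC_bounded lab acm.
have kmP' x : `]a, b]%classic x -> `|m x| <= km.
  by rewrite /= in_itv/= => /andP[ax xb]; rewrite kmP// xb ltW.
have mm := AC_measurable_oc lab acm.
have mm' : measurable_fun `]a, b] m' by apply: measurable_funM => //; exact: mc.
have mm2 : itg `]a, b] (fun x => (m x * m' x) ^+ 2).
  exact: integrable_sqr_scale kmP' _ _.
have vmm : itg `]a, b] (fun x => m x * m' x * v x).
  by apply: integrable_mul_sqr => //; exact: measurable_funM.
have := tr _ _ acmm.
have g2 : itg `]a, b] (fun x => (m' x * m x + m x * m' x) ^+ 2).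
  apply: eq_integrable (integrable_scale 4 _ mm2) => // x _ /=.
  by congr EFin; ring.
move=> /(_ g2) trm.
have trE : \int[leb]_(x in `]a, b]) (w x * (m x * m x)) =
    - (2 * \int[leb]_(x in `]a, b]) (m x * m' x * v x)).
  apply/eqP; rewrite -addr_eq0; apply/eqP; rewrite -[RHS]trm; congr (_ + _).
  by rewrite -RintegralZl//; apply: eq_Rintegral => x _; ring.
have := heat _ _ acP => /eqP; rewrite eq_sym -subr_eq => /eqP <-.
have -> : mu * \int[leb]_(x in `]a, b]) (th x * w x * (Phi' \o th) x) =
    2 * (- (mu * p)) * \int[leb]_(x in `]a, b]) (m x * m' x * v x).
  have -> : \int[leb]_(x in `]a, b]) (th x * w x * (Phi' \o th) x) =
      \int[leb]_(x in `]a, b]) (p * (w x * (m x * m x))).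
    apply: eq_Rintegral => x _ /=.
    by rewrite mulrAC eu /m/= expr2; ring.
  rewrite RintegralZl//.
    by rewrite trE; ring.
  apply: eq_integrable (integrable_mul_sqr _ mw (measurable_funM mm mm) w2 _) => //.
  have mi := AC_integrable lab acm.
  have : itg `]a, b] (fun x => (m x * m x) * (m x * m x)).
    apply: (AC_mul_integrable lab acmm); exact: (AC_mul_integrable lab acm mi).
  by apply: eq_integrable => // x _ /=; rewrite expr2.
apply: le_trans (absorption (nu := - (mu * p)) ab acm m2 mv v2 c0 _); last first.
  by rewrite sqrrN.
rewrite [leRHS]addrC lerD2l mulNr lerN2 -RintegralZl//.
apply: le_Rintegral => //; first exact: integrable_scale.
move=> x Dx; rewrite /m'; have := cv (th x).
move: (thx x) (Phi'' (th x)) (rho' (th x)) => u v1 w1 vw.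
have : 0 <= (v1 - 2 * w1 ^+ 2) * u ^+ 2 by rewrite mulr_ge0 ?sqr_ge0 ?subr_ge0.
have -> : u * (v1 * u) = v1 * u ^+ 2 by ring.
rewrite mulrBl subr_ge0 => H.
by have -> : 2 * (w1 * u) ^+ 2 = 2 * w1 ^+ 2 * u ^+ 2 by ring.
Qed.

Lemma is_derive_pow (n : nat) (r : R) :
  is_derive r 1 (fun r : R => r ^+ n) (n%:R * r ^+ n.-1).
Proof. by split; [exact: exprn_derivable|rewrite exp_derive [LHS]mulr1]. Qed.

Lemma locally_lipschitz_cst (c : R) : locally_lipschitz (cst c : R -> R).
Proof.
by move=> M; exists 0 => // r s _ _; rewrite /cst subrr normr0 mul0r.
Qed.

Lemma locally_lipschitz_id : locally_lipschitz (id : R -> R).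
Proof. by move=> M; exists 1 => // r s _ _; rewrite mul1r. Qed.

Lemma locally_lipschitz_bounded g : locally_lipschitz g ->
  forall M : R, exists2 k : R, 0 <= k & forall r, `|r| <= M -> `|g r| <= k.
Proof.
move=> lg M; have [K K0 KP] := lg `|M|.
exists (K * `|M| + `|g 0|); first by rewrite addr_ge0// mulr_ge0.
move=> r rM; rewrite -[g r](subrK (g 0)) (le_trans (ler_normD _ _))// lerD2r.
have rM' := le_trans rM (ler_norm _).
apply: le_trans (KP _ _ rM' _) _; first by rewrite normr0.
by rewrite subr0 ler_wpM2l.
Qed.

Lemma locally_lipschitz_mul f g : locally_lipschitz f -> locally_lipschitz g ->
  locally_lipschitz (fun x => f x * g x).
Proof.
move=> lf lg M; have [K K0 KP] := lf M; have [L L0 LP] := lg M.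
have [k k0 kP] := locally_lipschitz_bounded lf M.
have [l l0 lP] := locally_lipschitz_bounded lg M.
exists (k * L + l * K); first by rewrite addr_ge0// mulr_ge0.
move=> r s rM sM.
have -> : f r * g r - f s * g s = f r * (g r - g s) + g s * (f r - f s) by ring.
rewrite (le_trans (ler_normD _ _))// !normrM mulrDl -!mulrA.
by apply: lerD; apply: ler_pM => //; [exact: kP|exact: LP|exact: lP|exact: KP].
Qed.

Lemma locally_lipschitz_exp f n : locally_lipschitz f ->
  locally_lipschitz (fun x => f x ^+ n).
Proof.
move=> lf; elim: n => [|n IH]; first exact: locally_lipschitz_cst.
have := locally_lipschitz_mul lf IH.
by under [X in locally_lipschitz X]funext => x do rewrite -exprS.
Qed.

Lemma locally_lipschitz_scale f (c : R) : locally_lipschitz f ->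
  locally_lipschitz (fun x => c * f x).
Proof. exact: (locally_lipschitz_mul (locally_lipschitz_cst c)). Qed.

Lemma is_derive_scale (c : R) f x (df : R) : is_derive x 1 f df ->
  is_derive x 1 (fun y => c * f y) (c * df).
Proof.
move=> H; have := is_derive_mul (is_derive_cst c x 1) H.
by rewrite mulr0 addr0.
Qed.

(** With [rho = r^q] the convexity bound reads [2 q^2 <= 2 q (2 q - 1)], which holds from [q = 1]
    on. *)
Lemma power_like_pow (q : nat) : (0 < q)%N ->
  power_like (q.*2)%:R (fun r => r ^+ q) (fun r => q%:R * r ^+ q.-1)
    (fun r => (q.*2)%:R * r ^+ (q.*2).-1)
    (fun r => (q.*2)%:R * ((q.*2).-1%:R * r ^+ (q.*2).-2)).
Proof.
move=> q0; have lid := locally_lipschitz_id; split.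
- exact: is_derive_pow.
- exact/locally_lipschitz_scale/locally_lipschitz_exp.
- move=> r; have -> : (fun r : R => (r ^+ q) ^+ 2) = (fun r => r ^+ q.*2).
    by apply/funext => s; rewrite -exprM muln2.
  exact: is_derive_pow.
- by move=> r; apply: is_derive_scale; exact: is_derive_pow.
- exact/locally_lipschitz_scale/locally_lipschitz_exp.
- exact/locally_lipschitz_scale/locally_lipschitz_scale/locally_lipschitz_exp.
- move=> r; rewrite -exprM muln2 mulrCA -exprS prednK// double_gt0//.
- case: q q0 => // q _ r; rewrite doubleS /= exprMn -exprM muln2 !mulrA.
  rewrite ler_wpM2r//; first by rewrite -mul2n exprM exprn_ge0// sqr_ge0.
  rewrite -![_.+1%:R]natr1 -mul2n natrM; have : 0 <= q%:R :> R by [].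
  by move: (q%:R : R) => x; nra.
Qed.

Definition negpart (r : R) : R := Num.min r 0.

Lemma locally_lipschitz_negpart : locally_lipschitz negpart.
Proof.
move=> M; exists 1 => // r s _ _; rewrite mul1r /negpart.
have [r0|r0] := leP r 0; have [s0|s0] := leP s 0; rewrite ?subrr ?normr0 ?subr0 ?sub0r ?normrN//.
- by rewrite !ler0_norm//; lra.
- by rewrite ler0_norm// ger0_norm; lra.
Qed.

(** Only the kink at [0] needs care: for an exponent at least [2] the difference quotient there is
    at most [|h|] once [|h| <= 1]. *)
Lemma is_derive_negpart (n : nat) (r : R) :
  is_derive r 1 (fun r => negpart r ^+ n.+2) (n.+2%:R * negpart r ^+ n.+1).
Proof.
have [r0|r0|->] := ltgtP r 0.
- have -> : negpart r = r by rewrite /negpart min_l// ltW.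
  apply: (near_eq_is_derive _ (is_derive_pow n.+2 r)).
  by near=> y; rewrite /negpart min_l//; near: y; exact: lt_le_nbhsl.
- have -> : n.+2%:R * negpart r ^+ n.+1 = 0.
    by rewrite /negpart min_r ?ltW// expr0n mulr0.
  apply: (@near_eq_is_derive _ _ _ (cst 0 : R -> R)).
  near=> y; rewrite /negpart min_r ?expr0n//.
  by near: y; exact: lt_le_nbhsr.
- have n0 : negpart 0 = 0 by rewrite /negpart minxx.
  rewrite n0 expr0n mulr0.
  have c : h^-1 *: (negpart (h + 0) ^+ n.+2 - negpart 0 ^+ n.+2) @[h --> 0^'] --> (0 : R).
    apply/cvgrPdist_le => e e0; near=> h.
    rewrite n0 addr0 expr0n subr0 sub0r normrN /GRing.scale/=.
    have nh : `|negpart h| <= `|h|.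
      by rewrite /negpart; case: (leP h 0) => // _; rewrite normr0.
    have h1 : `|h| <= 1 by near: h; exact: dnbhs0_le.
    have he : `|h| <= e by near: h; exact: dnbhs0_le.
    have h0 : h != 0 by near: h; exact: nbhs_dnbhs_neq.
    rewrite normrM normfV ler_pdivrMl ?normr_gt0// normrX exprS.
    apply: ler_pM => //.
    rewrite exprS (le_trans _ he)//.
    rewrite -[leRHS]mulr1; apply: ler_pM => //.
    by rewrite exprn_ile1// (le_trans nh).
  apply: DeriveDef.
    by apply/cvg_ex; exists 0; under eq_fun do rewrite [_%:A]mulr1; exact: c.
  rewrite /derive; under eq_fun do rewrite [_%:A]mulr1.
  exact/cvg_lim.
Unshelve. all: by end_near. Qed.

(** The square is the lowest integer power of [negpart] with a locally Lipschitz derivative, whence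
    the degree [4] of [Phi]; the convexity bound amounts to [8 <= 12]. *)
Lemma power_like_negpart :
  power_like 4 (fun r => negpart r ^+ 2) (fun r => 2 * negpart r)
    (fun r => 4 * negpart r ^+ 3) (fun r => 4 * (3 * negpart r ^+ 2)).
Proof.
have ln := locally_lipschitz_negpart; split.
- by move=> r; have := is_derive_negpart 0 r; rewrite expr1.
- exact: locally_lipschitz_scale.
- move=> r; have -> : (fun r : R => (negpart r ^+ 2) ^+ 2) = (fun r => negpart r ^+ 4).
    by apply/funext => s; rewrite -exprM.
  exact: is_derive_negpart.
- by move=> r; apply: is_derive_scale; exact: is_derive_negpart.
- exact/locally_lipschitz_scale/locally_lipschitz_exp.
- exact/locally_lipschitz_scale/locally_lipschitz_scale/locally_lipschitz_exp.
- move=> r; rewrite /negpart; case: (leP r 0) => r0; first by ring.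
  by rewrite !expr0n/= !mulr0.
- move=> r; have := sqr_ge0 (negpart r); nra.
Qed.

End Dissipation.

(** * Integration over a space-time cylinder *)

Section SpaceTime.
Context {R : realType}.
Local Notation leb := (@lebesgue_measure R).
Local Notation itg D f := (leb.-integrable D (EFin \o f)).
Local Notation RR := (measurableTypeR R * measurableTypeR R)%type.
Implicit Types (a b x y T : R) (F G H : R -> R -> R).

Definition cylinder T a b : set RR := `]0, T[ `*` `]a, b[.

Lemma measurable_cylinder T a b : measurable (cylinder T a b).
Proof. by apply: measurableX. Qed.

Lemma fubini_F_patch T a b (f : RR -> \bar R) :
  fubini_F leb (f \_ (cylinder T a b)) =
  (fun t => \int[leb]_(x in `]a, b[) f (t, x))%E \_ `]0, T[.
Proof.
apply/funext => t; rewrite /fubini_F patchE; case: ifPn => [|] tI.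
  rewrite [RHS]integral_mkcond; apply: eq_integral => x _; rewrite !patchE.
  congr (if _ then _ else _); apply/idP/idP; rewrite !inE.
    by move=> -[].
  by split => //; rewrite inE in tI.
rewrite integral0_eq// => x _; rewrite patchE memNset// => -[/= tI' _].
by move: tI; rewrite notin_setE; apply.
Qed.

Lemma fubini_G_patch T a b (f : RR -> \bar R) :
  fubini_G leb (f \_ (cylinder T a b)) =
  (fun x => \int[leb]_(t in `]0%R, T[) f (t, x))%E \_ `]a, b[.
Proof.
apply/funext => x; rewrite /fubini_G patchE; case: ifPn => [|] xI.
  rewrite [RHS]integral_mkcond; apply: eq_integral => t _; rewrite !patchE.
  congr (if _ then _ else _); apply/idP/idP; rewrite !inE.
    by move=> -[].
  by split => //; rewrite inE in xI.
rewrite integral0_eq// => t _; rewrite patchE memNset// => -[/= _ xI'].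
by move: xI; rewrite notin_setE; apply.
Qed.

Lemma tonelli_cylinder T a b (f : RR -> \bar R) : measurable_fun (cylinder T a b) f ->
  (forall p, cylinder T a b p -> (0 <= f p)%E) ->
  (\int[leb]_(t in `]0%R, T[) \int[leb]_(x in `]a, b[) f (t, x) =
   \int[leb]_(x in `]a, b[) \int[leb]_(t in `]0%R, T[) f (t, x))%E.
Proof.
move=> mf f0; have mC := measurable_cylinder T a b.
have mp : measurable_fun setT (f \_ (cylinder T a b)).
  exact: ((measurable_restrictT f mC).1 mf).
have p0 p : (0 <= (f \_ (cylinder T a b)) p)%E.
  by rewrite patchE; case: ifPn => //; rewrite inE; exact: f0.
rewrite integral_mkcond [RHS]integral_mkcond -fubini_F_patch -fubini_G_patch.
exact: (fubini_tonelli (m1 := leb) (m2 := leb) _ mp p0).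
Qed.

Lemma measurable_slice_x T a b F t : jointly_measurable T a b F ->
  `]0, T[%classic t -> measurable_fun `]a, b[ (F t).
Proof.
move=> mF tI.
apply: (measurable_comp (measurable_cylinder T a b) _ mF (g := pair t)).
  by move=> _ [x xab <-].
exact: (measurable_funS measurableT) (pair1_measurable t).
Qed.

Lemma measurable_slice_t T a b F x : jointly_measurable T a b F ->
  `]a, b[%classic x -> measurable_fun `]0, T[ (F^~ x).
Proof.
move=> mF xI.
apply: (measurable_comp (measurable_cylinder T a b) _ mF (g := fun t => (t, x))).
  by move=> _ [t tI <-].
exact: (measurable_funS measurableT) (pair2_measurable x).
Qed.

(** Stated with the iterated integral because that is the form produced by bounds on time slices;
    [L1Q_integrable] identifies it with integrability for the product measure. *)
Definition L1Q T a b F := jointly_measurable T a b F /\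
  (\int[leb]_(t in `]0%R, T[) \int[leb]_(x in `]a, b[) `|F t x|%:E < +oo)%E.

Lemma L1Q_integrable T a b F : L1Q T a b F <->
  (leb \x leb)%E.-integrable setT
    ((fun p : RR => (F p.1 p.2)%:E) \_ (cylinder T a b)).
Proof.
have mC := measurable_cylinder T a b.
split.
  move=> [mF Foo].
  have mF' : measurable_fun (cylinder T a b) (fun p : RR => (F p.1 p.2)%:E).
    exact/measurable_EFinP.
  have mp := (measurable_restrictT _ mC).1 mF'.
  apply/(@integrable12ltyP _ _ _ _ R leb leb _ mp).2.
  rewrite (_ : (fun t => _) = fubini_F leb
      ((fun p : RR => `|F p.1 p.2|%:E) \_ (cylinder T a b))); last first.
    apply/funext => t; apply: eq_integral => x _; rewrite !patchE.
    by case: ifPn => //; rewrite abse0.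
  by rewrite fubini_F_patch -integral_mkcond.
move=> iF; have mp := measurable_int _ iF.
have mF' := (measurable_restrictT _ mC).2 mp.
split; first exact/measurable_EFinP.
move/(@integrable12ltyP _ _ _ _ R leb leb _ mp).1 : iF.
rewrite (_ : (fun t => _) = fubini_F leb
    ((fun p : RR => `|F p.1 p.2|%:E) \_ (cylinder T a b))); last first.
  apply/funext => t; apply: eq_integral => x _; rewrite !patchE.
  by case: ifPn => //; rewrite abse0.
by rewrite fubini_F_patch -integral_mkcond.
Qed.

Lemma L1Q_ae_x T a b F : L1Q T a b F ->
  {ae leb, forall t, t \in `]0, T[ -> itg `]a, b[ (F t)}.
Proof.
move=> /L1Q_integrable /ae_integrable1 /ae_imp; apply => t H tI.
apply/(integrable_mkcond _ _).2 => //.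
move: H; congr integrable; apply/funext => x; rewrite !patchE.
congr (if _ then _ else _); apply/idP/idP; rewrite !inE.
  by move=> -[].
by split => //; exact: tI.
Qed.

Lemma L1Q_ae_t T a b F : L1Q T a b F ->
  {ae leb, forall x, x \in `]a, b[ -> itg `]0, T[ (F^~ x)}.
Proof.
move=> /L1Q_integrable /ae_integrable2 /ae_imp; apply => x H xI.
apply/(integrable_mkcond _ _).2 => //.
move: H; congr integrable; apply/funext => t; rewrite !patchE.
congr (if _ then _ else _); apply/idP/idP; rewrite !inE.
  by move=> -[].
by split => //; exact: xI.
Qed.

Lemma integrable_fubini_G (f : RR -> \bar R) : (leb \x leb)%E.-integrable setT f ->
  leb.-integrable setT (fubini_G leb f).
Proof.
move=> fi; have mf := measurable_int _ fi.
have ma : measurable_fun setT (fun y => \int[leb]_x `|f (x, y)|)%E.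
  apply: (measurable_fun_fubini_tonelli_G (m1 := leb) (abse \o f)) => //.
    exact: measurableT_comp.
  by move=> p; exact: abse_ge0.
apply/integrableP; split; first exact: (@measurable_fubini_G _ _ _ _ R leb leb f fi).
apply: le_lt_trans ((@integrable21ltyP _ _ _ _ R leb leb _ mf).1 fi).
apply: ge0_le_integral => //.
- by apply: measurableT_comp => //; exact: (@measurable_fubini_G _ _ _ _ R leb leb f fi).
- by move=> y _; apply: le_abse_integral => //; exact: measurableT_comp.
Qed.

Lemma L1Q_int_t T a b F : L1Q T a b F ->
  itg `]0, T[ (fun t => \int[leb]_(x in `]a, b[) F t x).
Proof.
move=> FL.
have i : leb.-integrable `]0%R, T[ (fun t => \int[leb]_(x in `]a, b[) (F t x)%:E)%E.
  apply/(integrable_mkcond _ _).2 => //.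
  have := fubini_F_patch T a b (fun p => (F p.1 p.2)%:E) => /= <-.
  by apply: integrable_fubini_F; exact/L1Q_integrable.
have [mi ioo] := integrableP _ _ _ i.
apply/integrableP; split.
  apply/measurable_EFinP; exact: measurableT_comp.
apply: le_lt_trans ioo; apply: ge0_le_integral => //.
- by do 2 apply: measurableT_comp => //; exact: measurableT_comp.
- exact: measurableT_comp.
(* Passing to [fine] never increases the absolute value, even where the inner integral is
   infinite. *)
move=> t _; rewrite /Rintegral /=.
by case: (\int[_]_(_ in _) _)%E => [r| |] //=; rewrite leey.
Qed.

Lemma L1Q_int_x T a b F : L1Q T a b F ->
  itg `]a, b[ (fun x => \int[leb]_(t in `]0, T[) F t x).
Proof.
move=> FL.
have i : leb.-integrable `]a, b[ (fun x => \int[leb]_(t in `]0%R, T[) (F t x)%:E)%E.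
  apply/(integrable_mkcond _ _).2 => //.
  have := fubini_G_patch T a b (fun p => (F p.1 p.2)%:E) => /= <-.
  by apply: integrable_fubini_G; exact/L1Q_integrable.
have [mi ioo] := integrableP _ _ _ i.
apply/integrableP; split.
  apply/measurable_EFinP; exact: measurableT_comp.
apply: le_lt_trans ioo; apply: ge0_le_integral => //.
- by do 2 apply: measurableT_comp => //; exact: measurableT_comp.
- exact: measurableT_comp.
move=> t _; rewrite /Rintegral /=.
by case: (\int[_]_(_ in _) _)%E => [r| |] //=; rewrite leey.
Qed.

(** [Rintegral] gives a real default to an infinite inner integral, so Fubini's theorem is applied
    to the extended integrals, which are finite on almost every slice. *)
Lemma L1Q_fubini T a b F : L1Q T a b F ->
  \int[leb]_(t in `]0, T[) \int[leb]_(x in `]a, b[) F t x =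
  \int[leb]_(x in `]a, b[) \int[leb]_(t in `]0, T[) F t x.
Proof.
move=> FL.
have iF := (L1Q_integrable T a b F).1 FL.
pose f p := (F p.1 p.2)%:E.
have fin_t : {ae leb, forall t, t \in `]0, T[ ->
    (\int[leb]_(x in `]a, b[) (F t x)%:E)%E \is a fin_num}.
  by apply: (ae_imp (L1Q_ae_x FL)) => t H /H; exact: integrable_fin_num.
have fin_x : {ae leb, forall x, x \in `]a, b[ ->
    (\int[leb]_(t in `]0%R, T[) (F t x)%:E)%E \is a fin_num}.
  by apply: (ae_imp (L1Q_ae_t FL)) => x H /H; exact: integrable_fin_num.
have i1 := L1Q_int_t FL; have i2 := L1Q_int_x FL.
have mt : measurable_fun `]0, T[ (fun t => \int[leb]_(x in `]a, b[) (F t x)%:E)%E.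
  have : leb.-integrable `]0%R, T[ (fun t => \int[leb]_(x in `]a, b[) (F t x)%:E)%E.
    apply/(integrable_mkcond _ _).2 => //.
    have := fubini_F_patch T a b f => /= <-.
    exact: integrable_fubini_F.
  by move=> /integrableP[].
have mx : measurable_fun `]a, b[ (fun x => \int[leb]_(t in `]0%R, T[) (F t x)%:E)%E.
  have : leb.-integrable `]a, b[ (fun x => \int[leb]_(t in `]0%R, T[) (F t x)%:E)%E.
    apply/(integrable_mkcond _ _).2 => //.
    have := fubini_G_patch T a b f => /= <-.
    exact: integrable_fubini_G.
  by move=> /integrableP[].
rewrite /Rintegral; congr fine.
transitivity (\int[leb]_(t in `]0%R, T[) \int[leb]_(x in `]a, b[) (F t x)%:E)%E.
  apply: ae_eq_integral => //.
    by case/integrableP: i1.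
  by apply: (ae_imp fin_t) => t H /= tI; rewrite fineK//; exact: H.
transitivity (\int[leb]_(x in `]a, b[) \int[leb]_(t in `]0%R, T[) (F t x)%:E)%E; last first.
  apply: ae_eq_integral => //.
    by case/integrableP: i2.
  by apply: (ae_imp fin_x) => x H /= xI; rewrite fineK//; exact: H.
rewrite integral_mkcond [RHS]integral_mkcond.
have := fubini_F_patch T a b f => /= <-; have := fubini_G_patch T a b f => /= <-.
exact: Fubini.
Qed.

End SpaceTime.

(** * Null sets in space-time and their slices *)

Section SpaceTimeNullSets.
Context {R : realType}.
Local Notation leb := (@lebesgue_measure R).
Local Notation RR := (measurableTypeR R * measurableTypeR R)%type.
Implicit Types (a b x y T : R) (F G H : R -> R -> R).

Lemma L1Q_cylinder T a b F : L1Q T a b F <->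
  (leb \x leb)%E.-integrable (cylinder T a b) (fun p : RR => (F p.1 p.2)%:E).
Proof.
apply: (iff_trans (L1Q_integrable T a b F)); apply: iff_sym.
exact: (integrable_mkcond _ (measurable_cylinder T a b)).
Qed.

Lemma jm_add T a b F G : jm T a b F -> jm T a b G ->
  jm T a b (fun t x => F t x + G t x).
Proof. by move=> mF mG; apply: measurable_funD. Qed.

Lemma jm_mul T a b F G : jm T a b F -> jm T a b G ->
  jm T a b (fun t x => F t x * G t x).
Proof. by move=> mF mG; apply: measurable_funM. Qed.

Lemma jm_comp T a b F (g : R -> R) : continuous g -> jm T a b F ->
  jm T a b (fun t x => g (F t x)).
Proof.
by move=> cg mF; apply: (measurableT_comp (continuous_measurable_fun cg) mF).
Qed.

Lemma jm_t T a b (g : R -> R) : continuous g -> jm T a b (fun t x => g t).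
Proof.
move=> cg; apply: (measurable_funS measurableT) => //.
by apply: (measurableT_comp (continuous_measurable_fun cg) measurable_fst).
Qed.

Lemma jm_x T a b (g : R -> R) : continuous g -> jm T a b (fun t x => g x).
Proof.
move=> cg; apply: (measurable_funS measurableT) => //.
by apply: (measurableT_comp (continuous_measurable_fun cg) measurable_snd).
Qed.

Lemma jm_cst T a b (c : R) : jm T a b (fun t x => c).
Proof. by apply: (jm_t (g := cst c)) => x; exact: cvg_cst. Qed.

Lemma jm_scale T a b F (c : R) : jm T a b F -> jm T a b (fun t x => c * F t x).
Proof. by move=> mF; apply: jm_mul => //; exact: jm_cst. Qed.

Lemma L1Q_add T a b F G : L1Q T a b F -> L1Q T a b G ->
  L1Q T a b (fun t x => F t x + G t x).
Proof.
move=> /L1Q_cylinder FL /L1Q_cylinder GL; apply/L1Q_cylinder.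
rewrite (_ : (fun p => _) = (fun p => (F p.1 p.2)%:E) \+ (fun p => (G p.1 p.2)%:E))%E;
  last by apply/funext.
apply: integrableD => //; exact: measurable_cylinder.
Qed.

Lemma L1Q_le T a b F G : jm T a b F -> L1Q T a b G ->
  (forall t x, `]0, T[%classic t -> `]a, b[%classic x -> `|F t x| <= `|G t x|) ->
  L1Q T a b F.
Proof.
move=> mF /L1Q_cylinder GL FG; apply/L1Q_cylinder.
apply: le_integrable GL => //; first exact: measurable_cylinder.
  exact/measurable_EFinP.
by move=> [t x] [/= tI xI]; rewrite lee_fin; exact: FG.
Qed.

Lemma L1Q_mul_bounded T a b F G (c : R) : jm T a b F -> L1Q T a b G ->
  (forall t x, `]0, T[%classic t -> `]a, b[%classic x -> `|F t x| <= c) ->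
  L1Q T a b (fun t x => F t x * G t x).
Proof.
move=> mF GL Fc; have [mG _] := GL.
have cG : L1Q T a b (fun t x => c * G t x).
  apply/L1Q_cylinder; rewrite (_ : (fun p => _) = (fun p => c%:E * (G p.1 p.2)%:E))%E;
    last by apply/funext.
  apply: integrableZl; first exact: measurable_cylinder.
  exact/L1Q_cylinder.
apply: L1Q_le cG _; first exact: jm_mul.
move=> t x tI xI; rewrite !normrM ler_wpM2r// (le_trans (Fc _ _ tI xI))//.
exact: ler_norm.
Qed.

Lemma L1Q_scale T a b F (c : R) : L1Q T a b F -> L1Q T a b (fun t x => c * F t x).
Proof.
by move=> FL; apply: (L1Q_mul_bounded (c := `|c|)) => //; exact: jm_cst.
Qed.

Lemma measurable_int_slice T a b F : jm T a b F ->
  measurable_fun `]0, T[ (fun t => \int[leb]_(x in `]a, b[) `|F t x|%:E)%E.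
Proof.
move=> mF; apply/(measurable_restrictT _ _).2 => //.
have := fubini_F_patch T a b (fun p : RR => `|F p.1 p.2|%:E) => /= <-.
apply: measurable_fun_fubini_tonelli_F.
  apply: ((measurable_restrictT _ (measurable_cylinder T a b)).1).
  by apply/measurable_EFinP; exact: measurableT_comp.
by move=> p; rewrite patchE; case: ifPn.
Qed.

(** [g] is replaced by the maximum of [f] and [g], equal to it almost everywhere, so that pointwise
    monotonicity of the integral applies. *)
Lemma ae_le_integral (D : set R) (f g : R -> \bar R) : measurable D ->
  measurable_fun D f -> measurable_fun D g ->
  (forall x, D x -> (0 <= f x)%E) -> (forall x, D x -> (0 <= g x)%E) ->
  {ae leb, forall x, D x -> (f x <= g x)%E} ->
  (\int[leb]_(x in D) f x <= \int[leb]_(x in D) g x)%E.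
Proof.
move=> mD mf mg f0 g0 fg.
have mm : measurable_fun D (fun x => maxe (f x) (g x)) by exact: measurable_maxe.
have -> : (\int[leb]_(x in D) g x = \int[leb]_(x in D) (maxe (f x) (g x)))%E.
  apply: ae_eq_integral => //.
  by apply: (ae_imp fg) => x /= H Dx; rewrite max_r// H.
apply: ge0_le_integral => //.
- by move=> x Dx; rewrite le_max lexx.
Qed.

Lemma L1Q_dom T a b F G (k : R) : jm T a b F -> L1Q T a b G -> 0 <= k ->
  {ae leb, forall t, `]0, T[%classic t ->
    (\int[leb]_(x in `]a, b[) `|F t x|%:E <= k%:E * \int[leb]_(x in `]a, b[) `|G t x|%:E)%E} ->
  L1Q T a b F.
Proof.
move=> mF [mG Goo] k0 H; split; first exact: mF.
have mGs := measurable_int_slice mG.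
have G0 t : (0 <= \int[leb]_(x in `]a, b[) `|G t x|%:E)%E by apply: integral_ge0.
apply: (@le_lt_trans _ _ (\int[leb]_(t in `]0%R, T[) (k%:E * \int[leb]_(x in `]a, b[) `|G t x|%:E))%E).
  apply: ae_le_integral => //.
  - exact: measurable_int_slice.
  - exact: measurable_funeM.
  - by move=> t _; apply: integral_ge0.
  - by move=> t _; apply: mule_ge0.
rewrite ge0_integralZl//.
by apply: lte_mul_pinfty.
Qed.

Lemma L1Q_bound T a b F (M : R) : 0 < T -> jm T a b F ->
  {ae leb, forall t, `]0, T[%classic t ->
    (\int[leb]_(x in `]a, b[) `|F t x|%:E <= M%:E)%E} ->
  L1Q T a b F.
Proof.
move=> T0 mF H; split => //.
have H' : {ae leb, forall t, `]0, T[%classic t ->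
    (\int[leb]_(x in `]a, b[) `|F t x|%:E <= `|M|%:E)%E}.
  apply: (ae_imp H) => t Ht tI; apply: le_trans (Ht tI) _.
  by rewrite lee_fin ler_norm.
apply: (@le_lt_trans _ _ (\int[leb]_(t in `]0%R, T[) (cst `|M|%:E t))%E).
  apply: ae_le_integral => //.
  - exact: measurable_int_slice.
  - by move=> t _; apply: integral_ge0.
  - by move=> t _; rewrite lee_fin.
rewrite integral_cst//= lebesgue_measure_itv/= lte_fin T0.
by rewrite -EFinD -EFinM ltry.
Qed.

Lemma ae_iter T a b H : jm T a b H ->
  (\int[leb]_(t in `]0%R, T[) \int[leb]_(x in `]a, b[) `|H t x|%:E = 0)%E ->
  {ae leb, forall t, t \in `]0, T[ -> {ae leb, forall x, x \in `]a, b[ -> H t x = 0}}.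
Proof.
move=> mH H0; have mS := measurable_int_slice mH.
have := (ae_eq_integral_abs leb (measurable_itv _) mS).1.
rewrite -[X in (_ = X -> _) -> _]H0 => HH.
apply: (ae_imp (HH _)); first by apply: eq_integral => t _; rewrite gee0_abs// integral_ge0.
move=> t /= Ht tI; have mHt := measurable_slice_x mH tI.
have mE : measurable_fun `]a, b[ (EFin \o H t) by exact/measurable_EFinP.
have HH2 := (ae_eq_integral_abs leb (measurable_itv _) mE).1.
apply: (ae_imp (HH2 _)); last by move=> x Hx xI; have [] := Hx xI.
by rewrite -[RHS](Ht tI); apply: eq_integral => x _.
Qed.

Lemma integral_ae0 (D : set R) (f : R -> \bar R) : measurable D -> measurable_fun D f ->
  {ae leb, forall x, D x -> f x = 0%E} -> (\int[leb]_(x in D) f x = 0)%E.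
Proof.
move=> mD mf f0; rewrite -[RHS](integral0 leb D).
by apply: ae_eq_integral => //; exact: f0.
Qed.

(** Tonelli's theorem: either order of the quantifiers says that the double integral of [|H|] is
    zero. In this way information obtained at fixed [x] is read at fixed [t]. *)
Lemma ae_swap T a b H : jm T a b H ->
  {ae leb, forall x, x \in `]a, b[ -> {ae leb, forall t, t \in `]0, T[ -> H t x = 0}} ->
  {ae leb, forall t, t \in `]0, T[ -> {ae leb, forall x, x \in `]a, b[ -> H t x = 0}}.
Proof.
move=> mH H0; apply: ae_iter => //.
have mf : measurable_fun (cylinder T a b) (fun p : RR => `|H p.1 p.2|%:E).
  by apply/measurable_EFinP; exact: measurableT_comp.
have := tonelli_cylinder mf; rewrite /= => -> //.
apply: integral_ae0 => //.
  apply/(measurable_restrictT _ _).2 => //.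
  have := fubini_G_patch T a b (fun p : RR => `|H p.1 p.2|%:E) => /= <-.
  apply: measurable_fun_fubini_tonelli_G.
    exact: ((measurable_restrictT _ (measurable_cylinder T a b)).1).
  by move=> p; rewrite patchE; case: ifPn.
apply: (ae_imp H0) => x Hx xI; apply: integral_ae0 => //.
  apply/measurable_EFinP; apply: measurableT_comp => //.
  exact: measurable_slice_t mH xI.
by apply: (ae_imp (Hx xI)) => t Ht /Ht ->; rewrite normr0.
Qed.

Lemma ae_product_slices T a b H : jm T a b H ->
  {ae (leb \x leb)%E, forall p : R * R, 0 < p.1 -> p.2 \in `]a, b[ -> H p.1 p.2 = 0} ->
  {ae leb, forall t, t \in `]0, T[ -> {ae leb, forall x, x \in `]a, b[ -> H t x = 0}}.
Proof.
move=> mH H0; apply: ae_iter => //; have mC := measurable_cylinder T a b.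
have mf : measurable_fun (cylinder T a b) (fun p : RR => `|H p.1 p.2|%:E).
  by apply/measurable_EFinP; exact: measurableT_comp.
rewrite integral_mkcond.
have := fubini_F_patch T a b (fun p : RR => `|H p.1 p.2|%:E) => /= <-.
rewrite -(fubini_tonelli1 (m1 := leb) (m2 := leb)) //; last 2 first.
- exact: ((measurable_restrictT _ mC).1).
- by move=> p; rewrite patchE; case: ifPn.
rewrite -integral_mkcond -[RHS](integral0 (leb \x leb)%E (cylinder T a b)).
apply: ae_eq_integral => //.
apply: (@filterS _ _ (ae_filter_ringOfSetsType (leb \x leb)%E)) H0.
move=> [t x] /= Hp [/= tI xI]; rewrite Hp ?normr0//.
by move: tI; rewrite in_itv/= => /andP[].
Qed.

Lemma ae_slices_product T a b H : jm T a b H ->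
  {ae leb, forall t, t \in `]0, T[ -> {ae leb, forall x, x \in `]a, b[ -> H t x = 0}} ->
  {ae (leb \x leb)%E, forall p : R * R, cylinder T a b p -> H p.1 p.2 = 0}.
Proof.
move=> mH H0; have mC := measurable_cylinder T a b.
have mf : measurable_fun (cylinder T a b) (fun p : RR => (H p.1 p.2)%:E).
  exact/measurable_EFinP.
have HH := (ae_eq_integral_abs (leb \x leb)%E mC mf).1.
apply: (@filterS _ _ (ae_filter_ringOfSetsType (leb \x leb)%E) _ _ _ (HH _)).
by move=> p Hp /Hp[].
rewrite integral_mkcond.
have mfa : measurable_fun (cylinder T a b) (fun p : RR => `|H p.1 p.2|%:E).
  by apply/measurable_EFinP; exact: measurableT_comp.
rewrite (fubini_tonelli1 (m1 := leb) (m2 := leb)) //; last 2 first.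
- exact: ((measurable_restrictT _ mC).1).
- by move=> p; rewrite patchE; case: ifPn.
have := fubini_F_patch T a b (fun p : RR => `|H p.1 p.2|%:E) => /= ->.
rewrite -integral_mkcond; apply: integral_ae0 => //.
  exact: measurable_int_slice.
apply: (ae_imp H0) => t Ht tI; apply: integral_ae0 => //.
  apply/measurable_EFinP; apply: measurableT_comp => //.
  exact: measurable_slice_x mH tI.
by apply: (ae_imp (Ht tI)) => x Hx /Hx ->; rewrite normr0.
Qed.

End SpaceTimeNullSets.

(** * Time derivative of integral functionals *)

Section Evolution.
Context {R : realType}.
Local Notation leb := (@lebesgue_measure R).
Local Notation itg D f := (leb.-integrable D (EFin \o f)).
Implicit Types (a b x y T : R) (F G H : R -> R -> R).

Definition weak_t_on_tents T a b F G :=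
  {ae leb, forall x, x \in `]a, b[ -> weak_on_tents 0 T (F^~ x) (G^~ x)}.

Lemma ae_weak_t T a b F G :
  (forall phi, test_function 0 T phi -> {ae leb, forall x, x \in `]a, b[ ->
       \int[leb]_(t in `]0, T[) (F t x * derive1 phi t) =
       - \int[leb]_(t in `]0, T[) (G t x * phi t)}) ->
  weak_t_on_tents T a b F G.
Proof.
move=> H.
have : {ae leb, forall x, forall i : nat * rat * rat * rat * rat,
    let: (n, s, t, s', t') := i in
    x \in `]a, b[ -> admissible_knots 0 T n (ratr s) (ratr t) (ratr s') (ratr t') ->
    \int[leb]_(u in `]0, T[) (F u x * dtent n (ratr s) (ratr t) (ratr s') (ratr t') u) =
    - \int[leb]_(u in `]0, T[) (G u x * tent n (ratr s) (ratr t) (ratr s') (ratr t') u)}.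
  apply: ae_count => -[[[[n s] t] s'] t'].
  have [adm|nadm] := pselect (admissible_knots 0 T n (ratr s : R) (ratr t) (ratr s') (ratr t')).
    have := H _ (test_tent adm); rewrite derive1_tent => /ae_imp; apply.
    by move=> x Hx xI _; exact: Hx.
  by apply: ae_true => x _ /nadm.
move=> /ae_imp; apply => x Hx xI n s t s' t' adm.
exact: (Hx (n, s, t, s', t')).
Qed.

Lemma continuous_tent n (s t s' t' : R) : continuous (tent n s t s' t').
Proof.
move=> x; apply/differentiable_continuous/derivable1_diffP.
by have [] := is_derive_tent n s t s' t' x.
Qed.

Lemma L1Q_mul_t T a b F (g : R -> R) : 0 <= T -> continuous g -> L1Q T a b F ->
  L1Q T a b (fun t x => F t x * g t).
Proof.
move=> T0 cg FL.
have [||c _ cP] := @EVT_max R (fun x => `|g x|) 0 T.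
- by [].
- apply: continuous_subspaceT => x.
  by apply: continuous_comp; [exact: cg|exact: norm_continuous].
have := L1Q_mul_bounded (F := fun t x => g t) (c := `|g c|) (@jm_t R T a b g cg) FL.
have -> : (fun t x => g t * F t x) = (fun t x => F t x * g t).
  by apply/funext => t; apply/funext => x; rewrite mulrC.
apply=> t x /=; rewrite in_itv/= => /andP[t0 tT] _.
by rewrite cP// in_itv/= !ltW.
Qed.

Lemma L1Q_int_mul_t T a b F (g : R -> R) : L1Q T a b F ->
  {ae leb, forall t, `]0, T[%classic t ->
    \int[leb]_(x in `]a, b[) (F t x * g t) = (\int[leb]_(x in `]a, b[) F t x) * g t}.
Proof.
move=> FL; apply: (ae_imp (L1Q_ae_x FL)) => t Ht tI.
by rewrite RintegralZr//; exact: Ht.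
Qed.

(** Converse of [du_bois_reymond], used to return from an absolutely continuous slice to a weak form
    that can be integrated in [x]. *)
Lemma AC_weak_tents T (f g F : R -> R) : 0 < T -> AC 0 T F g ->
  {ae leb, forall t, t \in `]0, T[ -> f t = F t} -> measurable_fun `]0, T[ f ->
  weak_on_tents 0 T f g.
Proof.
move=> T0 acF fF mf n s t s' t' adm.
have acT := AC_tent n (ratr s) (ratr t) (ratr s') (ratr t') (ltW T0).
set te := tent _ _ _ _ _ in acT *; set dte := dtent _ _ _ _ _ in acT *.
have [gi _] := acF; have [di _] := acT.
have cdte : continuous dte.
  exact/locally_lipschitz_continuous/locally_lipschitz_dtent.
have i1 := AC_mul_integrable (ltW T0) acF di.
have i2 : itg `]0, T] (fun x => g x * te x).
  apply: eq_integrable (AC_mul_integrable (ltW T0) acT gi) => // x _ /=.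
  by rewrite mulrC.
have -> : \int[leb]_(u in `]0, T[) (f u * dte u) = \int[leb]_(u in `]0, T[) (F u * dte u).
  apply: ae_Rint_eq => //.
  - apply: measurable_funM => //; apply: (measurable_funS measurableT) => //.
    exact: continuous_measurable_fun.
  - by apply: itg_measurable; apply/integrable_bndo_bndc.
  - by apply: (ae_imp fF) => u Hu uI; rewrite Hu.
rewrite !Rintegral_itv_bndo_bndc; [|exact/integrable_bndo_bndc..].
apply/eqP; rewrite -addr_eq0 addrC -RintegralD//.
have -> : \int[leb]_(x in `]0, T]) (g x * te x + F x * dte x) = F T * te T - F 0 * te 0.
  exact: (AC_ibp (ltW T0) acF acT).
have -> : te T = 0.
  apply: (tent_out adm); apply/orP; right; case: adm => _ _ tb [_ _ tb'].
  by rewrite -lerBrDr ge_max !lerBrDr !ltW.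
have -> : te 0 = 0.
  apply: (tent_out adm); apply/orP; left; case: adm => sa _ _ [sa' _ _].
  by rewrite le_min !ltW.
by rewrite !mulr0 subrr.
Qed.

(** The chain rule applies to the absolutely continuous representative in time at almost every [x].
    The result is put back into weak form, which is linear and survives integration over [x] by
    Fubini; [du_bois_reymond] in time then produces [y]. *)
Lemma evolution T a b F G (Phi Phi' : R -> R) : 0 < T ->
  L1Q T a b F -> L1Q T a b G -> weak_t_on_tents T a b F G ->
  (forall r : R, is_derive r 1 Phi (Phi' r)) -> locally_lipschitz Phi' ->
  L1Q T a b (fun t x => Phi (F t x)) ->
  L1Q T a b (fun t x => G t x * Phi' (F t x)) ->
  exists2 y, AC 0 T y (fun t => \int[leb]_(x in `]a, b[) (G t x * Phi' (F t x))) &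
    {ae leb, forall t, t \in `]0, T[ -> \int[leb]_(x in `]a, b[) Phi (F t x) = y t}.
Proof.
move=> T0 FL GL wFG dPhi lPhi VL ZL.
apply: (du_bois_reymond T0 (L1Q_int_t VL) (L1Q_int_t ZL)).
move=> n s t s' t' adm.
have key : {ae leb, forall x, x \in `]a, b[ ->
    weak_on_tents 0 T (fun t => Phi (F t x)) (fun t => G t x * Phi' (F t x))}.
  apply: ae_imp2 (ae_and wFG (L1Q_ae_t FL)) (L1Q_ae_t GL) _.
  move=> x [wx Fx] Gx xI; have {}wx := wx xI; have {}Fx := Fx xI; have {}Gx := Gx xI.
  have [f acf Ff] := du_bois_reymond T0 Fx Gx wx.
  have acPhi := AC_chain (ltW T0) acf dPhi lPhi.
  have mPhi' : measurable_fun setT Phi'.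
    exact: (continuous_measurable_fun (locally_lipschitz_continuous lPhi)).
  have mF : measurable_fun `]0, T[ (F^~ x) by exact: itg_measurable Fx.
  have mG : measurable_fun `]0, T[ (G^~ x) by exact: itg_measurable Gx.
  have acV : AC 0 T (Phi \o f) (fun t => G t x * Phi' (F t x)).
    apply: AC_ae acPhi.
      apply/measurable_fun_itv_bndo_bndcP; apply: measurable_funM => //.
      exact: measurableT_comp.
    by apply: (ae_imp Ff) => u Hu uI; rewrite mulrC Hu.
  apply: (AC_weak_tents T0 acV).
    by apply: (ae_imp Ff) => u Hu uI; rewrite /= Hu.
  apply: measurableT_comp => //; apply: continuous_measurable_fun => r.
  by apply/differentiable_continuous/derivable1_diffP; have [] := dPhi r.
set te := tent _ _ _ _ _; set dte := dtent _ _ _ _ _.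
have cdte : continuous dte.
  exact/locally_lipschitz_continuous/locally_lipschitz_dtent.
have cte : continuous te by exact: continuous_tent.
have Vd := L1Q_mul_t (ltW T0) cdte VL; have Zt := L1Q_mul_t (ltW T0) cte ZL.
have i1 := L1Q_int_t Vd; have i2 := L1Q_int_t Zt.
have j1 := L1Q_int_x Vd; have j2 := L1Q_int_x Zt.
have k1 := L1Q_int_t VL; have k2 := L1Q_int_t ZL.
have mcont (g : R -> R) : continuous g -> measurable_fun `]0, T[ g.
  by move=> cg; apply: (measurable_funS measurableT) => //; exact: continuous_measurable_fun.
have -> : \int[leb]_(u in `]0, T[) ((\int[leb]_(x in `]a, b[) Phi (F u x)) * dte u) =
    \int[leb]_(u in `]0, T[) \int[leb]_(x in `]a, b[) (Phi (F u x) * dte u).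
  apply: ae_Rint_eq => //.
  - by apply: measurable_funM; [exact: itg_measurable k1|exact: mcont].
  - exact: itg_measurable i1.
  - by apply: (ae_imp (L1Q_int_mul_t dte VL)) => u Hu uI; rewrite Hu.
have -> : \int[leb]_(u in `]0, T[) ((\int[leb]_(x in `]a, b[) (G u x * Phi' (F u x))) * te u) =
    \int[leb]_(u in `]0, T[) \int[leb]_(x in `]a, b[) (G u x * Phi' (F u x) * te u).
  apply: ae_Rint_eq => //.
  - by apply: measurable_funM; [exact: itg_measurable k2|exact: mcont].
  - exact: itg_measurable i2.
  - by apply: (ae_imp (L1Q_int_mul_t te ZL)) => u Hu uI; rewrite Hu.
rewrite (L1Q_fubini Vd) (L1Q_fubini Zt).
rewrite -[RHS]mulN1r -RintegralZl//; apply: ae_Rint_eq => //.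
- exact: itg_measurable j1.
- by apply: measurable_funM => //; exact: itg_measurable j2.
- by apply: (ae_imp key) => x Hx xI; rewrite (Hx xI _ _ _ _ _ adm) mulN1r.
Qed.

End Evolution.

(** * Sobolev and Bochner norms *)

Section Spaces.
Context {R : realType}.
Local Notation leb := (@lebesgue_measure R).
Local Notation itg D f := (leb.-integrable D (EFin \o f)).
Implicit Types (a b x y : R) (f g h F G : R -> R).

Lemma Lp_norm2E a b f :
  Lp_norm a b 2%:E f = ((\int[leb]_(x in `]a, b[) (f x ^+ 2)%:E) `^ 2^-1)%E.
Proof.
rewrite /Lp_norm unlock /Lnorm; congr (_ `^ _)%E.
rewrite [RHS]integral_mkcond; apply: eq_integral => x _ /=.
rewrite !patchE; case: ifPn => _; last by rewrite normr0 powR0.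
by rewrite powR_mulrn// real_normK ?num_real.
Qed.

Lemma poweR_half_le (X : \bar R) (M : R) : (0 <= X)%E -> 0 <= M ->
  (X `^ 2^-1 <= M%:E)%E -> (X <= (M ^+ 2)%:E)%E.
Proof.
move=> X0 M0 H.
have -> : X = ((X `^ 2^-1) `^ 2)%E by rewrite -poweRrM mulVf ?poweRe1// pnatr_eq0.
have -> : (M ^+ 2)%:E = ((M%:E) `^ 2)%E by rewrite poweR_EFin powR_mulrn.
by apply: gt0_ler_poweR => //; rewrite in_itv/= ?poweR_ge0 ?lee_fin ?M0 leey.
Qed.

Lemma Lp_norm2_le a b f (M : R) : 0 <= M -> measurable_fun `]a, b[ f ->
  (Lp_norm a b 2%:E f <= M%:E)%E ->
  itg `]a, b[ (fun x => f x ^+ 2) /\ \int[leb]_(x in `]a, b[) f x ^+ 2 <= M ^+ 2.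
Proof.
move=> M0 mf; rewrite Lp_norm2E.
set I := (\int[leb]_(x in `]a, b[) (f x ^+ 2)%:E)%E => H.
have I0 : (0 <= I)%E by apply: integral_ge0 => x _; rewrite lee_fin sqr_ge0.
have IM := poweR_half_le I0 M0 H.
split.
  apply/integrableP; split.
    by apply/measurable_EFinP; exact: measurable_funX.
  rewrite (_ : (\int[_]_(_ in _) _)%E = I); last first.
    by apply: eq_integral => x _ /=; rewrite ger0_norm// sqr_ge0.
  exact: le_lt_trans IM (ltry _).
by rewrite -lee_fin /Rintegral fineK// ge0_fin_numE// (le_lt_trans IM (ltry _)).
Qed.

Lemma Lp_norm_ae a b f g : measurable_fun `]a, b[ f ->
  measurable_fun `]a, b[ g ->
  {ae leb, forall x, x \in `]a, b[ -> f x = g x} ->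
  Lp_norm a b 2%:E f = Lp_norm a b 2%:E g.
Proof.
move=> mf mg fg; rewrite !Lp_norm2E; congr (_ `^ _)%E.
apply: ae_eq_integral => //; try by apply/measurable_EFinP; exact: measurable_funX.
by apply: (ae_imp fg) => x H xI; rewrite H.
Qed.

Lemma Lp_norm_wderiv_le a b k f i : (i <= k)%N ->
  (Lp_norm a b 2%:E (iter i (wderiv a b) f) <= Sobolev_norm a b k f)%E.
Proof.
move=> ik; rewrite /Sobolev_norm.
have -> : Lp_norm a b 2%:E (iter i (wderiv a b) f) =
    ((Lp_norm a b 2%:E (iter i (wderiv a b) f) `^ 2) `^ 2^-1)%E.
  by rewrite -poweRrM mulfV ?poweRe1 ?pnatr_eq0//; exact: Lnorm_ge0.
apply: gt0_ler_poweR => //.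
- by rewrite in_itv/= poweR_ge0 leey.
- by rewrite in_itv/= leey andbT; apply: sume_ge0 => j _; exact: poweR_ge0.
have ik1 : (i < k.+1)%N by [].
rewrite (bigD1 (Ordinal ik1))//= leeDl//.
by apply: sume_ge0 => j _; exact: poweR_ge0.
Qed.

Lemma Lp2_measurable a b f : Lp a b 2%:E f -> measurable_fun `]a, b[ f.
Proof.
rewrite /Lp/= inE => /andP[+ _]; rewrite inE/= => mf.
by apply/(measurable_restrictT _ _).2.
Qed.

Lemma dtent_out a b n s t s' t' : admissible_knots a b n s t s' t' ->
  forall x, (x <= a) || (b <= x) -> dtent n s t s' t' x = 0.
Proof.
move=> [sa st tb [sa' st' tb']] x.
rewrite /dtent => /orP[xa|bx].
  by rewrite !drampn_lt ?subrr ?mulr0 ?subrr//; lra.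
by rewrite !drampn_gt ?subrr ?mulr0 ?subrr//; move: tb tb'; move: (n.+1%:R^-1) => e tb tb'; lra.
Qed.

(** Tents supported in a smaller interval are also tests on []a, b[]; this gives access to
    subintervals on which locally integrable functions are integrable. *)
Lemma weak_derivative_restrict a b c d f g : a <= c -> d <= b ->
  weak_derivative a b f g -> weak_on_tents c d f g.
Proof.
move=> ac db [_ _ H] n s t s' t' adm.
have adm' : admissible_knots a b n (ratr s : R) (ratr t) (ratr s') (ratr t').
  case: adm => h1 h2 h3 [h4 h5 h6].
  split; [exact: le_lt_trans h1|by []|exact: lt_le_trans db|].
  by split; [exact: le_lt_trans h4|by []|exact: lt_le_trans db].
have := H _ (test_tent adm'); rewrite derive1_tent.
have res h (k : R -> R) : (forall x, (x <= c) || (d <= x) -> k x = 0) ->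
    \int[leb]_(x in `]a, b[) (h x * k x) = \int[leb]_(x in `]c, d[) (h x * k x).
  move=> k0; rewrite Rintegral_mkcond [RHS]Rintegral_mkcond.
  apply: eq_Rintegral => x _; rewrite !patchE.
  case: ifPn => xab; case: ifPn => xcd //.
    move: xcd; rewrite notin_setE/= in_itv/= => /negP; rewrite negb_and -!leNgt.
    by move=> /k0 ->; rewrite mulr0.
  move: xab xcd; rewrite notin_setE inE/= !in_itv/= => /negP; rewrite negb_and -!leNgt.
  by move=> /orP[] h1 /andP[h2 h3]; lra.
rewrite (res f); last exact: dtent_out adm.
rewrite (res g)// => x xo; apply: (tent_out adm).
case: adm => h1 h2 h3 [h4 h5 h6].
apply/orP; case/orP: xo => xo; [left|right].
  by rewrite le_min; apply/andP; split; [have := ltW h1|have := ltW h4]; exact: le_trans.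
rewrite -lerBrDr ge_max !lerBrDr; apply/andP; split; apply: le_trans xo; exact: ltW.
Qed.

Lemma locally_integrable_itg a b c d f : a < c -> d < b ->
  locally_integrable `]a, b[ f -> itg `]c, d[ f.
Proof.
move=> ac db [mf _ H].
have sub : `[c, d]%classic `<=` `]a, b[.
  by apply: subset_itv; rewrite bnd_simp.
have fi : itg `[c, d] f.
  apply/integrableP; split; last exact: H sub (@segment_compact _ _ _).
  by apply/measurable_EFinP; exact: measurable_funS mf.
by apply: integrableS fi => //; exact: subset_itv_oo_cc.
Qed.

(** On each []a + e n, b - e n[] the two absolutely continuous representatives of [f] coincide,
    hence so do their derivatives, and these intervals exhaust []a, b[]. Uniqueness matters because
    [Sobolev_norm] is computed with the derivative chosen by [wderiv]. *)
Lemma weak_derivative_unique a b f g g' : weak_derivative a b f g ->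
  weak_derivative a b f g' -> {ae leb, forall x, x \in `]a, b[ -> g x = g' x}.
Proof.
move=> fg fg'; have [lf lg _] := fg; have [_ lg' _] := fg'.
pose e n : R := n.+1%:R^-1.
have e0 n : 0 < e n by rewrite invr_gt0 ltr0n.
have H n : {ae leb, forall x, x \in `]a + e n, b - e n[ -> g x = g' x}.
  have [cd|dc] := ltP (a + e n) (b - e n); last first.
    apply: ae_true => x; rewrite in_itv/= => /andP[h1 h2]; lra.
  have h1 : a < a + e n by rewrite ltrDl.
  have h2 : b - e n < b by rewrite gtrBl.
  have fi := locally_integrable_itg h1 h2 lf.
  have gi := locally_integrable_itg h1 h2 lg.
  have gi' := locally_integrable_itg h1 h2 lg'.
  have [F acF fF] := du_bois_reymond cd fi gi (weak_derivative_restrict (ltW h1) (ltW h2) fg).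
  have [F' acF' fF'] := du_bois_reymond cd fi gi' (weak_derivative_restrict (ltW h1) (ltW h2) fg').
  have acD := AC_add acF (AC_scale (-1) acF').
  have D0 := AC_ae0 cd acD (c := 0).
  have {}D0 : forall x, a + e n <= x <= b - e n -> F x + -1 * F' x = 0.
    apply: D0; apply: ae_imp2 fF fF' _ => x hx hx' xI.
    by rewrite -hx// -hx'// mulN1r subrr.
  have := AC_cst_deriv0 cd acD (c := 0) => /(_ _)/ae_imp; apply.
    by move=> x /andP[x1 x2]; apply: D0; rewrite !ltW.
  by move=> x hx /hx; rewrite mulN1r => /subr0_eq.
have := ae_count H => /ae_imp; apply => x Hx; rewrite in_itv/= => /andP[ax xb].
have m0 : 0 < Num.min (x - a) (b - x) by rewrite lt_min !subr_gt0 ax.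
have [n nm] : exists n, e n < Num.min (x - a) (b - x).
  exact: (filter_ex (near_infty_natSinv_lt (PosNum m0))).
apply: (Hx n); rewrite in_itv/=; move: nm; rewrite lt_min => /andP[h1 h2].
by apply/andP; split; lra.
Qed.

Lemma wderivP a b f g : weak_derivative a b f g ->
  weak_derivative a b f (wderiv a b f).
Proof. by move=> fg; rewrite /wderiv; case: xgetP => [_ -> //|/(_ g)]. Qed.

Lemma wderiv_ae a b f g : weak_derivative a b f g ->
  {ae leb, forall x, x \in `]a, b[ -> wderiv a b f x = g x}.
Proof. by move=> fg; exact: weak_derivative_unique (wderivP fg) fg. Qed.

Lemma weak_derivative_ae a b f f' g : weak_derivative a b f g ->
  locally_integrable `]a, b[ f' ->
  {ae leb, forall x, x \in `]a, b[ -> f x = f' x} -> weak_derivative a b f' g.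
Proof.
move=> [lf lg H] lf' ff'; split => // phi tphi; rewrite -H//.
have [mf _ _] := lf; have [mf' _ _] := lf'.
have cp : continuous (derive1 phi).
  move=> x; apply/differentiable_continuous/derivable1_diffP.
  by have [sp _] := tphi; exact: (sp 1%N x).
have mp : measurable_fun `]a, b[ (derive1 phi).
  by apply: (measurable_funS measurableT) => //; exact: continuous_measurable_fun.
apply: ae_Rint_eq => //; try exact: measurable_funM.
by apply: (ae_imp ff') => x Hx xI; rewrite Hx.
Qed.

Lemma itg_of_sqr a b f : measurable_fun `]a, b[ f -> itg `]a, b[ (fun x => f x ^+ 2) ->
  itg `]a, b[ f.
Proof.
move=> mf f2.
have c1 : itg `]a, b[ (cst 1 : R -> R) by apply/integrable_bndo_bndc; exact: integrable_cst.
apply: integrable_le (integrable_add _ c1 f2) => // x _.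
have := sqr_ge0 (`|f x| - 1); have := normr_ge0 (f x).
rewrite -(real_normK (num_real (f x))) /cst; nra.
Qed.

Lemma weak_derivative_AC a b f g : a < b -> weak_derivative a b f g ->
  itg `]a, b[ (fun x => f x ^+ 2) -> itg `]a, b[ (fun x => g x ^+ 2) ->
  exists2 F, AC a b F g & {ae leb, forall x, x \in `]a, b[ -> f x = F x}.
Proof.
move=> ab fg f2 g2; have [[mf _ _] [mg _ _] _] := fg.
apply: du_bois_reymond => //; try exact: itg_of_sqr.
exact: weak_derivative_tents.
Qed.

End Spaces.

(** * Integration by parts for functions in [H^1_0] *)

Section Trace.
Context {R : realType}.
Local Notation leb := (@lebesgue_measure R).
Local Notation itg D f := (leb.-integrable D (EFin \o f)).
Implicit Types (a b x y : R) (f g h F G phi : R -> R).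

Lemma smooth_derive1 phi : smooth phi -> smooth (derive1 phi).
Proof. by move=> /smoothP s; apply/smoothP => k; have [] := s k.+1. Qed.

Lemma smooth_continuous phi : smooth phi -> continuous phi.
Proof.
by move=> sp x; apply/differentiable_continuous/derivable1_diffP; exact: (sp 0%N x).
Qed.

Lemma smooth_is_derive phi : smooth phi -> forall x : R, is_derive x 1 phi (derive1 phi x).
Proof. by move=> /smoothP /(_ 0%N) /Cn_deriv. Qed.

Lemma smooth_AC a b phi : a <= b -> smooth phi -> AC a b phi (derive1 phi).
Proof.
move=> ab sp; apply: AC_C1 => //; first exact: smooth_is_derive.
have sp' := smooth_derive1 sp.
apply: (@locally_lipschitz_C1 _ _ (derive1 (derive1 phi))).
  exact: smooth_is_derive.
exact/smooth_continuous/smooth_derive1.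
Qed.

Lemma continuous_locally_integrable a b f : continuous f ->
  locally_integrable `]a, b[ f.
Proof.
move=> cf; apply: open_integrable_locally; first exact: interval_open.
apply/integrable_bndo_bndc; apply/integrable_obnd_cbnd.
apply: continuous_compact_integrable; first exact: segment_compact.
exact: continuous_subspaceT.
Qed.

Lemma weak_derivative_smooth a b phi : a < b -> smooth phi ->
  weak_derivative a b phi (derive1 phi).
Proof.
move=> ab sp; split.
- exact/continuous_locally_integrable/smooth_continuous.
- exact/continuous_locally_integrable/smooth_continuous/smooth_derive1.
move=> psi [sq [c [d [ac db psi0]]]].
have acp := smooth_AC (ltW ab) sp; have acq := smooth_AC (ltW ab) sq.
have [pi _] := acp; have [qi _] := acq.
have i1 := AC_mul_integrable (ltW ab) acp qi.
have i2 : itg `]a, b] (fun x => derive1 phi x * psi x).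
  apply: eq_integrable (AC_mul_integrable (ltW ab) acq pi) => // x _ /=.
  by rewrite mulrC.
rewrite !Rintegral_itv_bndo_bndc; [|exact/integrable_bndo_bndc..].
apply/eqP; rewrite -addr_eq0 addrC -RintegralD//.
rewrite (AC_ibp (ltW ab) acp acq).
rewrite !psi0 ?mulr0 ?subrr// in_itv/= negb_and -!ltNge ?ac ?db ?orbT//.
Qed.

Lemma integrable_mul_continuous a b f g : continuous g -> itg `]a, b[ f ->
  itg `]a, b[ (fun t => f t * g t).
Proof.
move=> cg fi; apply/integrable_bndo_bndc.
have := continuous_mul_integrable cg ((integrable_bndo_bndc _ _ _).1 fi).
by apply: eq_integrable => // u _ /=; rewrite mulrC.
Qed.

Lemma weak_derivativeB a b f f' g g' : weak_derivative a b f g ->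
  weak_derivative a b f' g' -> itg `]a, b[ f -> itg `]a, b[ f' ->
  itg `]a, b[ g -> itg `]a, b[ g' ->
  weak_derivative a b (f \- f') (g \- g').
Proof.
move=> [lf lg H] [lf' lg' H'] fi fi' gi gi'; split.
- exact: locally_integrableB.
- exact: locally_integrableB.
move=> psi tpsi; have [sp _] := tpsi; have sp' := smooth_derive1 sp.
under eq_Rintegral do rewrite /= mulrBl.
under [in RHS]eq_Rintegral do rewrite /= mulrBl.
rewrite !RintegralB//; try by apply: integrable_mul_continuous => //; exact: smooth_continuous.
by rewrite H// H'// opprB opprK addrC.
Qed.

(** A substitute for the Cauchy-Schwarz inequality: a bound linear in [e] is enough when [e] tends
    to [0], and no square roots of integrals occur. *)
Lemma young_int (D : set R) (p F : R -> R) (e : R) : measurable D -> measurable_fun D p ->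
  measurable_fun D F -> itg D (fun x => p x ^+ 2) -> itg D (fun x => F x ^+ 2) ->
  0 < e -> \int[leb]_(x in D) p x ^+ 2 <= e ^+ 2 ->
  `|\int[leb]_(x in D) (p x * F x)| <= e * (1 + \int[leb]_(x in D) F x ^+ 2).
Proof.
move=> mD mp mF p2 F2 e0 pe.
have pF := integrable_mul_sqr mD mp mF p2 F2.
apply: le_trans (le_normr_Rintegral _ _) _ => //.
apply: (@le_trans _ _ (\int[leb]_(x in D) (e^-1 * p x ^+ 2 + e * F x ^+ 2))).
  apply: le_Rintegral => //.
  - exact: integrable_norm.
  - by apply: integrable_add => //; exact: integrable_scale.
  move=> x _; rewrite normrM -(real_normK (num_real (p x))) -(real_normK (num_real (F x))).
  move: (`|p x|) (`|F x|) (normr_ge0 (p x)) (normr_ge0 (F x)) => u v u0 v0.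
  have : 0 <= e^-1 * (u - e * v) ^+ 2 by rewrite mulr_ge0 ?sqr_ge0 ?invr_ge0 ?ltW.
  have -> : e^-1 * (u - e * v) ^+ 2 = e^-1 * u ^+ 2 + e * v ^+ 2 - 2 * (u * v).
    by field; rewrite gt_eqF.
  have : 0 <= u * v by rewrite mulr_ge0.
  lra.
rewrite RintegralD//; try exact: integrable_scale.
rewrite !RintegralZl// mulrDr mulr1 lerD2r.
by rewrite ler_pdivrMl// -expr2.
Qed.

(** Integration by parts has no boundary term for the test functions approximating [f]; what is left
    is controlled by the [H^1] norm of [phi_ n - f], which can be made smaller than any [e]. *)
Lemma Sobolev10_vanishing_trace a b f w : a < b -> Sobolev10 a b f ->
  weak_derivative a b f w -> itg `]a, b[ (fun x => f x ^+ 2) ->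
  itg `]a, b[ (fun x => w x ^+ 2) -> vanishing_trace a b f w.
Proof.
move=> ab [_ [phi_ tphi cv]] fw f2 w2 F G acF G2; have lab := ltW ab.
have [lf lw _] := fw; have [mf _ _] := lf; have [mw _ _] := lw.
have fi := itg_of_sqr mf f2; have wi := itg_of_sqr mw w2.
have [Gi _] := acF; have Fi := AC_integrable lab acF.
have mF := itg_measurable Fi; have mG := itg_measurable Gi.
have F2 : itg `]a, b] (fun x => F x ^+ 2).
  by apply: eq_integrable (AC_mul_integrable lab acF Fi) => // x _ /=; rewrite expr2.
have mf' := (measurable_fun_itv_bndo_bndcP _ _ _).1 mf.
have mw' := (measurable_fun_itv_bndo_bndcP _ _ _).1 mw.
have f2' : itg `]a, b] (fun x => f x ^+ 2) by exact/integrable_bndo_bndc.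
have w2' : itg `]a, b] (fun x => w x ^+ 2) by exact/integrable_bndo_bndc.
have wF := integrable_mul_sqr (measurable_itv _) mw' mF w2' F2.
have fG := integrable_mul_sqr (measurable_itv _) mf' mG f2' G2.
set S := _ + _.
have key (e : R) : 0 < e -> `|S| <= e * ((1 + \int[leb]_(x in `]a, b]) F x ^+ 2) +
    (1 + \int[leb]_(x in `]a, b]) G x ^+ 2)).
  move=> e0.
  have [n Sn] : exists n, (Sobolev_norm a b 1 (phi_ n \- f)%R <= e%:E)%E.
    have /fine_cvgP[fin cv'] := cv.
    have /cvgrPdist_le/(_ e e0) cle := cv'.
    have [n [fn len]] := filter_ex (filterI fin cle).
    exists n; rewrite -(fineK fn) lee_fin; apply: le_trans len.
    by rewrite /= sub0r normrN ler_norm.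
  have [sp [c [d [ac db phi0]]]] := tphi n; set phi := phi_ n in sp phi0 Sn.
  have acp := smooth_AC lab sp; have [p'i _] := acp.
  have pi := AC_integrable lab acp.
  have wd := weak_derivativeB (weak_derivative_smooth ab sp) fw
    ((integrable_bndo_bndc _ _ _).2 pi) fi ((integrable_bndo_bndc _ _ _).2 p'i) wi.
  have [[mpf _ _] [mpw _ _] _] := wd.
  have [_ [mwd _ _] _] := wderivP wd.
  have n0 := Lp_norm2_le (ltW e0) mpf (le_trans (Lp_norm_wderiv_le a b (phi \- f) (isT : 0 <= 1)%N) Sn).
  have n1 := le_trans (Lp_norm_wderiv_le a b (phi \- f) (isT : 1 <= 1)%N) Sn.
  (* The chosen derivative of [phi - f] is exchanged for [derive1 phi - w], equal to it almost
     everywhere. *)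
  rewrite /= (Lp_norm_ae mwd mpw (wderiv_ae wd)) in n1.
  have {}n1 := Lp_norm2_le (ltW e0) mpw n1.
  have [p2 pe] := n0; have [q2 qe] := n1.
  have p2' := (integrable_bndo_bndc _ _ _).1 p2.
  have q2' := (integrable_bndo_bndc _ _ _).1 q2.
  rewrite Rintegral_itv_bndo_bndc// in pe; rewrite Rintegral_itv_bndo_bndc// in qe.
  have mpf' := (measurable_fun_itv_bndo_bndcP _ _ _).1 mpf.
  have mpw' := (measurable_fun_itv_bndo_bndcP _ _ _).1 mpw.
  have y1 := young_int (measurable_itv _) mpf' mG p2' G2 e0 pe.
  have y2 := young_int (measurable_itv _) mpw' mF q2' F2 e0 qe.
  have i1 := integrable_mul_sqr (measurable_itv _) mpf' mG p2' G2.
  have i2 := integrable_mul_sqr (measurable_itv _) mpw' mF q2' F2.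
  have j1 := AC_mul_integrable lab acp Gi.
  have j2 : itg `]a, b] (fun x => derive1 phi x * F x).
    apply: eq_integrable (AC_mul_integrable lab acF p'i) => // x _ /=.
    by rewrite mulrC.
  have e1 : \int[leb]_(x in `]a, b]) ((derive1 phi \- w) x * F x) =
     \int[leb]_(x in `]a, b]) (derive1 phi x * F x) - \int[leb]_(x in `]a, b]) (w x * F x).
    by rewrite -RintegralB//; apply: eq_Rintegral => x _ /=; rewrite mulrBl.
  have e2 : \int[leb]_(x in `]a, b]) ((phi \- f) x * G x) =
     \int[leb]_(x in `]a, b]) (phi x * G x) - \int[leb]_(x in `]a, b]) (f x * G x).
    by rewrite -RintegralB//; apply: eq_Rintegral => x _ /=; rewrite mulrBl.
  have := AC_ibp lab acp acF; rewrite RintegralD//.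
  have -> : phi b = 0 by apply: phi0; rewrite in_itv/= negb_and -!ltNge db orbT.
  have -> : phi a = 0 by apply: phi0; rewrite in_itv/= negb_and -!ltNge ac.
  rewrite !mul0r subrr => e3.
  have -> : S = - (\int[leb]_(x in `]a, b]) ((derive1 phi \- w) x * F x) +
                \int[leb]_(x in `]a, b]) ((phi \- f) x * G x)).
    by rewrite e1 e2 addrACA e3 /S add0r -opprD opprK.
  by rewrite normrN mulrDr (le_trans (ler_normD _ _))// lerD.
set C := _ + _ in key.
have C0 : 0 <= C.
  by rewrite /C !addr_ge0// Rintegral_ge0// => x _; exact: sqr_ge0.
apply/eqP; rewrite -normr_le0; apply/ler_addgt0Pl => e e0; rewrite addr0.
apply: le_trans (key _ (divr_gt0 e0 (ltr_wpDl C0 ltr01))) _.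
by rewrite -mulrA ler_piMr ?(ltW e0)// mulrC ler_pdivrMr ?ltr_wpDl// mul1r lerDl.
Qed.

End Trace.

(** * Bounds extracted from Bochner norms *)

Section BochnerBounds.
Context {R : realType}.
Local Notation leb := (@lebesgue_measure R).
Implicit Types (a b x y T : R) (F G : R -> R -> R).

Lemma measurable_patch (D : set R) (f : R -> R) : measurable D ->
  measurable_fun D f -> measurable_fun setT (f \_ D).
Proof. by move=> mD mf; apply: ((measurable_restrictT f mD).1 mf). Qed.

Lemma emeasurable_patch (D : set R) (f : R -> \bar R) : measurable D ->
  measurable_fun D f -> measurable_fun setT (f \_ D).
Proof. by move=> mD mf; apply: ((measurable_restrictT f mD).1 mf). Qed.

Lemma lebT_gt0 : (0 < leb setT)%E.
Proof.
apply: (@lt_le_trans _ _ (leb `[0, 1])).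
  by rewrite lebesgue_measure_itv/= lte_fin ltr01 oppr0 adde0 lte_fin.
by apply: le_measure; rewrite ?inE.
Qed.

Lemma bochner_infty a b T (X : function_space) F :
  (forall f, 0 <= fs_norm X f)%E -> Bochner a b T +oo%E X F ->
  exists2 M : R, 0 <= M & {ae leb, forall t, t \in `]0, T[ ->
    fs_mem X (F t) /\ (fs_norm X (F t) <= M%:E)%E}.
Proof.
move=> X0 [_ mem]; rewrite unlock /Lnorm; case: ifPn => [_|]; last first.
  by rewrite lebT_gt0.
set h := abse \o _; move=> hoo; have hs := ess_sup_ge leb h.
exists (Num.max 0 (fine (ess_sup leb h))); first by rewrite le_max lexx.
apply: ae_imp2 mem hs _ => t mt ht tI; split; first exact: mt.
have {ht} : (fs_norm X (F t) <= ess_sup leb h)%E.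
  move: ht; rewrite /h /= patchE mem_set//; apply: le_trans.
  by rewrite gee0_abs.
move=> h1; apply: le_trans h1 _.
have s0 : (0 <= ess_sup leb h)%E.
  apply: ess_sup_gee; first by rewrite lebT_gt0.
  by apply: nearW => s; exact: abse_ge0.
rewrite -(@fineK _ (ess_sup leb h)); last by rewrite ge0_fin_numE.
by rewrite lee_fin /= le_max lexx orbT.
Qed.

Lemma L1_le_L2 a b (f : R -> R) : a < b -> measurable_fun `]a, b[ f ->
  (\int[leb]_(x in `]a, b[) `|f x|%:E <= Lp_norm a b 2%:E f * ((b - a) `^ 2^-1)%:E)%E.
Proof.
move=> ab mf; pose g : R -> R := cst 1.
have m1 : measurable_fun setT (f \_ `]a, b[) by exact: measurable_patch.
have m2 : measurable_fun setT (g \_ `]a, b[).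
  by apply: measurable_patch => //; exact: measurable_cst.
have := @hoelder _ _ _ leb (f \_ `]a, b[) (g \_ `]a, b[) 2 2 m1 m2.
rewrite -/(Lp_norm a b 2%:E f) -/(Lp_norm a b 2%:E g) => /(_ _ _ _).
have -> : Lp_norm a b 2%:E g = ((b - a) `^ 2^-1)%:E.
  rewrite Lp_norm2E -poweR_EFin; congr (_ `^ _)%E.
  under eq_integral do rewrite /g /cst expr1n.
  by rewrite integral_cst//= lebesgue_measure_itv/= lte_fin ab mul1e EFinD.
move=> H; apply: le_trans (H _ _ _) => //; last by rewrite [RHS]splitr !div1r.
rewrite Lnorm1 [leLHS]integral_mkcond; apply: ge0_le_integral => //.
- by move=> x _; rewrite patchE; case: ifPn.
- by apply: emeasurable_patch => //; apply/measurable_EFinP; exact: measurableT_comp.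
- by apply: measurableT_comp => //; apply/measurable_EFinP; exact: measurable_funM.
- move=> x _; rewrite /= !patchE; case: ifPn => _; first by rewrite /g /cst mulr1.
  by apply: (@le_trans _ _ 0%E) => //; rewrite lee_fin.
Qed.

Lemma measurable_Lp_slice T a b F : jm T a b F ->
  measurable_fun `]0, T[ (fun t => Lp_norm a b 2%:E (F t)).
Proof.
move=> mF; have mF2 := jm_mul mF mF; have m := measurable_int_slice mF2.
have -> : (fun t => Lp_norm a b 2%:E (F t)) =
    (fun t => (\int[leb]_(x in `]a, b[) `|F t x * F t x|%:E) `^ 2^-1)%E.
  apply/funext => t; rewrite Lp_norm2E; congr (_ `^ _)%E.
  by apply: eq_integral => x _; rewrite -expr2 ger0_norm// sqr_ge0.
by apply: (measurableT_comp (measurable_poweR _) m).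
Qed.

Lemma bochner_L1 a b T F : a < b -> Bochner a b T 1%E (L2_space a b) F -> L1Q T a b F.
Proof.
move=> ab [mF _]; rewrite Lnorm1 => Foo; split => //.
have mL := measurable_Lp_slice mF.
apply: (@le_lt_trans _ _ (\int[leb]_(t in `]0%R, T[)
    (Lp_norm a b 2%:E (F t) * ((b - a) `^ 2^-1)%:E))%E).
  apply: ge0_le_integral => //.
  - by move=> t _; apply: integral_ge0.
  - exact: measurable_int_slice.
  - by apply: emeasurable_funM.
  - by move=> t tI; apply: L1_le_L2 => //; exact: measurable_slice_x mF tI.
under eq_integral do rewrite muleC.
rewrite ge0_integralZl ?lee_fin ?powR_ge0//; last by move=> t _; exact: Lnorm_ge0.
apply: lte_mul_pinfty => //; first by rewrite lee_fin powR_ge0.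
apply: le_lt_trans Foo; rewrite integral_mkcond; apply: ge0_le_integral => //.
- by move=> t _; rewrite patchE; case: ifPn => // _; exact: Lnorm_ge0.
- exact: emeasurable_patch.
- by apply: measurableT_comp => //; exact: emeasurable_patch.
- by move=> t _; rewrite !patchE; case: ifPn => _; rewrite lee_abs.
Qed.

End BochnerBounds.

(** * Regularity of the slices of a solution *)

Section Slices.
Context {R : realType}.
Local Notation leb := (@lebesgue_measure R).
Local Notation itg D f := (leb.-integrable D (EFin \o f)).
Implicit Types (a b x y T : R) (F G : R -> R -> R).

(** [M] bounds the square of the [L^2] norm, not the norm. *)
Definition sqr_bounded a b (M : R) (f : R -> R) :=
  [/\ measurable_fun `]a, b[ f, itg `]a, b[ (fun x => f x ^+ 2) &
      \int[leb]_(x in `]a, b[) f x ^+ 2 <= M].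

Lemma sqr_bounded_weaken a b M N f : M <= N -> sqr_bounded a b M f -> sqr_bounded a b N f.
Proof. by move=> MN [mf fi fM]; split => //; exact: le_trans MN. Qed.

Lemma sqr_bounded_L1 a b M f : a < b -> sqr_bounded a b M f ->
  \int[leb]_(x in `]a, b[) `|f x| <= (b - a) + M.
Proof.
move=> ab [mf f2 fM]; have fi := itg_of_sqr mf f2.
have c1 : itg `]a, b[ (cst 1 : R -> R) by apply/integrable_bndo_bndc; exact: integrable_cst.
apply: (@le_trans _ _ (\int[leb]_(x in `]a, b[) (1 + f x ^+ 2))).
  apply: le_Rintegral => //; first exact: integrable_norm.
    exact: integrable_add.
  move=> x _; have := sqr_ge0 (`|f x| - 1).
  rewrite -(real_normK (num_real (f x))); have := normr_ge0 (f x); nra.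
rewrite RintegralD//; apply: lerD => //.
by rewrite Rintegral_itv_bndo_bndc// Rint_cst ?mul1r// ltW.
Qed.

(** Embedding of [H^1] into the bounded functions: [|v x|] is at most the mean of [|v|] plus
    [\int |g|], and both [L^1] norms are at most [(b - a) + M] since [|r| <= 1 + r^2]. *)
Lemma AC_sup_bound a b M v g : a < b -> AC a b v g -> sqr_bounded a b M g ->
  sqr_bounded a b M v -> forall x, a <= x <= b ->
  `|v x| <= 1 + M / (b - a) + ((b - a) + M).
Proof.
move=> ab acv gM vM x xab; have lab := ltW ab; have L0 : 0 < b - a by rewrite subr_gt0.
have g1 := sqr_bounded_L1 ab gM; have v1 := sqr_bounded_L1 ab vM.
have [gi _] := acv; have vi := AC_integrable lab acv.
have ni : itg `]a, b] (fun x => `|g x|) by exact: integrable_norm.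
rewrite Rintegral_itv_bndo_bndc in g1; last exact/integrable_bndo_bndc.
rewrite Rintegral_itv_bndo_bndc in v1; last first.
  by apply/integrable_bndo_bndc; exact: integrable_norm.
have D u w : a <= u -> u <= w -> w <= b -> `|v w - v u| <= (b - a) + M.
  move=> au uw wb; apply: le_trans (AC_dist acv au uw wb) _.
  apply: le_trans g1; apply: le_Rint_subset => //.
  by apply: subset_itv; rewrite bnd_simp.
have key y : a <= y <= b -> `|v x| <= `|v y| + ((b - a) + M).
  move=> /andP[ay yb]; have /andP[ax xb] := xab.
  have -> : v x = v y + (v x - v y) by ring.
  apply: le_trans (ler_normD _ _) _; rewrite lerD2l.
  have [yx|/ltW xy] := leP y x; first exact: D.
  by rewrite distrC; exact: D.
have h1 : (b - a) * `|v x| <= ((b - a) + M) + (b - a) * ((b - a) + M).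
  apply: (@le_trans _ _ (\int[leb]_(y in `]a, b]) (((b - a) + M) + 1 * `|v y|))).
    have -> : (b - a) * `|v x| = \int[leb]_(_ in `]a, b]) `|v x|.
      by rewrite Rint_cst// mulrC.
    apply: le_Rintegral => //; first exact: integrable_cst.
      apply: integrable_add => //; first exact: integrable_cst.
      by apply: integrable_scale => //; exact: integrable_norm.
    move=> y /=; rewrite in_itv/= => /andP[ay yb].
    by rewrite mul1r addrC; apply: key; rewrite yb ltW.
  rewrite Rint_addZ//; last 2 first.
  - exact: integrable_cst.
  - exact: integrable_norm.
  by rewrite Rint_cst// mul1r; lra.
rewrite -(ler_pM2l L0); apply: le_trans h1 _.
have -> : (b - a) * (1 + M / (b - a) + (b - a + M)) =
  ((b - a) + M) + (b - a) * ((b - a) + M) by field; rewrite gt_eqF.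
by [].
Qed.

(** All that is used of a solution at one time, once the exceptional times are discarded. [th] and
    [ux] come with absolutely continuous representatives so that they can serve as test
    functions. *)
Record slice a b (mu M : R) (th tht thx ut utt utx ux uxx : R -> R) : Prop := Slice {
  sl_th : exists2 v, AC a b v thx & {ae leb, forall x, x \in `]a, b[ -> th x = v x};
  sl_th2 : sqr_bounded a b M th;
  sl_thx2 : sqr_bounded a b M thx;
  sl_ut2 : sqr_bounded a b M ut;
  sl_utx2 : sqr_bounded a b M utx;
  sl_ux2 : sqr_bounded a b M ux;
  sl_uxx2 : sqr_bounded a b M uxx;
  sl_ux : exists2 v, AC a b v uxx & {ae leb, forall x, x \in `]a, b[ -> ux x = v x};
  sl_tht : itg `]a, b[ tht;
  sl_heat : heat_slice a b mu th thx tht utx;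
  sl_trace : vanishing_trace a b ut utx;
  sl_wave : {ae leb, forall x, x \in `]a, b[ -> utt x = uxx x + mu * thx x} }.

Lemma Sobolev_norm_ge0 a b k f : (0 <= Sobolev_norm a b k f)%E.
Proof. exact: poweR_ge0. Qed.

Lemma Sobolev_norm_sqr_bounded a b k f g M : (0 < k)%N -> 0 <= M ->
  weak_derivative a b f g -> (Sobolev_norm a b k f <= M%:E)%E ->
  sqr_bounded a b (M ^+ 2) f /\ sqr_bounded a b (M ^+ 2) g.
Proof.
move=> k0 M0 fg fM; have [[mf _ _] [mg _ _] _] := fg.
have [f2 fb] := Lp_norm2_le M0 mf (le_trans (Lp_norm_wderiv_le a b f (leq0n k)) fM).
have := le_trans (Lp_norm_wderiv_le a b f k0) fM.
have [_ [mw _ _] _] := wderivP fg.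
rewrite /= (Lp_norm_ae mw mg (wderiv_ae fg)) => /(Lp_norm2_le M0 mg)[g2 gb].
by split; split.
Qed.

(** The second-order term of [Sobolev_norm] differentiates the chosen derivative of [f]; that one
    agrees with [g] almost everywhere, so it too has the weak derivative [h]. *)
Lemma Sobolev_norm2_sqr_bounded a b f g h M : 0 <= M ->
  weak_derivative a b f g -> weak_derivative a b g h ->
  (Sobolev_norm a b 2 f <= M%:E)%E ->
  sqr_bounded a b (M ^+ 2) g /\ sqr_bounded a b (M ^+ 2) h.
Proof.
move=> M0 fg gh fM; have [_ gb] := Sobolev_norm_sqr_bounded (isT : 0 < 2)%N M0 fg fM.
split => //.
have wfg := wderiv_ae fg; have [_ lw _] := wderivP fg.
have wh : weak_derivative a b (wderiv a b f) h.
  apply: weak_derivative_ae gh lw _.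
  by apply: (ae_imp wfg) => x H xI; rewrite H.
have := le_trans (Lp_norm_wderiv_le a b f (isT : 2 <= 2)%N) fM.
have [_ [mw _ _] _] := wderivP wh; have [_ [mh _ _] _] := gh.
rewrite /= (Lp_norm_ae mw mh (wderiv_ae wh)) => /(Lp_norm2_le M0 mh)[h2 hb].
by split.
Qed.

(** At almost every [x] the difference of the two derivatives is zero for almost every [t], and
    [ae_swap] exchanges the order. This identifies the time derivative hidden in the regularity
    class of [u] with [ut]. *)
Lemma weak_t_unique T a b F G G' : 0 < T -> L1Q T a b G -> L1Q T a b G' ->
  weak_t_on_tents T a b F G -> weak_t_on_tents T a b F G' ->
  {ae leb, forall t, t \in `]0, T[ -> {ae leb, forall x, x \in `]a, b[ -> G t x = G' t x}}.
Proof.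
move=> T0 GL GL' H H'; have [mG _] := GL; have [mG' _] := GL'.
have mD : jm T a b (fun t x => G t x + -1 * G' t x) by apply: jm_add => //; exact: jm_scale.
have := ae_swap mD => /(_ _)/ae_imp; apply; last first.
  move=> t Ht tI; apply: (ae_imp (Ht tI)) => x Hx /Hx.
  by rewrite mulN1r => /subr0_eq.
have GG := ae_and (L1Q_ae_t GL) (L1Q_ae_t GL').
apply: ae_imp2 (ae_and H H') GG _.
move=> x [Hx Hx'] [Gx Gx'] xI.
have Gi := Gx xI; have Gi' := Gx' xI.
apply: weak_on_tents0 => //.
  by apply: integrable_add => //; exact: integrable_scale.
move=> n s t s' t' adm.
have e := Hx xI _ _ _ _ _ adm; have e' := Hx' xI _ _ _ _ _ adm.
have cT := @continuous_tent R n (ratr s) (ratr t) (ratr s') (ratr t').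
set te := tent _ _ _ _ _ in e e' cT *.
have mi k : itg `]0, T[ k -> itg `]0, T[ (fun t => k t * te t).
  move=> ki; apply/integrable_bndo_bndc.
  have := continuous_mul_integrable cT ((integrable_bndo_bndc _ _ _).1 ki).
  by apply: eq_integrable => // u _ /=; rewrite mulrC.
have -> : \int[leb]_(u in `]0, T[) ((G u x + -1 * G' u x) * te u) =
   \int[leb]_(u in `]0, T[) (G u x * te u) + -1 * \int[leb]_(u in `]0, T[) (G' u x * te u).
  rewrite -Rint_addZ//; try exact: mi.
  by apply: eq_Rintegral => u _; rewrite mulrDl mulrA.
under eq_Rintegral do rewrite mul0r.
rewrite Rintegral_cst// mul0r mulN1r; move: e e'.
move: (\int[leb]_(u in `]0, T[) (F u x * _)) => I -> /oppr_inj ->.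
by rewrite subrr oppr0.
Qed.

End Slices.

(** * Equations satisfied by almost every time slice *)

Section SliceEquations.
Context {R : realType}.
Local Notation leb := (@lebesgue_measure R).
Local Notation itg D f := (leb.-integrable D (EFin \o f)).
Implicit Types (a b x y T : R) (F G : R -> R -> R).

Lemma L1Q_mul_x T a b F (g : R -> R) : a <= b -> continuous g -> L1Q T a b F ->
  L1Q T a b (fun t x => F t x * g x).
Proof.
move=> ab cg FL.
have [||c _ cP] := @EVT_max R (fun x => `|g x|) a b.
- by [].
- apply: continuous_subspaceT => x.
  by apply: continuous_comp; [exact: cg|exact: norm_continuous].
have := L1Q_mul_bounded (F := fun t x => g x) (c := `|g c|) (@jm_x R T a b g cg) FL.
have -> : (fun t x => g x * F t x) = (fun t x => F t x * g x).
  by apply/funext => t; apply/funext => x; rewrite mulrC.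
apply=> t x _ /=; rewrite in_itv/= => /andP[t0 tT].
by rewrite cP// in_itv/= !ltW.
Qed.

(** This is [(u_x)_t = (u_t)_x], needed to differentiate [\int u_x^2] in the energy. For a time test
    [phi], the functions [k = u phi' + u_t phi] and [K = u_x phi' + u_tx phi] are integrated in
    time: the first integral is zero, and the second is its weak derivative in [x], hence zero as
    well. *)
Lemma weak_t_dx T a b u ut ux utx : a < b -> 0 < T ->
  L1Q T a b u -> L1Q T a b ut -> L1Q T a b ux -> L1Q T a b utx ->
  (forall phi, test_function 0 T phi -> {ae leb, forall x, x \in `]a, b[ ->
       \int[leb]_(t in `]0, T[) (u t x * derive1 phi t) =
       - \int[leb]_(t in `]0, T[) (ut t x * phi t)}) ->
  {ae leb, forall t, t \in `]0, T[ -> weak_derivative a b (u t) (ux t)} ->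
  {ae leb, forall t, t \in `]0, T[ -> weak_derivative a b (ut t) (utx t)} ->
  weak_t_on_tents T a b ux utx.
Proof.
move=> ab T0 uL utL uxL utxL H dux dutx; apply: ae_weak_t => phi tphi.
have [sphi _] := tphi; have cphi := smooth_continuous sphi.
have cphi' := smooth_continuous (smooth_derive1 sphi).
have KL := L1Q_add (L1Q_mul_t (ltW T0) cphi' uxL) (L1Q_mul_t (ltW T0) cphi utxL).
have kL := L1Q_add (L1Q_mul_t (ltW T0) cphi' uL) (L1Q_mul_t (ltW T0) cphi utL).
set K := fun t x => _ in KL; set k := fun t x => _ in kL.
have k0 : {ae leb, forall x, x \in `]a, b[ -> \int[leb]_(t in `]0, T[) k t x = 0}.
  apply: ae_imp2 (H _ tphi) (ae_and (L1Q_ae_t uL) (L1Q_ae_t utL)) _.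
  move=> x Hx [ui uti] xI; rewrite /k RintegralD//.
  - by rewrite Hx// addNr.
  - by apply: integrable_mul_continuous => //; exact: ui.
  - by apply: integrable_mul_continuous => //; exact: uti.
have hi := L1Q_int_x KL.
have h0 : {ae leb, forall x, x \in `]a, b[ -> \int[leb]_(t in `]0, T[) K t x = 0}.
  apply: weak_on_tents0 => //.
  move=> n s t s' t' adm.
  set ze := tent _ _ _ _ _; have cze : continuous ze by exact: continuous_tent.
  set dze := dtent _ _ _ _ _.
  have cdze : continuous dze.
    exact: (locally_lipschitz_continuous (locally_lipschitz_dtent _ _ _ _ _)).
  under eq_Rintegral do rewrite mul0r.
  rewrite Rintegral_cst// mul0r; apply/esym/eqP; rewrite oppr_eq0; apply/eqP.
  have KzL := L1Q_mul_x (ltW ab) cze KL; have kzL := L1Q_mul_x (ltW ab) cdze kL.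
  have mz (g : R -> R) : continuous g -> measurable_fun `]a, b[ g.
    by move=> cg; apply: (measurable_funS measurableT) => //; exact: continuous_measurable_fun.
  have i1 := L1Q_int_x KzL; have i2 := L1Q_int_t KzL.
  have j1 := L1Q_int_x kzL; have j2 := L1Q_int_t kzL.
  transitivity (\int[leb]_(x in `]a, b[) \int[leb]_(t in `]0, T[) (K t x * ze x)).
    apply: ae_Rint_eq => //.
    - by apply: measurable_funM; [exact: itg_measurable hi|exact: mz].
    - exact: itg_measurable i1.
    - apply: (ae_imp (L1Q_ae_t KL)) => x Kx xI.
      by rewrite RintegralZr//; exact: Kx.
  rewrite -(L1Q_fubini KzL).
  transitivity (- \int[leb]_(t in `]0, T[) \int[leb]_(x in `]a, b[) (k t x * dze x)).
    rewrite -mulN1r -RintegralZl//; apply: ae_Rint_eq => //.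
    - exact: itg_measurable i2.
    - by apply: measurable_funM => //; exact: itg_measurable j2.
    apply: ae_imp2 (ae_and dux dutx)
      (ae_and (ae_and (L1Q_ae_x uxL) (L1Q_ae_x utxL))
      (ae_and (L1Q_ae_x uL) (L1Q_ae_x utL))) _.
    move=> r [d1 d2] [[uxi utxi] [ui uti]] rI.
    have e1 := weak_derivative_tents (d1 rI) adm.
    have e2 := weak_derivative_tents (d2 rI) adm.
    rewrite -/ze -/dze in e1 e2.
    have l (f1 f2 w : R -> R) (c1 c2 : R) : continuous w -> itg `]a, b[ f1 -> itg `]a, b[ f2 ->
      \int[leb]_(x in `]a, b[) ((f1 x * c1 + f2 x * c2) * w x) =
      c1 * \int[leb]_(x in `]a, b[) (f1 x * w x) + c2 * \int[leb]_(x in `]a, b[) (f2 x * w x).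
      move=> cw g1 g2; rewrite -!RintegralZl//; try exact: integrable_mul_continuous.
      rewrite -RintegralD//.
      - by apply: eq_Rintegral => x _; ring.
      - by apply: integrable_scale => //; exact: integrable_mul_continuous.
      - by apply: integrable_scale => //; exact: integrable_mul_continuous.
    rewrite /K /k l//; [|exact: uxi|exact: utxi].
    rewrite l//; [|exact: ui|exact: uti].
    by rewrite e1 e2 !mulrN -opprD mulN1r opprK.
  rewrite (L1Q_fubini kzL) (_ : \int[leb]_(x in `]a, b[) _ = 0) ?oppr0//.
  transitivity (\int[leb]_(x in `]a, b[) (0 : R)); last by rewrite Rintegral_cst// mul0r.
  apply: ae_Rint_eq => //; first exact: itg_measurable j1.
  apply: ae_imp2 k0 (L1Q_ae_t kL) _ => x kx ki xI.
  by rewrite RintegralZr ?kx ?mul0r//; exact: ki.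
apply: ae_imp2 h0 (ae_and (L1Q_ae_t uxL) (L1Q_ae_t utxL)) _.
move=> x hx [ui uti] xI; have := hx xI; rewrite /K RintegralD//.
- by move=> /eqP; rewrite addr_eq0 => /eqP.
- by apply: integrable_mul_continuous => //; exact: ui.
- by apply: integrable_mul_continuous => //; exact: uti.
Qed.

Lemma smooth_rampn n (s : R) : smooth (rampn n s).
Proof. by apply/smoothP => k; exact: differentiable_upto_rampn. Qed.

Lemma derive1_rampn n (s : R) : derive1 (rampn n s) = drampn n s.
Proof.
by apply/funext => x; rewrite derive1E; have D := is_derive_rampn n s x; exact: derive_val.
Qed.

Lemma smooth_cst (c : R) : smooth (cst c).
Proof. by apply/smoothP => k; exact: Cn_cst. Qed.

Lemma derive1_cst0 (c : R) : derive1 (cst c : R -> R) = cst 0.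
Proof. by apply/funext => x; rewrite derive1E derive_cst. Qed.

(** With the source moved to the left, a Neumann problem for [thx] alone remains, and [neumann_test]
    extends it to all absolutely continuous tests. *)
Lemma heat_slice_tests a b M mu (th thx tht utx : R -> R) : a < b ->
  sqr_bounded a b M th -> sqr_bounded a b M thx -> sqr_bounded a b M utx ->
  itg `]a, b[ tht ->
  (forall n (s : rat), \int[leb]_(x in `]a, b[) (tht x * rampn n (ratr s) x) +
     \int[leb]_(x in `]a, b[) (thx x * drampn n (ratr s) x) =
     mu * \int[leb]_(x in `]a, b[) (th x * utx x * rampn n (ratr s) x)) ->
  \int[leb]_(x in `]a, b[) tht x = mu * \int[leb]_(x in `]a, b[) (th x * utx x) ->
  heat_slice a b mu th thx tht utx.
Proof.
move=> ab [mth th2 _] [mthx thx2 _] [mutx utx2 _] thti Hn H1 F G0 acF.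
have thu := integrable_mul_sqr (measurable_itv _) mth mutx th2 utx2.
pose f x := tht x + (- mu) * (th x * utx x).
have fi : itg `]a, b[ f by apply: integrable_add => //; exact: integrable_scale.
have thxi := itg_of_sqr mthx thx2.
have fi' := (integrable_bndo_bndc _ _ _).1 fi.
have thxi' := (integrable_bndo_bndc _ _ _).1 thxi.
have thu' := (integrable_bndo_bndc _ _ _).1 thu.
have thti' := (integrable_bndo_bndc _ _ _).1 thti.
have wr : weak_on_ramps a b f thx.
  split=> [|n s _].
    by rewrite /f Rint_addZ// H1 mulNr subrr.
  have cr := smooth_continuous (@smooth_rampn n (ratr s : R)).
  have -> : \int[leb]_(x in `]a, b[) (f x * rampn n (ratr s) x) =
     \int[leb]_(x in `]a, b[) (tht x * rampn n (ratr s) x) +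
     (- mu) * \int[leb]_(x in `]a, b[) (th x * utx x * rampn n (ratr s) x).
    rewrite -Rint_addZ//; try exact: integrable_mul_continuous.
    by apply: eq_Rintegral => x _; rewrite /f mulrDl !mulrA.
  rewrite mulNr -(Hn n s); move: (\int[leb]_(x in _) _) (\int[leb]_(x in _) _) => u v.
  ring.
have := neumann_test ab fi' thxi' wr acF.
have i1 : itg `]a, b] (fun x => tht x * F x).
  by apply: eq_integrable (AC_mul_integrable (ltW ab) acF thti') => // x _ /=; rewrite mulrC.
have i2 : itg `]a, b] (fun x => th x * utx x * F x).
  by apply: eq_integrable (AC_mul_integrable (ltW ab) acF thu') => // x _ /=; rewrite mulrC.
have -> : \int[leb]_(x in `]a, b]) (f x * F x) =
     \int[leb]_(x in `]a, b]) (tht x * F x) +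
     (- mu) * \int[leb]_(x in `]a, b]) (th x * utx x * F x).
  by rewrite -Rint_addZ//; apply: eq_Rintegral => x _; rewrite /f mulrDl !mulrA.
by move=> e; lra.
Qed.

End SliceEquations.

Section Solutions.
Context {R : realType}.
Local Notation leb := (@lebesgue_measure R).
Local Notation itg D f := (leb.-integrable D (EFin \o f)).
Implicit Types (a b x y T : R) (F G : R -> R -> R).

Lemma sqr_bounded_ae a b M (f g : R -> R) : measurable_fun `]a, b[ g ->
  {ae leb, forall x, x \in `]a, b[ -> f x = g x} -> sqr_bounded a b M f -> sqr_bounded a b M g.
Proof.
move=> mg fg [mf f2 fM].
have e : {ae leb, forall x, `]a, b[%classic x -> f x ^+ 2 = g x ^+ 2}.
  by apply: (ae_imp fg) => x Hx xI; rewrite Hx.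
split => //.
  by apply: ae_integrable e f2 => //; exact: measurable_funX.
by rewrite -(ae_Rint_eq _ _ _ e)//; exact: measurable_funX.
Qed.

Lemma L1Q_sqr_bounded T a b F M : a < b -> 0 < T -> jm T a b F ->
  {ae leb, forall t, t \in `]0, T[ -> sqr_bounded a b M (F t)} -> L1Q T a b F.
Proof.
move=> ab T0 mF H; apply: (@L1Q_bound _ _ _ _ _ ((b - a) + M)) => //.
apply: (ae_imp H) => t Ht tI; have sb := Ht tI; have [mf f2 _] := sb.
have fi : itg `]a, b[ (fun x => `|F t x|) by apply: integrable_norm => //; exact: itg_of_sqr.
rewrite -(fineK (integrable_fin_num _ fi))//.
by rewrite lee_fin; exact: sqr_bounded_L1.
Qed.

Lemma vanishing_trace_ae a b (f g w : R -> R) : measurable_fun `]a, b[ f ->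
  measurable_fun `]a, b[ g -> {ae leb, forall x, x \in `]a, b[ -> f x = g x} ->
  vanishing_trace a b f w -> vanishing_trace a b g w.
Proof.
move=> mf mg fg H F G acF G2; rewrite -[RHS](H F G acF G2); congr (_ + _).
have mG : measurable_fun `]a, b] G by apply: itg_measurable; case: acF.
apply: ae_Rint_eq => //.
- by apply: measurable_funM => //; exact/measurable_fun_itv_bndo_bndcP.
- by apply: measurable_funM => //; exact/measurable_fun_itv_bndo_bndcP.
- by apply: (ae_imp (ae_oo_oc fg)) => x Hx xI; rewrite Hx.
Qed.

Lemma heat_tests T a b (mu : R) (theta thetat thetax utx : R -> R -> R) :
  (forall psi, smooth psi ->
    {ae leb, forall t, 0 < t ->
      \int[leb]_(x in `]a, b[) (thetat t x * psi x) +
      \int[leb]_(x in `]a, b[) (thetax t x * derive1 psi x) =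
      mu * \int[leb]_(x in `]a, b[) (theta t x * utx t x * psi x)}) ->
  {ae leb, forall t, t \in `]0, T[ ->
    (forall n (s : rat), \int[leb]_(x in `]a, b[) (thetat t x * rampn n (ratr s) x) +
     \int[leb]_(x in `]a, b[) (thetax t x * drampn n (ratr s) x) =
     mu * \int[leb]_(x in `]a, b[) (theta t x * utx t x * rampn n (ratr s) x)) /\
    \int[leb]_(x in `]a, b[) thetat t x =
      mu * \int[leb]_(x in `]a, b[) (theta t x * utx t x)}.
Proof.
move=> H.
have H1 : {ae leb, forall t, forall i : nat * rat, 0 < t ->
    \int[leb]_(x in `]a, b[) (thetat t x * rampn i.1 (ratr i.2) x) +
     \int[leb]_(x in `]a, b[) (thetax t x * drampn i.1 (ratr i.2) x) =
     mu * \int[leb]_(x in `]a, b[) (theta t x * utx t x * rampn i.1 (ratr i.2) x)}.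
  apply: ae_count => -[n s] /=; have := H _ (@smooth_rampn R n (ratr s)).
  by rewrite derive1_rampn.
have H2 := H _ (@smooth_cst R 1); rewrite derive1_cst0 in H2.
apply: ae_imp2 H1 H2 _ => t h1 h2; rewrite in_itv/= => /andP[t0 _]; split.
  by move=> n s; exact: (h1 (n, s)).
have := h2 t0; rewrite /cst.
under eq_Rintegral do rewrite mulr1.
under [X in _ + X = _]eq_Rintegral do rewrite mulr0.
rewrite Rintegral_cst// mul0r addr0 => ->.
by congr (_ * _); apply: eq_Rintegral => x _; rewrite mulr1.
Qed.

Record regular_solution a b (mu T M : R) (theta thetat thetax ut utt utx ux uxx : R -> R -> R)
    : Prop := RegularSolution {
  ex_slice : {ae leb, forall t, t \in `]0, T[ ->
    slice a b mu M (theta t) (thetat t) (thetax t) (ut t) (utt t) (utx t) (ux t) (uxx t)};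
  ex_theta : L1Q T a b theta;
  ex_thetat : L1Q T a b thetat;
  ex_ut : L1Q T a b ut;
  ex_utt : L1Q T a b utt;
  ex_utx : L1Q T a b utx;
  ex_ux : L1Q T a b ux;
  ex_wtheta : weak_t_on_tents T a b theta thetat;
  ex_wut : weak_t_on_tents T a b ut utt;
  ex_wux : weak_t_on_tents T a b ux utx }.

Lemma regularity_of_solution a b (mu : R) (u0 v0 theta0 : R -> R) (u theta : R -> R -> R) :
  a < b -> weak_solution a b mu u0 v0 theta0 u theta ->
  exists thetat thetax ut utt utx ux uxx : R -> R -> R,
  forall T, 0 < T -> exists2 M : R, 0 <= M &
    regular_solution a b mu T M theta thetat thetax ut utt utx ux uxx.
Proof.
move=> ab [_ reg [ut [utt [utx [ux [uxx [thetat [thetax]]]]]]]].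
move=> [loc1 loc2 wave heat _].
exists thetat, thetax, ut, utt, utx, ux, uxx => T T0.
(* [G] is the time derivative of [u] supplied by the regularity class. Its slices lie in [H^1_0],
   but it is a priori another function than [ut]; [eqG] identifies them. *)
have [B1 [_ [G wuG [BG _]]] _ B4 _] := reg T T0.
have [[Bu But wuut] [_ Butt wututt] [jutx dutx] [Bth Btht wth]] := loc1 T T0.
have [[jux dux] [juxx duxx] [jthx dthx]] := loc2 T T0.
have [_ BG1 wG] := wuG.
have uL := bochner_L1 ab Bu; have utL := bochner_L1 ab But.
have uttL := bochner_L1 ab Butt; have GL := bochner_L1 ab BG1.
have thL := bochner_L1 ab Bth; have thtL := bochner_L1 ab Btht.
have nn k f : (0 <= fs_norm (H_space a b k) f)%E by exact: Sobolev_norm_ge0.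
have nn0 f : (0 <= fs_norm (H10_space a b) f)%E by exact: Sobolev_norm_ge0.
have [Mu Mu0 HMu] := bochner_infty (nn 2) B1.
have [Mt Mt0 HMt] := bochner_infty nn0 BG.
have [Mh Mh0 HMh] := bochner_infty (nn 1) B4.
pose M := Mu ^+ 2 + Mt ^+ 2 + Mh ^+ 2.
have [sMu sMt sMh] : [/\ Mu ^+ 2 <= M, Mt ^+ 2 <= M & Mh ^+ 2 <= M].
  have := sqr_ge0 Mu; have := sqr_ge0 Mt; have := sqr_ge0 Mh.
  by rewrite /M; move: (Mu ^+ 2) (Mt ^+ 2) (Mh ^+ 2) => r1 r2 r3 *; split; lra.
have M0 : 0 <= M by apply: le_trans sMu; exact: sqr_ge0.
have wut_tents := ae_weak_t wuut; have wG_tents := ae_weak_t wG.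
have eqG := weak_t_unique T0 GL utL wG_tents wut_tents.
have [jut _] := utL; have [jtht _] := thtL.
have jwave : jm T a b (fun t x => utt t x + -1 * (uxx t x + mu * thetax t x)).
  have [jutt _] := uttL; apply: jm_add => //; apply: jm_scale.
  by apply: jm_add => //; exact: jm_scale.
have wave' : {ae leb, forall t, t \in `]0, T[ -> {ae leb, forall x, x \in `]a, b[ ->
    utt t x + -1 * (uxx t x + mu * thetax t x) = 0}}.
  apply: (ae_product_slices jwave).
  apply: (@filterS _ _ (ae_filter_ringOfSetsType (leb \x leb)%E)) wave => p Hp p1 p2.
  by rewrite -(Hp p1 p2) mulN1r addrCA subrr addr0 subrr.
have HS : {ae leb, forall t, t \in `]0, T[ ->
    slice a b mu M (theta t) (thetat t) (thetax t) (ut t) (utt t) (utx t) (ux t) (uxx t)}.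
  have A1 := ae_and (ae_and HMu dux) duxx.
  have A2 := ae_and (ae_and HMt dutx) eqG.
  have A3 := ae_and (ae_and HMh dthx) (ae_and (L1Q_ae_x thtL) (heat_tests T heat)).
  apply: ae_imp2 (ae_and A1 A2) (ae_and A3 wave') _.
  move=> t [[[h1 h2] h3] [[h4 h5] h6]] [[[h7 h8] [h9 h10]] h11] tI.
  have [_ nu] := h1 tI; have d1 := h2 tI; have d2 := h3 tI.
  have [memG nG] := h4 tI; have d3 := h5 tI; have eG := h6 tI.
  have [_ nth] := h7 tI; have d4 := h8 tI; have thti := h9 tI.
  have [heat1 heat2] := h10 tI; have wv := h11 tI.
  have [sux suxx] := Sobolev_norm2_sqr_bounded Mu0 d1 d2 nu.
  have [sth sthx] := Sobolev_norm_sqr_bounded (isT : 0 < 1)%N Mh0 d4 nth.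
  (* The [H^1] bound is known for [G t], so [utx t] is first recognized as the weak derivative of
     [G t]. *)
  have d3G : weak_derivative a b (G t) (utx t).
    have [[_ [g dg _]] _] := memG; have [lG _ _] := dg.
    apply: weak_derivative_ae d3 lG _.
    by apply: (ae_imp eG) => x Hx xI; rewrite Hx.
  have [sG sutx] := Sobolev_norm_sqr_bounded (isT : 0 < 1)%N Mt0 d3G nG.
  have mut := measurable_slice_x jut tI.
  have sut := sqr_bounded_ae mut eG sG.
  have W := sqr_bounded_weaken.
  split.
  - have [_ f2 _] := sth; have [_ g2 _] := sthx.
    exact: weak_derivative_AC ab d4 f2 g2.
  - exact: W sMh sth.
  - exact: W sMh sthx.
  - exact: W sMt sut.
  - exact: W sMt sutx.
  - exact: W sMu sux.
  - exact: W sMu suxx.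
  - have [_ f2 _] := sux; have [_ g2 _] := suxx.
    exact: weak_derivative_AC ab d2 f2 g2.
  - exact: thti.
  - have sth' := sqr_bounded_weaken sMh sth; have sthx' := sqr_bounded_weaken sMh sthx.
    have sutx' := sqr_bounded_weaken sMt sutx.
    exact: (heat_slice_tests ab sth' sthx' sutx' thti heat1 heat2).
  - have [mG g2 _] := sG; have [_ w2 _] := sutx.
    apply: vanishing_trace_ae mG mut eG _.
    exact: Sobolev10_vanishing_trace.
  - by apply: (ae_imp wv) => x Hx xI; have := Hx xI; rewrite mulN1r => /subr0_eq.
exists M; first exact: M0.
have utxL : L1Q T a b utx.
  by apply: (L1Q_sqr_bounded (M := M)) => //; apply: (ae_imp HS) => t Ht tI; case: (Ht tI).
have uxL : L1Q T a b ux.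
  by apply: (L1Q_sqr_bounded (M := M)) => //; apply: (ae_imp HS) => t Ht tI; case: (Ht tI).
split => //.
- exact: ae_weak_t.
- exact: ae_weak_t.
- exact: weak_t_dx ab T0 uL utL uxL utxL wuut dux dutx.
Qed.

End Solutions.

(** * Energy, positivity and the Moser iteration *)

Section Powers.
Context {R : realType}.
Local Notation leb := (@lebesgue_measure R).
Local Notation itg D f := (leb.-integrable D (EFin \o f)).
Implicit Types (a b x y T M N p c : R) (F G H : R -> R -> R).

Lemma Rint_oo_oc a b (f : R -> R) : measurable_fun `]a, b[ f ->
  \int[leb]_(x in `]a, b[) f x = \int[leb]_(x in `]a, b]) f x.
Proof.
by move=> mf; rewrite /Rintegral integral_itv_bndo_bndc//; exact/measurable_EFinP.
Qed.

Definition sup_bound a b M : R := 1 + M / (b - a) + ((b - a) + M).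

Lemma slice_theta_bound a b mu M (th tht thx ut utt utx ux uxx : R -> R) : a < b ->
  slice a b mu M th tht thx ut utt utx ux uxx ->
  {ae leb, forall x, x \in `]a, b[ -> `|th x| <= sup_bound a b M}.
Proof.
move=> ab [[v acv thv] sth sthx _ _ _ _ _ _ _ _ _].
have mv : measurable_fun `]a, b[ v.
  by apply/measurable_fun_itv_bndo_bndcP; exact: AC_measurable_oc (ltW ab) acv.
have sv := sqr_bounded_ae mv thv sth.
apply: (ae_imp thv) => x thvx xI; rewrite thvx//.
apply: (AC_sup_bound ab acv sthx sv).
by move: xI; rewrite in_itv/= => /andP[/ltW-> /ltW->].
Qed.

(** Makes powers of the temperature admissible in [evolution]: [g] is bounded on the range of [F]
    because [F] is, by a constant that may depend on [T]. *)
Lemma L1Q_mul_locally_bounded T a b F H N (g : R -> R) : jm T a b F -> L1Q T a b H ->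
  locally_lipschitz g ->
  {ae leb, forall t, t \in `]0, T[ -> {ae leb, forall x, x \in `]a, b[ -> `|F t x| <= N}} ->
  L1Q T a b (fun t x => H t x * g (F t x)).
Proof.
move=> mF HL lg FN; have [k k0 kP] := locally_lipschitz_bounded lg N.
have [mH _] := HL.
have mg := jm_comp (locally_lipschitz_continuous lg) mF.
have mHg := jm_mul mH mg.
apply: (L1Q_dom (k := k) mHg HL k0).
apply: (ae_imp FN) => t Ht tI; have {}Ht := Ht tI.
have mHt := measurable_slice_x mH tI; have mHgt := measurable_slice_x mHg tI.
have m1 : measurable_fun `]a, b[ (fun x => `|H t x|%:E).
  by apply/measurable_EFinP; exact: measurableT_comp.
rewrite -ge0_integralZl//; apply: ae_le_integral => //.
- by apply/measurable_EFinP; exact: measurableT_comp.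
- exact: measurable_funeM.
- by move=> x _; rewrite mule_ge0.
apply: (ae_imp Ht) => x Hx xI; rewrite -EFinM lee_fin normrM mulrC.
by apply: ler_wpM2r => //; apply: kP; exact: Hx.
Qed.

(** [slice_dissipation] concerns the absolutely continuous representative [v]; here every integral
    is transferred back to [th], which differs from it on a null set only. *)
Lemma slice_power_dissipation a b mu M p c (rho rho' Phi' Phi'' : R -> R)
    (th tht thx ut utt utx ux uxx : R -> R) : a < b ->
  power_like p rho rho' Phi' Phi'' -> slice a b mu M th tht thx ut utt utx ux uxx ->
  0 < c -> (mu * p) ^+ 2 * \int[leb]_(x in `]a, b[) ut x ^+ 2 <= c ^+ 2 ->
  \int[leb]_(x in `]a, b[) (tht x * Phi' (th x)) <=
  - (c ^+ 2 / (b - a)) * \int[leb]_(x in `]a, b[) rho (th x) ^+ 2 +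
  2 * c ^+ 2 * (4 * c ^+ 2 + (b - a)^-1) ^+ 2 *
    (\int[leb]_(x in `]a, b[) `|rho (th x)|) ^+ 2.
Proof.
move=> ab pl [[v acv thv] sth sthx sut sutx _ _ _ thti heat tr _] c0 cP.
have [mth _ _] := sth; have [mthx thx2 _] := sthx.
have [mut ut2 _] := sut; have [mutx utx2 _] := sutx.
have mtht := itg_measurable thti.
have mv := AC_measurable_oc (ltW ab) acv.
have crho : continuous rho.
  move=> r; apply/differentiable_continuous/derivable1_diffP.
  by have [] := pl_rho pl r.
have mcomp (g h : R -> R) : continuous g -> measurable_fun `]a, b[ h ->
    measurable_fun `]a, b[ (g \o h).
  by move=> cg mh; apply: (measurableT_comp (continuous_measurable_fun cg)).
have mrho := mcomp _ _ crho mth.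
have mPhi := mcomp _ _ (locally_lipschitz_continuous (pl_Phi'l pl)) mth.
rewrite Rint_oo_oc in cP; last exact: measurable_funX.
have m1 : measurable_fun `]a, b[ (fun x => tht x * Phi' (th x)) by exact: measurable_funM.
have m2 : measurable_fun `]a, b[ (fun x => rho (th x) ^+ 2) by exact: measurable_funX.
have m3 : measurable_fun `]a, b[ (fun x => `|rho (th x)|) by exact: measurableT_comp.
rewrite (Rint_oo_oc m1) (Rint_oo_oc m2) (Rint_oo_oc m3).
have oc f : measurable_fun `]a, b[ f -> measurable_fun `]a, b] (f : R -> R).
  by move=> mf; exact/measurable_fun_itv_bndo_bndcP.
have thv' := ae_oo_oc thv.
have oc2 f : itg `]a, b[ f -> itg `]a, b] (f : R -> R) by move/integrable_bndo_bndc.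
have mvc (g : R -> R) : continuous g -> measurable_fun `]a, b] (g \o v).
  by move=> cg; apply: (measurableT_comp (continuous_measurable_fun cg)).
have e1 : \int[leb]_(x in `]a, b]) (tht x * Phi' (th x)) =
    \int[leb]_(x in `]a, b]) (tht x * Phi' (v x)).
  apply: ae_Rint_eq => //.
  - exact: oc m1.
  - apply: measurable_funM; first exact: oc.
    by apply: mvc; exact: locally_lipschitz_continuous (pl_Phi'l pl).
  - by apply: (ae_imp thv') => x Hx xI; rewrite Hx.
have e2 : \int[leb]_(x in `]a, b]) rho (th x) ^+ 2 = \int[leb]_(x in `]a, b]) rho (v x) ^+ 2.
  apply: ae_Rint_eq => //.
  - exact: oc m2.
  - by apply: measurable_funX; exact: mvc.
  - by apply: (ae_imp thv') => x Hx xI; rewrite Hx.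
have e3 : \int[leb]_(x in `]a, b]) `|rho (th x)| = \int[leb]_(x in `]a, b]) `|rho (v x)|.
  apply: ae_Rint_eq => //.
  - exact: oc m3.
  - by apply: measurableT_comp => //; exact: mvc.
  - by apply: (ae_imp thv') => x Hx xI; rewrite Hx.
rewrite e1 e2 e3.
apply: (slice_dissipation (f := tht) (w := utx) (v := ut) (mu := mu) ab pl acv) => //.
- exact: oc2.
- exact: oc.
- exact: oc2.
- exact: oc.
- exact: oc2.
- move=> F G acF; rewrite (heat F G acF); congr (_ * _).
  have mF := AC_measurable_oc (ltW ab) acF.
  apply: ae_Rint_eq => //.
  + by apply: measurable_funM => //; apply: oc; exact: measurable_funM.
  + by apply: measurable_funM => //; apply: measurable_funM => //; exact: oc.
  + by apply: (ae_imp thv') => x Hx xI; rewrite Hx.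
Qed.

Lemma power_evolution T a b mu M p c (rho rho' Phi' Phi'' : R -> R)
    (theta thetat thetax ut utt utx ux uxx : R -> R -> R) : a < b -> 0 < T ->
  regular_solution a b mu T M theta thetat thetax ut utt utx ux uxx ->
  power_like p rho rho' Phi' Phi'' -> 0 < c ->
  {ae leb, forall t, t \in `]0, T[ ->
    (mu * p) ^+ 2 * \int[leb]_(x in `]a, b[) ut t x ^+ 2 <= c ^+ 2} ->
  exists y z : R -> R, [/\ AC 0 T y z,
    {ae leb, forall t, t \in `]0, T[ -> \int[leb]_(x in `]a, b[) rho (theta t x) ^+ 2 = y t} &
    {ae leb, forall t, t \in `]0, T[ -> z t <= - (c ^+ 2 / (b - a)) * y t +
      2 * c ^+ 2 * (4 * c ^+ 2 + (b - a)^-1) ^+ 2 *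
        (\int[leb]_(x in `]a, b[) `|rho (theta t x)|) ^+ 2}].
Proof.
move=> ab T0 [sl thL thtL _ _ _ _ wth _ _] pl c0 cP.
have thN : {ae leb, forall t, t \in `]0, T[ ->
    {ae leb, forall x, x \in `]a, b[ -> `|theta t x| <= sup_bound a b M}}.
  by apply: (ae_imp sl) => t Ht tI; exact: slice_theta_bound (Ht tI).
have [mth _] := thL.
have lPhi' := pl_Phi'l pl.
have lPhi : locally_lipschitz (fun r => rho r ^+ 2).
  exact: locally_lipschitz_C1 (pl_Phi pl) (locally_lipschitz_continuous lPhi').
have oneL : L1Q T a b (fun _ _ => 1 : R).
  apply: (@L1Q_sqr_bounded _ T a b _ (b - a)) => //; first exact: jm_cst.
  apply: ae_true => t _; split.
  - exact: measurable_cst.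
  - by apply/integrable_bndo_bndc; exact: integrable_cst.
  - under eq_Rintegral do rewrite expr1n.
    by rewrite Rint_oo_oc// Rint_cst ?mul1r// ltW.
have PhiL : L1Q T a b (fun t x => rho (theta t x) ^+ 2).
  have := L1Q_mul_locally_bounded mth oneL lPhi thN.
  rewrite (_ : (fun t x => _) = (fun t x => rho (theta t x) ^+ 2))//.
  by apply/funext => t; apply/funext => x; rewrite mul1r.
have PhitL := L1Q_mul_locally_bounded mth thtL lPhi' thN.
have [y acy yE] := evolution T0 thL thtL wth (pl_Phi pl) lPhi' PhiL PhitL.
exists y, (fun t => \int[leb]_(x in `]a, b[) (thetat t x * Phi' (theta t x))); split => //.
apply: ae_imp2 (ae_and sl cP) yE _ => t [slt cPt] yt tI; rewrite -yt//.
exact: slice_power_dissipation ab pl (slt tI) c0 (cPt tI).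
Qed.

End Powers.

(** * Conservation of energy *)

Section Energy.
Context {R : realType}.
Local Notation leb := (@lebesgue_measure R).
Local Notation itg D f := (leb.-integrable D (EFin \o f)).
Implicit Types (a b x y T M N p c : R) (F G H : R -> R -> R).

Lemma sqr_bounded_lin a b M N (r s : R) (f g : R -> R) :
  sqr_bounded a b M f -> sqr_bounded a b N g ->
  sqr_bounded a b (2 * r ^+ 2 * M + 2 * s ^+ 2 * N) (fun x => r * f x + s * g x).
Proof.
move=> [mf f2 fM] [mg g2 gN].
have mh : measurable_fun `]a, b[ (fun x => r * f x + s * g x).
  by apply: measurable_funD; apply: measurable_funM.
have i : itg `]a, b[ (fun x => 2 * r ^+ 2 * f x ^+ 2 + 2 * s ^+ 2 * g x ^+ 2).
  by apply: integrable_add => //; exact: integrable_scale.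
have le x : (r * f x + s * g x) ^+ 2 <= 2 * r ^+ 2 * f x ^+ 2 + 2 * s ^+ 2 * g x ^+ 2.
  move: (f x) (g x) => u v; have := sqr_ge0 (r * u - s * v).
  by rewrite -subr_ge0 => h; rewrite -subr_ge0; apply: le_trans h _; lra.
have i2 : itg `]a, b[ (fun x => (r * f x + s * g x) ^+ 2).
  apply: integrable_le i => //; first exact: measurable_funX.
  by move=> x _; rewrite ger0_norm ?sqr_ge0.
split => //; apply: le_trans (le_Rintegral _ i2 i (fun x _ => le x)) _ => //.
rewrite (Rint_addZ (f := fun x => 2 * r ^+ 2 * f x ^+ 2))//; last exact: integrable_scale.
rewrite (@RintegralZl _ _ _ leb)//.
by apply: lerD; apply: ler_wpM2l => //; rewrite mulr_ge0// sqr_ge0.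
Qed.

Lemma slice_utt_sqr_bounded a b mu M (th tht thx ut utt utx ux uxx : R -> R) :
  measurable_fun `]a, b[ utt ->
  slice a b mu M th tht thx ut utt utx ux uxx ->
  sqr_bounded a b (2 * M + 2 * mu ^+ 2 * M) utt.
Proof.
move=> mutt [_ _ sthx _ _ _ suxx _ _ _ _ wave].
have := sqr_bounded_lin 1 mu suxx sthx; rewrite expr1n mulr1.
apply: sqr_bounded_ae => //.
by apply: (ae_imp wave) => x Hx xI; rewrite Hx// mul1r.
Qed.

Lemma L1Q_mul_sqr_bounded T a b F G M : 0 < T -> jm T a b F -> jm T a b G ->
  {ae leb, forall t, t \in `]0, T[ -> sqr_bounded a b M (F t) /\ sqr_bounded a b M (G t)} ->
  L1Q T a b (fun t x => F t x * G t x).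
Proof.
move=> T0 mF mG H; apply: (L1Q_bound (M := M + M)) => //; first exact: jm_mul.
apply: (ae_imp H) => t Ht tI; have [[mf f2 fM] [mg g2 gM]] := Ht tI.
have fg := integrable_mul_sqr (measurable_itv _) mf mg f2 g2.
have fgn : itg `]a, b[ (fun x => `|F t x * G t x|) by exact: integrable_norm.
rewrite -(fineK (integrable_fin_num _ fgn))// lee_fin.
apply: le_trans (lerD fM gM).
rewrite -(@RintegralD _ _ _ leb)//; apply: le_Rintegral => //.
  exact: integrable_add.
move=> x _; rewrite normrM; move: (F t x) (G t x) => u v.
rewrite -(real_normK (num_real u)) -(real_normK (num_real v)).
have := sqr_ge0 (`|u| - `|v|); have := sqr_ge0 (`|u| + `|v|).
by move: `|u| `|v| => r s; rewrite sqrrB sqrrD; lra.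
Qed.

Lemma AC_stationary T (y z : R -> R) : AC 0 T y z ->
  {ae leb, forall t, t \in `]0, T[ -> z t = 0} -> forall t, 0 <= t <= T -> y t = y 0.
Proof.
move=> acy z0; have acy' : AC 0 T y (cst 0) by apply: AC_ae acy.
move=> t tT; have [_ ->//] := acy'.
have /andP[t0 _] := tT; by rewrite Rint_cst// mul0r addr0.
Qed.

(** The trace identity is used twice, with the representatives of [u_x] and of [theta] as tests: the
    first use cancels [\int u_t u_xx] against [\int u_tx u_x], the second cancels
    [mu \int u_t theta_x] against [mu \int theta u_tx], which equals [\int theta_t] by the constant
    test. *)
Lemma slice_energy_balance a b mu M (th tht thx ut utt utx ux uxx : R -> R) : a < b ->
  measurable_fun `]a, b[ utt ->
  slice a b mu M th tht thx ut utt utx ux uxx ->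
  \int[leb]_(x in `]a, b[) (utt x * ut x) + \int[leb]_(x in `]a, b[) (utx x * ux x) +
  \int[leb]_(x in `]a, b[) tht x = 0.
Proof.
move=> ab mutt [[w acw thw] sth sthx sut sutx sux suxx [v acv uxv] thti heat tr wave].
have [mth th2 _] := sth; have [mthx thx2 _] := sthx.
have [mut ut2 _] := sut; have [mutx utx2 _] := sutx.
have [mux ux2 _] := sux; have [muxx uxx2 _] := suxx.
have lab := ltW ab.
have mtht := itg_measurable thti.
have mv := AC_measurable_oc lab acv; have mw := AC_measurable_oc lab acw.
have oc (f : R -> R) : measurable_fun `]a, b[ f -> measurable_fun `]a, b] f.
  by move=> mf; exact/measurable_fun_itv_bndo_bndcP.
have oc2 (f : R -> R) : itg `]a, b[ f -> itg `]a, b] f by move/integrable_bndo_bndc.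
have mM (f g : R -> R) : measurable_fun `]a, b[ f -> measurable_fun `]a, b[ g ->
    measurable_fun `]a, b[ (fun x => f x * g x) by exact: measurable_funM.
rewrite (Rint_oo_oc (mM _ _ mutt mut)) (Rint_oo_oc (mM _ _ mutx mux)) (Rint_oo_oc mtht).
have tr1 := tr _ _ acv (oc2 _ uxx2).
have tr2 := tr _ _ acw (oc2 _ thx2).
have ac1 : AC a b (cst 1) (cst 0).
  apply: AC_C1 lab _ (locally_lipschitz_cst 0) => x; exact: is_derive_cst.
have h1 := heat _ _ ac1.
have e1 : \int[leb]_(x in `]a, b]) (utt x * ut x) =
    \int[leb]_(x in `]a, b]) (ut x * uxx x) + mu * \int[leb]_(x in `]a, b]) (ut x * thx x).
  have i1 := oc2 _ (integrable_mul_sqr (measurable_itv _) mut muxx ut2 uxx2).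
  have i2 := oc2 _ (integrable_mul_sqr (measurable_itv _) mut mthx ut2 thx2).
  rewrite -Rint_addZ//; apply: ae_Rint_eq => //.
  - exact: (oc _ (mM _ _ mutt mut)).
  - exact: itg_measurable (integrable_add _ i1 (integrable_scale mu _ i2)).
  - by apply: (ae_imp (ae_oo_oc wave)) => x Hx xI; rewrite Hx//; ring.
have e2 : \int[leb]_(x in `]a, b]) (utx x * ux x) = \int[leb]_(x in `]a, b]) (utx x * v x).
  apply: ae_Rint_eq => //.
  - exact: (oc _ (mM _ _ mutx mux)).
  - by apply: measurable_funM => //; exact: oc.
  - by apply: (ae_imp (ae_oo_oc uxv)) => x Hx xI; rewrite Hx.
have e3 : \int[leb]_(x in `]a, b]) (th x * utx x * cst 1 x) =
    \int[leb]_(x in `]a, b]) (utx x * w x).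
  apply: ae_Rint_eq => //.
  - by apply: measurable_funM => //; exact: (oc _ (mM _ _ mth mutx)).
  - by apply: measurable_funM => //; exact: oc.
  - by apply: (ae_imp (ae_oo_oc thw)) => x Hx xI; rewrite Hx// /cst mulr1 mulrC.
rewrite e3 in h1.
have e4 : \int[leb]_(x in `]a, b]) (thx x * cst 0 x) = 0.
  by under eq_Rintegral do rewrite /cst mulr0; rewrite Rint_cst// mul0r.
have e5 : \int[leb]_(x in `]a, b]) (tht x * cst 1 x) = \int[leb]_(x in `]a, b]) tht x.
  by apply: eq_Rintegral => x _; rewrite /cst mulr1.
rewrite e4 e5 addr0 in h1; rewrite e1 e2 h1.
move: tr1 tr2; move: (\int[leb]_(x in _) _) => I1; move: (\int[leb]_(x in _) _) => I2.
move: (\int[leb]_(x in _) _) => I3; move: (\int[leb]_(x in _) _) => I4.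
move=> /eqP; rewrite addr_eq0 => /eqP -> /eqP; rewrite addr_eq0 => /eqP ->; ring.
Qed.

(** [E] is twice the energy, so that no halves occur; [evolution] is applied to the squares of [u_t]
    and [u_x] and to [theta] itself. *)
Lemma energy_conservation T a b mu M (theta thetat thetax ut utt utx ux uxx : R -> R -> R) :
  a < b -> 0 < T -> regular_solution a b mu T M theta thetat thetax ut utt utx ux uxx ->
  exists E : R, {ae leb, forall t, t \in `]0, T[ ->
    \int[leb]_(x in `]a, b[) ut t x ^+ 2 + \int[leb]_(x in `]a, b[) ux t x ^+ 2 +
    2 * \int[leb]_(x in `]a, b[) theta t x = E}.
Proof.
move=> ab T0 [sl thL thtL utL uttL utxL uxL wth wut wux].
have [mut _] := utL; have [mutt _] := uttL; have [mutx _] := utxL; have [mux _] := uxL.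
have l2 : locally_lipschitz (fun r : R => 2 * r).
  exact/locally_lipschitz_scale/locally_lipschitz_id.
have d2 (r : R) : is_derive r 1 (fun r => r ^+ 2) (2 * r).
  by have := is_derive_pow 2 r; rewrite /= expr1.
pose K := 2 * M + 2 * mu ^+ 2 * M + M.
have bd : {ae leb, forall t, t \in `]0, T[ ->
    [/\ sqr_bounded a b K (ut t), sqr_bounded a b K (utt t),
        sqr_bounded a b K (utx t) & sqr_bounded a b K (ux t)]}.
  apply: (ae_imp sl) => t Ht tI; have st := Ht tI.
  have mt := measurable_slice_x mutt tI.
  have suttt := slice_utt_sqr_bounded mt st.
  have [_ _ _ s1 s2 s3 _ _ _ _ _ _] := st.
  have M0 : 0 <= M.
    have [_ _ H] := s1; apply: le_trans H; apply: Rintegral_ge0 => x _; exact: sqr_ge0.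
  have M2 : 0 <= 2 * mu ^+ 2 * M by rewrite mulr_ge0// mulr_ge0// sqr_ge0.
  by split; [move: s1|move: suttt|move: s2|move: s3];
    apply: sqr_bounded_weaken; rewrite /K; lra.
have sqL F : jm T a b F -> {ae leb, forall t, t \in `]0, T[ -> sqr_bounded a b K (F t)} ->
    L1Q T a b (fun t x => F t x ^+ 2).
  move=> mF Fb; have := L1Q_mul_sqr_bounded T0 mF mF => /(_ K).
  by apply; apply: (ae_imp Fb) => t Ht tI; split; exact: Ht.
have mulL F G : jm T a b F -> jm T a b G ->
    {ae leb, forall t, t \in `]0, T[ -> sqr_bounded a b K (F t) /\ sqr_bounded a b K (G t)} ->
    L1Q T a b (fun t x => F t x * (2 * G t x)).
  move=> mF mG FG; have := L1Q_scale 2 (L1Q_mul_sqr_bounded T0 mF mG FG).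
  rewrite (_ : (fun t x => _) = (fun t x => F t x * (2 * G t x)))//.
  by apply/funext => t; apply/funext => x; ring.
have bd1 := ae_imp bd (fun t Ht tI => let: And4 h _ _ _ := Ht tI in h).
have bd2 := ae_imp bd (fun t Ht tI => let: And4 h1 h2 _ _ := Ht tI in conj h2 h1).
have bd3 := ae_imp bd (fun t Ht tI => let: And4 _ _ h3 h4 := Ht tI in conj h3 h4).
have bd4 := ae_imp bd (fun t Ht tI => let: And4 _ _ _ h := Ht tI in h).
have [y1 ac1 y1E] := evolution T0 utL uttL wut d2 l2 (sqL _ mut bd1) (mulL _ _ mutt mut bd2).
have [y2 ac2 y2E] := evolution T0 uxL utxL wux d2 l2 (sqL _ mux bd4) (mulL _ _ mutx mux bd3).
have did (r : R) : is_derive r 1 (id : R -> R) (cst 1 r) by exact: is_derive_id.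
have thtL1 : L1Q T a b (fun t x => thetat t x * cst 1 (theta t x)).
  rewrite (_ : (fun t x => _) = thetat)//.
  by apply/funext => t; apply/funext => x; rewrite /cst mulr1.
have [y3 ac3 y3E] := evolution T0 thL thtL wth did (locally_lipschitz_cst 1) thL thtL1.
have acE := AC_add (AC_add ac1 ac2) (AC_scale 2 ac3).
exists (y1 0 + y2 0 + 2 * y3 0).
have st : {ae leb, forall t, t \in `]0, T[ ->
    \int[leb]_(x in `]a, b[) (utt t x * (2 * ut t x)) +
    \int[leb]_(x in `]a, b[) (utx t x * (2 * ux t x)) +
    2 * \int[leb]_(x in `]a, b[) (thetat t x * cst 1 (theta t x)) = 0}.
  apply: ae_imp2 sl bd _ => t slt bdt tI; have [[b1 b2 b3 b4] st] := (bdt tI, slt tI).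
  have mt := measurable_slice_x mutt tI.
  have H := slice_energy_balance ab mt st.
  have [mutt1 utt2 _] := b2; have [mut1 ut2 _] := b1.
  have [mutx1 utx2 _] := b3; have [mux1 ux2 _] := b4.
  have i1 := integrable_mul_sqr (measurable_itv _) mutt1 mut1 utt2 ut2.
  have i2 := integrable_mul_sqr (measurable_itv _) mutx1 mux1 utx2 ux2.
  have e (f g : R -> R) : itg `]a, b[ (fun x => f x * g x) ->
      \int[leb]_(x in `]a, b[) (f x * (2 * g x)) = 2 * \int[leb]_(x in `]a, b[) (f x * g x).
    move=> fg; rewrite -RintegralZl//; apply: eq_Rintegral => x _.
    by rewrite mulrCA.
  rewrite -[RHS](mulr0 2) -H !mulrDr (e _ _ i1) (e _ _ i2); congr (_ + 2 * _).
  by apply: eq_Rintegral => x _; rewrite /cst mulr1.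
have E := AC_stationary acE st.
apply: ae_imp2 (ae_and y1E y2E) y3E _ => t [h1 h2] h3 tI.
rewrite h1// h2// h3//; apply: E.
by move: tI; rewrite in_itv/= => /andP[/ltW -> /ltW ->].
Qed.

End Energy.

(** * Nonnegativity of the temperature *)

Section Positivity.
Context {R : realType}.
Local Notation leb := (@lebesgue_measure R).
Local Notation itg D f := (leb.-integrable D (EFin \o f)).
Implicit Types (a b x y T M N p c : R) (F G H : R -> R -> R).

Lemma AC_nonincreasing T (y z : R -> R) : AC 0 T y z ->
  {ae leb, forall t, t \in `]0, T[ -> z t <= 0} -> forall t, 0 <= t <= T -> y t <= y 0.
Proof.
move=> acy z0; have mz := itg_measurable (proj1 acy).
have acm : AC 0 T y (fun t => Num.min (z t) 0).
  apply: AC_ae acy; first exact: measurable_minr.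
  by apply: (ae_imp z0) => t Ht tI; rewrite min_l// Ht.
move=> t tT; have [mi ->//] := acm; rewrite gerDl.
have /andP[t0 tT'] := tT.
rewrite -[leRHS](mul0r (t - 0)) -Rint_cst//; apply: le_Rintegral => //.
- exact: AC_itg acm _ _.
- exact: integrable_cst.
- by move=> s _; rewrite ge_min lexx orbT.
Qed.

(** With the integrating factor [exp (- C t)], the product has derivative
    [(z - C y) exp (- C t) <= 0]. Both signs of [C] occur: nonnegative for the negative part of
    [theta], negative in the Moser step. *)
Lemma gronwall T (C : R) (y z : R -> R) : 0 <= T -> AC 0 T y z ->
  {ae leb, forall t, t \in `]0, T[ -> z t <= C * y t} -> y 0 <= 0 ->
  forall t, 0 <= t <= T -> y t <= 0.
Proof.
move=> T0 acy zy y0 t tT.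
have acid : AC 0 T (id : R -> R) (cst 1).
  by apply: (AC_C1 T0 _ (locally_lipschitz_cst 1)) => s; exact: is_derive_id.
have lexp : locally_lipschitz (expR : R -> R).
  exact: (locally_lipschitz_C1 (@is_derive_expR R) (@continuous_expR R)).
have acE := AC_chain T0 (AC_scale (- C) acid) (fun r => @is_derive_expR R r) lexp.
have acw := AC_mul T0 acy acE.
have w0 : {ae leb, forall s, s \in `]0, T[ ->
    z s * (expR \o (fun x => - C * id x)) s + y s * (expR (- C * id s) * (- C * cst 1 s)) <= 0}.
  apply: (ae_imp zy) => s Hs sI; have {Hs} := Hs sI; rewrite /=.
  have := expR_gt0 (- C * s); move: (expR _) (z s) (y s) => e r q e0 rq.
  rewrite /cst mulr1.
  have -> : r * e + q * (e * - C) = (r - C * q) * e by ring.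
  by rewrite pmulr_lle0// subr_le0.
have := AC_nonincreasing acw w0 tT; rewrite /= mulr0 expR0 mulr1 => H.
by have := le_trans H y0; rewrite pmulr_lle0// expR_gt0.
Qed.

(** [y] equals an integral functional only at almost every time, so its value at [0] has to be
    reached as a limit along times at which a bound is known. *)
Lemma AC_start_le T (B : R) (y z : R -> R) : 0 < T -> AC 0 T y z ->
  (forall e : R, 0 < e -> exists2 d : R, 0 < d &
    {ae leb, forall t, 0 < t < d -> t < T -> y t <= B + e}) -> y 0 <= B.
Proof.
move=> T0 acy H; apply/ler_addgt0Pl => e e0.
have e2 : 0 < e / 2 by rewrite divr_gt0.
have [d d0 Hd] := H _ e2; have [d' d'0 Hd'] := AC_uniform acy e2.
have m0 : 0 < Num.min (Num.min d d') T by rewrite !lt_min d0 d'0.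
have [t /andP[t0]] := ae_itv_point m0 Hd.
rewrite !lt_min => /andP[/andP[td td'] tT] /(_ _ tT); rewrite t0 td => /(_ isT) yt.
have := AC_dist acy (lexx 0) (ltW t0) (ltW tT).
have := Hd' 0 t (lexx _) (ltW t0) (ltW tT); rewrite subr0 => /(_ td') i1 i2.
have := le_trans i2 i1; rewrite ler_norml => /andP[i3 _].
have : e = e / 2 + e / 2 by rewrite -splitr.
by move: (e / 2) i3 yt => h i3 yt ->; lra.
Qed.

Lemma ae_le_Rint (D : set R) (f g : R -> R) : measurable D -> itg D f -> itg D g ->
  {ae leb, forall x, D x -> f x <= g x} ->
  \int[leb]_(x in D) f x <= \int[leb]_(x in D) g x.
Proof.
move=> mD fi gi fg; have mf := itg_measurable fi; have mg := itg_measurable gi.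
have mm : measurable_fun D (fun x => Num.min (f x) (g x)) by exact: measurable_minr.
have e : {ae leb, forall x, D x -> f x = Num.min (f x) (g x)}.
  by apply: (ae_imp fg) => x H Dx; rewrite min_l// H.
rewrite (ae_Rint_eq mD mf mm e); apply: le_Rintegral => //.
  exact: ae_integrable mD mm e fi.
by move=> x _; rewrite ge_min lexx orbT.
Qed.

Lemma integrable_cst_oo a b (r : R) : itg `]a, b[ (cst r : R -> R).
Proof. by apply/integrable_bndo_bndc; exact: integrable_cst. Qed.

Lemma Rint_cst_oo a b (r : R) : a <= b -> \int[leb]_(_ in `]a, b[) r = r * (b - a).
Proof. by move=> ab; rewrite Rint_oo_oc ?Rint_cst//; exact: measurable_cst. Qed.

Lemma ae_bounded_integrable a b (f : R -> R) (k : R) : measurable_fun `]a, b[ f ->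
  {ae leb, forall x, x \in `]a, b[ -> `|f x| <= k} -> itg `]a, b[ f.
Proof.
move=> mf fk; apply/integrableP; split; first exact/measurable_EFinP.
have k0 : 0 <= `|k| by [].
apply: (@le_lt_trans _ _ (\int[leb]_(x in `]a, b[) `|k|%:E)%E).
  apply: ae_le_integral => //.
  - by apply/measurable_EFinP; exact: measurableT_comp.
  - apply: (ae_imp fk) => x Hx xI; rewrite lee_fin.
    by apply: le_trans (Hx xI) _; exact: ler_norm.
have := integrable_cst_oo a b k => /integrableP[_].
by under eq_integral do rewrite /= /cst.
Qed.

Lemma Rint_eq0_ae (D : set R) (f : R -> R) : measurable D -> itg D f ->
  (forall x, D x -> 0 <= f x) -> \int[leb]_(x in D) f x = 0 ->
  {ae leb, forall x, D x -> f x = 0}.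
Proof.
move=> mD fi f0 If; have mf := measurable_int _ fi.
have HH := (ae_eq_integral_abs leb mD mf).1.
apply: (ae_imp (HH _)); last by move=> x Hx xI; have [] := Hx xI.
have -> : (\int[leb]_(x in D) `|(EFin \o f) x| = \int[leb]_(x in D) (f x)%:E)%E.
  by apply: eq_integral => x /[!inE] Dx; rewrite /= ger0_norm// f0.
have fin : (\int[leb]_(x in D) (f x)%:E)%E \is a fin_num by exact: integrable_fin_num.
by rewrite -(fineK fin) -[X in (X%:E = _)%E]/(Rintegral leb D f) If.
Qed.

(** Cauchy-Schwarz, by expanding [\int (|f| - S / (b - a))^2 >= 0], where [S / (b - a)] is the mean
    of [|f|]. *)
Lemma sqr_int_norm_le a b (f : R -> R) : a < b -> measurable_fun `]a, b[ f ->
  itg `]a, b[ (fun x => f x ^+ 2) ->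
  (\int[leb]_(x in `]a, b[) `|f x|) ^+ 2 <= (b - a) * \int[leb]_(x in `]a, b[) f x ^+ 2.
Proof.
move=> ab mf f2; have L0 : 0 < b - a by rewrite subr_gt0.
have fn : itg `]a, b[ (fun x => `|f x|) by apply: integrable_norm => //; exact: itg_of_sqr.
have ic c : itg `]a, b[ (cst c : R -> R) by apply/integrable_bndo_bndc; exact: integrable_cst.
set S := \int[leb]_(x in `]a, b[) `|f x|; set Y := \int[leb]_(x in `]a, b[) f x ^+ 2.
have : 0 <= \int[leb]_(x in `]a, b[) ((f x ^+ 2 + (- (2 * S / (b - a))) * `|f x|) +
    (S / (b - a)) ^+ 2 * cst 1 x).
  apply: Rintegral_ge0 => x _; rewrite /cst mulr1.
  have := sqr_ge0 (`|f x| - S / (b - a)); rewrite sqrrB real_normK ?num_real//.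
  congr (_ <= _); rewrite -mulrA; move: (f x ^+ 2) `|f x| (S / (b - a)) => u v w.
  by rewrite mulr2n; ring.
rewrite Rint_addZ//; last by apply: integrable_add => //; exact: integrable_scale.
have e1 : \int[leb]_(x in `]a, b[) cst 1 x = b - a.
  by rewrite Rint_oo_oc// Rint_cst ?mul1r// ltW.
rewrite e1 Rint_addZ// -/S -/Y.
rewrite -(pmulr_rge0 _ L0) => H; rewrite -subr_ge0.
by move: H; congr (_ <= _); field; rewrite gt_eqF.
Qed.

Lemma initial_closeness T a b F : 0 < T -> jm T a b F -> continuous_in (L2_space a b) F ->
  forall e : R, 0 < e -> exists2 d : R, 0 < d & forall t, 0 < t < d -> t < T ->
    sqr_bounded a b (e ^+ 2) (F t \- F 0).
Proof.
move=> T0 mF [mem cF] e e0; have {}cF := cF 0 (lexx 0).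
have mF0 := Lp2_measurable (mem 0 (lexx 0)).
have e0' : (0 < e%:E)%E by rewrite lte_fin.
have := cF _ (open_ereal_lt' e0').
rewrite nbhs_simpl/= => /nbhs_ballP[d /= d0 dP].
exists d => // t /andP[t0 td] tT.
have mFt : measurable_fun `]a, b[ (F t).
  by apply: measurable_slice_x mF _; rewrite /= in_itv/= t0.
have mD := measurable_funB mFt mF0.
have /dP/= : ball 0 d t by rewrite /ball/= sub0r normrN gtr0_norm.
rewrite in_itv/= ltW// => /(_ isT) /ltW.
by move=> /(Lp_norm2_le (ltW e0) mD)[f2 fM]; split.
Qed.

(** The source [(\int negpart^2)^2] is at most [(b - a) \int negpart^4], so the dissipation
    inequality closes on [y] alone and Gronwall's lemma applies from [y 0 <= 0]. *)
Lemma nonneg_temperature T a b mu (u0 v0 theta0 : R -> R) M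
    (u theta thetat thetax ut utt utx ux uxx : R -> R -> R) : a < b -> 0 < T ->
  weak_solution a b mu u0 v0 theta0 u theta ->
  regular_solution a b mu T M theta thetat thetax ut utt utx ux uxx ->
  {ae leb, forall t, t \in `]0, T[ -> {ae leb, forall x, x \in `]a, b[ -> 0 <= theta t x}}.
Proof.
move=> ab T0 ws ex; have [sl thL _ _ _ _ _ _ _ _] := ex.
have [mth _] := thL; have L0 : 0 < b - a by rewrite subr_gt0.
(* The [1] gives [c >= 1], hence [c <= c ^+ 2], and the bound required of [c ^+ 2] already holds for
   [c]. *)
pose c := 1 + (mu * 4) ^+ 2 * `|M|.
have c1 : 1 <= c by rewrite lerDl mulr_ge0// sqr_ge0.
have c0 : 0 < c by exact: lt_le_trans c1.
have cP : {ae leb, forall t, t \in `]0, T[ ->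
    (mu * 4) ^+ 2 * \int[leb]_(x in `]a, b[) ut t x ^+ 2 <= c ^+ 2}.
  apply: (ae_imp sl) => t Ht tI; have [_ _ _ [_ _ utM] _ _ _ _ _ _ _ _] := Ht tI.
  apply: (@le_trans _ _ c); last by rewrite expr2 ler_peMr// ltW.
  apply: (@le_trans _ _ ((mu * 4) ^+ 2 * `|M|)); last by rewrite lerDr.
  by apply: ler_wpM2l; [exact: sqr_ge0|exact: le_trans utM (ler_norm M)].
have [y [z [acy yE zE]]] := power_evolution ab T0 ex power_like_negpart c0 cP.
have mn t : t \in `]0, T[ -> measurable_fun `]a, b[ (fun x => negpart (theta t x) ^+ 2).
  move=> tI; have := measurable_slice_x mth tI => mt.
  apply: measurable_funX.
  apply: (measurableT_comp (continuous_measurable_fun _) mt).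
  exact: locally_lipschitz_continuous locally_lipschitz_negpart.
have thN : {ae leb, forall t, t \in `]0, T[ ->
    {ae leb, forall x, x \in `]a, b[ -> `|theta t x| <= sup_bound a b M}}.
  by apply: (ae_imp sl) => t Ht tI; exact: slice_theta_bound (Ht tI).
set N := sup_bound a b M in thN.
have nN (r : R) : `|r| <= N -> 0 <= negpart r ^+ 2 <= N ^+ 2.
  move=> rN; rewrite sqr_ge0/= -[_ ^+ 2]real_normK ?num_real//.
  rewrite ler_pXn2r ?nnegrE//; last exact: le_trans rN.
  apply: le_trans rN; rewrite /negpart; case: (leP r 0) => // _.
  by rewrite normr0.
have n4 : {ae leb, forall t, t \in `]0, T[ ->
    itg `]a, b[ (fun x => (negpart (theta t x) ^+ 2) ^+ 2)}.
  apply: (ae_imp thN) => t Ht tI; have mt := mn t tI.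
  apply: (@ae_bounded_integrable _ _ _ (N ^+ 2 * N ^+ 2)); first exact: measurable_funX.
  apply: (ae_imp (Ht tI)) => x Hx xI; rewrite ger0_norm ?sqr_ge0//.
  by have /andP[n0 n1] := nN _ (Hx xI); rewrite expr2 ler_pM.
have zy : {ae leb, forall t, t \in `]0, T[ ->
    z t <= 2 * c ^+ 2 * (4 * c ^+ 2 + (b - a)^-1) ^+ 2 * (b - a) * y t}.
  apply: ae_imp2 (ae_and zE n4) yE _ => t [h1 h2] h3 tI.
  apply: le_trans (h1 tI) _; have := sqr_int_norm_le ab (mn t tI) (h2 tI).
  rewrite (h3 tI) => CS.
  have yt0 : 0 <= y t.
    by rewrite -(h3 tI); apply: Rintegral_ge0 => x _; exact: sqr_ge0.
  have a0 : 0 <= c ^+ 2 / (b - a) * y t by rewrite mulr_ge0// divr_ge0 ?sqr_ge0// ltW.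
  have K0 : 0 <= 2 * c ^+ 2 * (4 * c ^+ 2 + (b - a)^-1) ^+ 2.
    by rewrite mulr_ge0 ?sqr_ge0// mulr_ge0// sqr_ge0.
  rewrite -[leRHS]mulrA mulNr; apply: le_trans (ler_wpM2l K0 CS).
  by rewrite gerDr oppr_le0.
have y0 : y 0 <= 0.
  apply: (AC_start_le T0 acy) => e e0; rewrite add0r.
  have [[_ _ _ [d dgt0 th0d]] _ [? [? [? [? [? [? [? [_ _ _ _ [cth _ _ init]]]]]]]]]] := ws.
  (* Near time [0], [negpart (theta t)^4 <= N^2 (theta t - theta 0)^2] because [theta 0] is
     positive. As [r <= 1] gives [r^2 <= r], this choice keeps [N ^+ 2 * r ^+ 2] below [e]. *)
  pose r := Num.min 1 (e / (N ^+ 2 + 1)).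
  have N1 : 0 < N ^+ 2 + 1 by rewrite ltr_wpDl ?sqr_ge0.
  have r0 : 0 < r by rewrite lt_min ltr01 divr_gt0.
  have rN : N ^+ 2 * r ^+ 2 <= e.
    have r1 : r <= 1 by rewrite ge_min lexx.
    have : r * (N ^+ 2 + 1) <= e by rewrite -ler_pdivlMr// ge_min lexx orbT.
    have := sqr_ge0 N; rewrite expr2; nra.
  have [h h0 hP] := initial_closeness T0 mth cth r0; exists h => //.
  apply: ae_imp2 (ae_and yE n4) thN _ => t [h1 h2] h3 th tT.
  have tI : t \in `]0, T[ by rewrite in_itv/= tT andbT; case/andP: th.
  have [mD D2 DM] := hP t th tT.
  rewrite -(h1 tI); apply: le_trans rN.
  apply: (@le_trans _ _ (\int[leb]_(x in `]a, b[) (N ^+ 2 * (theta t \- theta 0) x ^+ 2))).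
    apply: ae_le_Rint => //; [exact: h2|exact: integrable_scale|].
    apply: ae_imp2 init (h3 tI) _ => x ix Nx xI.
    have /andP[n0 n1] := nN _ (Nx xI); rewrite [leLHS]expr2.
    apply: ler_pM => //=; have [_ _ ->] := ix xI.
    have : d <= theta0 x.
      by apply: th0d; move: xI; rewrite !in_itv/= => /andP[/ltW -> /ltW ->].
    rewrite /negpart; case: (leP (theta t x) 0) => tx ?.
      by rewrite -ler_sqrt ?sqr_ge0// !sqrtr_sqr; rewrite !ler0_norm; lra.
    by rewrite expr0n sqr_ge0.
  by rewrite (@RintegralZl _ _ _ leb)//; apply: ler_wpM2l => //; exact: sqr_ge0.
have yneg := gronwall (ltW T0) acy zy y0.
apply: ae_imp2 (ae_and yE n4) thN _ => t [h1 h2] _ tI.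
have t0T : 0 <= t <= T by move: tI; rewrite in_itv/= => /andP[/ltW -> /ltW ->].
have z0 : \int[leb]_(x in `]a, b[) (negpart (theta t x) ^+ 2) ^+ 2 = 0.
  apply/le_anti; rewrite {1}(h1 tI) yneg//=.
  by apply: Rintegral_ge0 => x _; exact: sqr_ge0.
have n0 := Rint_eq0_ae (measurable_itv _) (h2 tI) (fun x _ => sqr_ge0 _) z0.
apply: (ae_imp n0) => x Hx xI; have /eqP := Hx xI; rewrite !sqrf_eq0 /negpart.
by case: (leP (theta t x) 0) => [_ /eqP ->//|/ltW].
Qed.

End Positivity.

(** * Moser iteration *)

Section Moser.
Context {R : realType}.
Local Notation leb := (@lebesgue_measure R).
Implicit Types (a b x y T M N p c : R) (F G H : R -> R -> R).

(** With [k = c^2 / (b - a)] the dissipation inequality has the form [y' <= - k y + k B], where [B]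
    is at least the level at which source and damping balance. Taking [B] above the initial value
    too, [gronwall] with the negative constant [- k] applies to [y - B]. The bound [N] is asked near
    time [0] only, so the result does not see [T]. *)
Lemma moser_step T a b mu M K N W (q : nat)
    (theta thetat thetax ut utt utx ux uxx : R -> R -> R) : a < b -> 0 < T ->
  regular_solution a b mu T M theta thetat thetax ut utt utx ux uxx ->
  (0 < q)%N -> 0 <= K -> 0 <= W -> 0 <= N ->
  {ae leb, forall t, t \in `]0, T[ -> \int[leb]_(x in `]a, b[) ut t x ^+ 2 <= K} ->
  {ae leb, forall t, t \in `]0, T[ -> \int[leb]_(x in `]a, b[) `|theta t x ^+ q| <= W} ->
  {ae leb, forall t, t \in `]0, 1[ -> {ae leb, forall x, x \in `]a, b[ -> `|theta t x| <= N}} ->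
  {ae leb, forall t, t \in `]0, T[ -> \int[leb]_(x in `]a, b[) `|theta t x ^+ q.*2| <=
    Num.max ((b - a) * N ^+ q.*2)
      (2 * (b - a) * (4 * ((1 + mu ^+ 2 * K) * q.*2%:R) ^+ 2 + (b - a)^-1) ^+ 2 * W ^+ 2)}.
Proof.
move=> ab T0 ex q0 K0 W0 N0 utK thW thN; have L0 : 0 < b - a by rewrite subr_gt0.
have [sl thL _ _ _ _ _ _ _ _] := ex; have [mth _] := thL.
have muK : 0 <= mu ^+ 2 * K by rewrite mulr_ge0// sqr_ge0.
have p0 : 0 < q.*2%:R :> R by rewrite ltr0n double_gt0.
(* Proportional to [q]. For [k = mu ^+ 2 * K], the inequality [k <= (1 + k)^2] gives the size
   required of [c], and the [1] keeps [c] positive when [mu] is zero. *)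
set c := (1 + mu ^+ 2 * K) * q.*2%:R.
have c0 : 0 < c by rewrite mulr_gt0// ltr_wpDr.
have cP : {ae leb, forall t, t \in `]0, T[ ->
    (mu * q.*2%:R) ^+ 2 * \int[leb]_(x in `]a, b[) ut t x ^+ 2 <= c ^+ 2}.
  apply: (ae_imp utK) => t Ht tI.
  apply: (le_trans (ler_wpM2l (sqr_ge0 _) (Ht tI))).
  rewrite /c !exprMn mulrAC ler_wpM2r ?sqr_ge0//; move: muK.
  by move: (mu ^+ 2 * K) => k k0; nra.
have [y [z [acy yE zE]]] := power_evolution ab T0 ex (power_like_pow q0) c0 cP.
set B := Num.max _ _.
have nB : - B = - B + \int[leb]_(x in `]0, T]) 0 by rewrite Rint_cst ?mul0r ?addr0// ltW.
have acB : AC 0 T (cst (- B)) (cst 0).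
  by apply: (AC_C1 (ltW T0) _ (locally_lipschitz_cst 0)) => s; exact: is_derive_cst.
have acyB := AC_add acy acB.
have sq (r : R) : (r ^+ q) ^+ 2 = `|r ^+ q.*2|.
  by rewrite -exprM muln2 ger0_norm// -muln2 exprM sqr_ge0.
have y0 : y 0 + - B <= 0.
  rewrite subr_le0; apply: (AC_start_le T0 acy) => e e0; exists 1 => //.
  apply: ae_imp2 (ae_and yE thN) sl _ => t [h1 h2] slt t01 tT.
  have t1 : t \in `]0, 1[ by rewrite in_itv.
  have tI : t \in `]0, T[ by rewrite in_itv/= tT andbT; case/andP: t01.
  rewrite -(h1 tI); apply: (@le_trans _ _ B); last by rewrite lerDl ltW.
  rewrite /B le_max; apply/orP; left.
  have mt := measurable_slice_x mth tI.
  have bd : {ae leb, forall x, x \in `]a, b[ -> (theta t x ^+ q) ^+ 2 <= N ^+ q.*2}.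
    apply: (ae_imp (h2 t1)) => x Hx xI; rewrite sq normrX.
    by rewrite lerXn2r ?nnegrE//; exact: Hx.
  rewrite mulrC -Rint_cst_oo ?(ltW ab)//; apply: ae_le_Rint => //.
    apply: (@ae_bounded_integrable _ _ _ _ (N ^+ q.*2)).
      by apply: measurable_funX; exact: measurable_funX.
    by apply: (ae_imp bd) => x Hx xI; rewrite ger0_norm ?sqr_ge0// Hx.
  exact: integrable_cst_oo.
have zy : {ae leb, forall t, t \in `]0, T[ ->
    z t + cst 0 t <= - (c ^+ 2 / (b - a)) * (y t + - B)}.
  apply: ae_imp2 zE thW _ => t h1 h2 tI; rewrite /cst addr0.
  apply: le_trans (h1 tI) _; rewrite mulrDr lerD2l mulrNN.
  set S := \int[leb]_(x in _) _; have SW : S <= W by exact: h2.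
  have S0 : 0 <= S by apply: Rintegral_ge0.
  have S2 : S ^+ 2 <= W ^+ 2 by rewrite lerXn2r ?nnegrE.
  set X := (4 * c ^+ 2 + (b - a)^-1).
  have le1 : 2 * (b - a) * X ^+ 2 * W ^+ 2 <= B by rewrite /B le_max lexx orbT.
  have c2 : 0 <= c ^+ 2 / (b - a) by rewrite divr_ge0 ?sqr_ge0// ltW.
  apply: le_trans (ler_wpM2l c2 le1).
  have -> : c ^+ 2 / (b - a) * (2 * (b - a) * X ^+ 2 * W ^+ 2) =
      2 * c ^+ 2 * X ^+ 2 * W ^+ 2 by field; rewrite gt_eqF.
  by rewrite ler_wpM2l// mulr_ge0 ?sqr_ge0// mulr_ge0// sqr_ge0.
have H := gronwall (ltW T0) acyB zy y0.
apply: (ae_imp yE) => t Ht tI; under eq_Rintegral do rewrite -sq.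
rewrite (Ht tI) -subr_le0; apply: H.
by move: tI; rewrite in_itv/= => /andP[/ltW -> /ltW ->].
Qed.

(* [beta / 16^k * D^(2^k)] is a supersolution of the recursion of [moser_step]. *)
Lemma iteration_bound (L N S kappa : R) : 0 < L -> 0 <= N -> 0 <= S ->
  exists beta D : R, [/\ 0 < beta <= 1, 0 < D, S <= beta * D &
    forall k : nat, Num.max (L * N ^+ (2 ^ k).*2)
      (2 * L * (4 * (kappa * (2 ^ k).*2%:R) ^+ 2 + L^-1) ^+ 2 *
        (beta / 16 ^+ k * D ^+ (2 ^ k)) ^+ 2) <= beta / 16 ^+ k.+1 * D ^+ (2 ^ k.+1)].
Proof.
move=> L0 N0 S0; pose A := 2 * L * (4 * kappa ^+ 2 + L^-1) ^+ 2.
have A0 : 0 <= A by rewrite mulr_ge0 ?sqr_ge0// mulr_ge0// ltW.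
(* [256] is a product of two factors [16]: one from [(4 * u ^+ 2) ^+ 2] below, with [u = 2 ^+ k],
   the other from dividing [16 ^+ k.+1] by [16 ^+ k]. The choice makes [256 * A * beta <= 1]. *)
have [beta betaE] : exists r : R, r = (256 * (A + 1))^-1 by eexists.
have A1 : 1 <= 256 * (A + 1) by lra.
have b0 : 0 < beta by rewrite betaE invr_gt0; apply: lt_le_trans A1.
have Lb : 0 <= L / beta by rewrite divr_ge0// ltW.
have Sb : 0 <= S / beta by rewrite divr_ge0// ltW.
(* For [p = 2 ^ k.+1], [D0 ^+ p] has to dominate [16 ^+ k.+1 * (L / beta) * N ^+ p], and its three
   factors match these three; the term [S / beta] is for the start of the recursion. *)
pose D0 := 16 * (1 + L / beta) * (N + 1); pose D := D0 + S / beta.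
have D00 : 0 < D0 by apply: mulr_gt0; [apply: mulr_gt0 => //; exact: ltr_wpDr|exact: ltr_wpDl].
have D_0 : 0 < D by rewrite ltr_wpDr.
exists beta, D; split => //.
- by rewrite b0 betaE invf_le1//; apply: lt_le_trans A1.
- have e : beta * (S / beta) = S by rewrite mulrCA divff ?mulr1// gt_eqF.
  by rewrite /D mulrDr e lerDr mulr_ge0// ltW.
move=> k; have e16 : 0 < 16 ^+ k.+1 :> R by rewrite exprn_gt0.
rewrite ge_max; apply/andP; split.
  rewrite -mul2n -expnS; set p := (2 ^ k.+1)%N.
  have kp : (k.+1 <= p)%N by exact/ltnW/ltn_expl.
  apply: (@le_trans _ _ (beta / 16 ^+ k.+1 * D0 ^+ p)); last first.
    rewrite ler_wpM2l ?divr_ge0 ?(ltW b0) ?(ltW e16)//.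
    by rewrite lerXn2r ?nnegrE ?(ltW D00) ?(ltW D_0)// lerDl.
  rewrite /D0 !exprMn.
  have h1 : 1 <= 16 ^+ p / 16 ^+ k.+1 :> R.
    by rewrite ler_pdivlMr// mul1r ler_eXn2l// ltr1n.
  have h2 : L / beta <= (1 + L / beta) ^+ p.
    apply: (@le_trans _ _ (1 + L / beta)); first by rewrite lerDr.
    by rewrite ler_eXnr// ?expn_gt0// lerDl.
  have h3 : N ^+ p <= (N + 1) ^+ p by rewrite lerXn2r ?nnegrE ?lerDl// addr_ge0.
  have -> : beta / 16 ^+ k.+1 * (16 ^+ p * (1 + L / beta) ^+ p * (N + 1) ^+ p) =
      beta * (1 + L / beta) ^+ p * (16 ^+ p / 16 ^+ k.+1) * (N + 1) ^+ p by ring.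
  apply: ler_pM => //; [exact: ltW|exact: exprn_ge0|].
  rewrite -[leLHS]mulr1; apply: ler_pM => //; first exact: ltW.
  by rewrite -ler_pdivrMl// mulrC.
have -> : (2 ^ k).*2%:R = 2 * 2 ^+ k :> R by rewrite -mul2n natrM natrX.
have -> : D ^+ (2 ^ k.+1) = (D ^+ (2 ^ k)) ^+ 2 by rewrite -exprM expnS mulnC.
have -> : (16 : R) = 2 ^+ 4 by rewrite -natrX.
rewrite -!exprM [(4 * k)%N]mulnC [(4 * k.+1)%N]mulnC !exprM.
move: (D ^+ (2 ^ k)) => E.
have u0 : 1 <= 2 ^+ k :> R by rewrite exprn_ege1// ler1n.
rewrite [2 ^+ k.+1]exprS; move: (2 ^+ k : R) u0 => u u1.
have u0 : 0 < u by apply: lt_le_trans u1.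
pose Y := 4 * kappa ^+ 2 + L^-1.
have Li : 0 <= L^-1 by rewrite invr_ge0 ltW.
have Y0 : 0 <= Y by rewrite addr_ge0// mulr_ge0// sqr_ge0.
(* As [u >= 1], the lower-order term [L^-1] is absorbed into the multiple of [u ^+ 2]. *)
have XY : 4 * (kappa * (2 * u)) ^+ 2 + L^-1 <= Y * (4 * u ^+ 2).
  have v1 : 1 <= u ^+ 2 by rewrite exprn_ege1.
  rewrite /Y; move: (L^-1) Li => l l0; move: (sqr_ge0 kappa) v1.
  by rewrite !exprMn; move: (kappa ^+ 2) (u ^+ 2) => m v m0 v1; nra.
have X0 : 0 <= 4 * (kappa * (2 * u)) ^+ 2 + L^-1 by rewrite addr_ge0// mulr_ge0// sqr_ge0.
apply: (@le_trans _ _ (2 * L * (Y * (4 * u ^+ 2)) ^+ 2 * (beta / u ^+ 4 * E) ^+ 2)).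
  rewrite ler_wpM2r ?sqr_ge0//; apply: ler_wpM2l; first by rewrite mulr_ge0// ltW.
  by rewrite lerXn2r ?nnegrE// (le_trans X0).
have Ab : 256 * A * beta <= 1.
  by rewrite betaE ler_pdivrMr ?mul1r; [lra|apply: lt_le_trans A1].
have -> : 2 * L * (Y * (4 * u ^+ 2)) ^+ 2 * (beta / u ^+ 4 * E) ^+ 2 =
    (256 * A * beta) * (beta / (2 * u) ^+ 4 * E ^+ 2).
  by rewrite /A -/Y; field; rewrite gt_eqF.
rewrite -[leRHS]mul1r ler_wpM2r// mulr_ge0 ?sqr_ge0// divr_ge0 ?(ltW b0)//.
by rewrite exprn_ge0// mulr_ge0// ltW.
Qed.

End Moser.

(** * The bound uniform in time *)

Section Final.
Context {R : realType}.
Local Notation leb := (@lebesgue_measure R).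
Local Notation itg D f := (leb.-integrable D (EFin \o f)).
Implicit Types (a b x y T M N p c : R) (F G H : R -> R -> R).

Lemma ae_itv_extend (P : R -> Prop) S T : S <= T ->
  {ae leb, forall t, t \in `]0, T[ -> P t} -> {ae leb, forall t, t \in `]0, S[ -> P t}.
Proof.
move=> ST; move/ae_imp; apply=> t Ht; rewrite in_itv/= => /andP[t0 tS].
by apply: Ht; rewrite in_itv/= t0 (lt_le_trans tS).
Qed.

(** The constants obtained for different [T] are compared at a common time in []0, 1[], so one [E]
    serves all times. *)
Lemma uniform_energy a b mu (theta thetat thetax ut utt utx ux uxx : R -> R -> R) :
  a < b ->
  (forall T, 0 < T -> exists2 M : R, 0 <= M &
    regular_solution a b mu T M theta thetat thetax ut utt utx ux uxx) ->
  exists E : R, forall T, 0 < T -> {ae leb, forall t, t \in `]0, T[ ->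
    \int[leb]_(x in `]a, b[) ut t x ^+ 2 + \int[leb]_(x in `]a, b[) ux t x ^+ 2 +
    2 * \int[leb]_(x in `]a, b[) theta t x = E}.
Proof.
move=> ab ex; have [M1 _ /(energy_conservation ab ltr01)[E HE]] := ex 1 ltr01.
exists E => T T0; pose S := Num.max T 1.
have S0 : 0 < S by rewrite lt_max ltr01 orbT.
have [M _ /(energy_conservation ab S0)[E' HE']] := ex S S0.
have [t /andP[t0 t1] [h1 h2]] := ae_itv_point ltr01 (ae_and HE HE').
have e : E' = E.
  rewrite -h1 ?in_itv/= ?t0// -h2// in_itv/= t0/=.
  by rewrite lt_max t1 orbT.
by rewrite -e; apply: ae_itv_extend HE'; rewrite le_max lexx.
Qed.

(** Chebyshev's inequality with [p = 2 ^ k]: the set [E] where [|f| >= 2 D] satisfies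
    [(2 D)^p |E| <= D^p], so [2^p |E| <= 1] for all [k]. The factor [2] is what forces [E] to be
    null. *)
Lemma sup_of_powers a b (D : R) (f : R -> R) : a < b -> 0 < D ->
  measurable_fun `]a, b[ f ->
  (forall k : nat, itg `]a, b[ (fun x => f x ^+ (2 ^ k)) /\
    \int[leb]_(x in `]a, b[) `|f x ^+ (2 ^ k)| <= D ^+ (2 ^ k)) ->
  {ae leb, forall x, x \in `]a, b[ -> `|f x| <= 2 * D}.
Proof.
move=> ab D0 mf H; have DD0 : 0 < 2 * D by rewrite mulr_gt0.
pose E := `]a, b[ `&` [set x | (2 * D)%:E <= `|(f x)%:E|]%E.
have mE : measurable E.
  have mn : measurable_fun `]a, b[ (fun x => `|(f x)%:E|%E).
    by apply: measurableT_comp => //; exact/measurable_EFinP.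
  exact: emeasurable_fun_c_infty.
have Ek (k : nat) : ((2 ^ k)%:R%:E * leb E <= 1)%E.
  have [fi fk] := H k; set p := (2 ^ k)%N in fi fk *.
  pose g x := f x ^+ p.
  have fn : itg `]a, b[ (fun x => `|f x ^+ p|) by exact: integrable_norm.
  have fk' : (\int[leb]_(x in `]a, b[) `|(EFin \o g) x| <= (D ^+ p)%:E)%E.
    rewrite -[leLHS]fineK; last exact: integrable_fin_num.
    by rewrite lee_fin.
  have mfp : measurable_fun `]a, b[ (EFin \o g).
    exact: measurable_int fi.
  have a0 : 0 < (2 * D) ^+ p by rewrite exprn_gt0.
  have := le_trans (le_integral_abse leb (measurable_itv _) mfp a0) fk'.
  have -> : `]a, b[ `&` [set x | ((2 * D) ^+ p)%:E <= `|(EFin \o g) x|]%E = E.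
    apply: eq_set => x; congr (_ /\ _); rewrite /= !lee_fin /g normrX.
    by rewrite ler_pXn2r ?nnegrE ?(ltW DD0)// expn_gt0.
  rewrite exprMn EFinM -muleA muleCA => h.
  have Dp : 0 < D ^+ p by rewrite exprn_gt0.
  have h' : ((2 ^+ p)%:E * leb E <= 1)%E.
    by rewrite -(@lee_pmul2l _ (D ^+ p)%:E)// mule1.
  apply: le_trans h'; apply: lee_wpmul2r => //.
  by rewrite lee_fin -natrX ler_nat ltnW// ltn_expl.
have E0 : leb E = 0%E.
  apply/eqP; rewrite eq_le measure_ge0 andbT.
  have fE : leb E \is a fin_num.
    by rewrite ge0_fin_numE//; have := Ek 0%N; rewrite mul1e => /le_lt_trans; apply; rewrite ltry.
  rewrite -(fineK fE) lee_fin leNgt; apply/negP => e0.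
  set m := fine _ in e0; pose n := Num.bound m^-1.
  have mn : m^-1 < n%:R by apply: archi_boundP; rewrite invr_ge0 ltW.
  have := Ek n; rewrite -(fineK fE) -/m -EFinM lee_fin -ler_pdivlMr// mul1r.
  move=> /le_lt_trans /(_ mn); rewrite ltr_nat ltnNge => /negP; apply.
  exact/ltnW/ltn_expl.
exists E; split => // x /= /not_implyP[xI /negP]; rewrite -ltNge => h.
by split => //=; rewrite lee_fin ltW.
Qed.

Lemma temperature_bound a b mu (u0 v0 theta0 : R -> R) (u theta : R -> R -> R) :
  a < b -> weak_solution a b mu u0 v0 theta0 u theta ->
  exists C : R, forall T, 0 < T -> jm T a b theta /\
    {ae leb, forall t, t \in `]0, T[ -> {ae leb, forall x, x \in `]a, b[ -> `|theta t x| <= C}}.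
Proof.
move=> ab ws; have [thetat [thetax [ut [utt [utx [ux [uxx ex]]]]]]] := regularity_of_solution ab ws.
have [E HE] := uniform_energy ab ex.
(* Once [theta >= 0], every term of the conserved quantity is nonnegative and hence bounded by [E];
   the absolute value makes [K >= 0] immediate. *)
pose K := `|E|; have K0 : 0 <= K by exact: normr_ge0.
have bounds T : 0 < T -> {ae leb, forall t, t \in `]0, T[ ->
    \int[leb]_(x in `]a, b[) ut t x ^+ 2 <= K /\
    \int[leb]_(x in `]a, b[) `|theta t x ^+ (2 ^ 0)| <= K}.
  move=> T0; have [M _ exM] := ex T T0.
  have [sl [mth _] _ _ _ _ _ _ _ _] := exM.
  apply: ae_imp2 (ae_and sl (nonneg_temperature ab T0 ws exM)) (HE T T0) _.
  move=> t [h1 h2] h3 tI; have := h3 tI; have mt := measurable_slice_x mth tI.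
  have -> : \int[leb]_(x in `]a, b[) `|theta t x ^+ (2 ^ 0)| =
      \int[leb]_(x in `]a, b[) theta t x.
    apply: ae_Rint_eq => //; first by apply: measurableT_comp => //; exact: measurable_funX.
    by apply: (ae_imp (h2 tI)) => x Hx xI; rewrite expn0 expr1 ger0_norm// Hx.
  have i1 : 0 <= \int[leb]_(x in `]a, b[) ut t x ^+ 2.
    by apply: Rintegral_ge0 => x _; exact: sqr_ge0.
  have i2 : 0 <= \int[leb]_(x in `]a, b[) ux t x ^+ 2.
    by apply: Rintegral_ge0 => x _; exact: sqr_ge0.
  have i3 : 0 <= \int[leb]_(x in `]a, b[) theta t x.
    have -> : \int[leb]_(x in `]a, b[) theta t x = \int[leb]_(x in `]a, b[) `|theta t x|.
      apply: ae_Rint_eq => //; first exact: measurableT_comp.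
      by apply: (ae_imp (h2 tI)) => x Hx xI; rewrite ger0_norm// Hx.
    exact: Rintegral_ge0.
  have EK : E <= K by exact: ler_norm.
  move: EK i1 i2 i3; clearbody K; clear.
  move: (\int[leb]_(x in _) ut t x ^+ 2) (\int[leb]_(x in _) ux t x ^+ 2).
  by move: (\int[leb]_(x in _) theta t x) => I1 I2 I3 *; split; lra.
(* [N] comes from the regularity on []0, 1[]; together with [K] it fixes [beta] and [D] before any
   [T] is chosen. *)
have [M1 _ ex1] := ex 1 ltr01; pose N := `|sup_bound a b M1|.
have thN T M : regular_solution a b mu T M theta thetat thetax ut utt utx ux uxx ->
    {ae leb, forall t, t \in `]0, T[ ->
      {ae leb, forall x, x \in `]a, b[ -> `|theta t x| <= `|sup_bound a b M|}}.
  move=> [sl _ _ _ _ _ _ _ _ _]; apply: (ae_imp sl) => t Ht tI.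
  apply: (ae_imp (slice_theta_bound ab (Ht tI))) => x Hx xI.
  by apply: le_trans (Hx xI) _; exact: ler_norm.
have L0 : 0 < b - a by rewrite subr_gt0.
have [beta [D [/andP[b0 b1] D0 SD step]]] :=
  iteration_bound (1 + mu ^+ 2 * K) L0 (normr_ge0 (sup_bound a b M1)) K0.
have iter k T : 0 < T -> {ae leb, forall t, t \in `]0, T[ ->
    \int[leb]_(x in `]a, b[) `|theta t x ^+ (2 ^ k)| <= beta / 16 ^+ k * D ^+ (2 ^ k)}.
  move=> T0; have [M _ exM] := ex T T0.
  elim: k => [|k IH].
    apply: (ae_imp (bounds T T0)) => t Ht tI; have [_ h] := Ht tI.
    by apply: le_trans h _; rewrite expr0 divr1 expn0 expr1.
  have W0 : 0 <= beta / 16 ^+ k * D ^+ (2 ^ k).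
    by rewrite mulr_ge0 ?divr_ge0 ?exprn_ge0 ?(ltW b0) ?(ltW D0).
  have utK : {ae leb, forall t, t \in `]0, T[ -> \int[leb]_(x in `]a, b[) ut t x ^+ 2 <= K}.
    by apply: (ae_imp (bounds T T0)) => t Ht tI; case: (Ht tI).
  have k0 : (0 < 2 ^ k)%N by rewrite expn_gt0.
  have := moser_step ab T0 exM k0 K0 W0 (normr_ge0 _) utK IH (thN _ _ ex1).
  move/ae_imp; apply => t Ht tI; apply: le_trans (step k).
  by have := Ht tI; rewrite -mul2n -expnS.
exists (2 * D) => T T0; have [M _ exM] := ex T T0.
have [_ [mth _] _ _ _ _ _ _ _ _] := exM; split => //.
have all_k := ae_count (fun k => iter k T T0).
apply: ae_imp2 (thN _ _ exM) all_k _ => t h1 h2 tI; have mt := measurable_slice_x mth tI.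
apply: sup_of_powers => // k; split.
  apply: (@ae_bounded_integrable _ _ _ _ (`|sup_bound a b M| ^+ (2 ^ k))).
    exact: measurable_funX.
  apply: (ae_imp (h1 tI)) => x Hx xI; rewrite normrX.
  by rewrite lerXn2r ?nnegrE//; exact: Hx.
apply: le_trans (h2 k tI) _; rewrite -[leRHS]mul1r ler_wpM2r//.
  by rewrite exprn_ge0// ltW.
rewrite ler_pdivrMr ?exprn_gt0// mul1r; apply: le_trans b1 _.
by rewrite exprn_ege1// ler1n.
Qed.

End Final.

Theorem theorem3p1 (R : realType) (a b mu : R) (u0 v0 theta0 : R -> R)
    (u theta : R -> R -> R) :
  a < b ->
  weak_solution a b mu u0 v0 theta0 u theta ->
  (fun p : measurableTypeR R * measurableTypeR R => theta p.1 p.2 : R)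
    \_ (`]0, +oo[ `*` `]a, b[)
    \in Lfun (@lebesgue_measure R \x @lebesgue_measure R)%E +oo%E.
Proof.
move=> ab /(temperature_bound ab)[C H].
set f := (f in f \_ _); pose Q n := cylinder n.+1%:R a b.
(* The unbounded cylinder is exhausted by cylinders of height [n + 1]; [C] is the same on each, and
   a countable union of null sets is null. *)
have QE : `]0, +oo[ `*` `]a, b[ = \bigcup_n Q n.
  apply/seteqP; split => [[t x] [/= tI xI]|[t x] [n _ [/= tI xI]]]; last first.
    by split => //=; move: tI; rewrite !in_itv/= andbT => /andP[].
  have t0 : 0 < t by move: tI; rewrite in_itv/= andbT.
  exists (Num.bound t) => //; split => //=; rewrite in_itv/= t0/=.
  apply: lt_trans (archi_boundP (ltW t0)) _.
  by rewrite ltr_nat.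
have mQ n : measurable (Q n) by exact: measurable_cylinder.
have mf : measurable_fun (\bigcup_n Q n) f.
  by apply/measurable_fun_bigcup => // n; have [] := H n.+1%:R (ltr0Sn _ _).
have mU : measurable (\bigcup_n Q n) by exact: bigcup_measurable.
rewrite QE inE; apply/andP; split; rewrite inE/=.
  exact: (measurable_restrictT f mU).1.
rewrite /finite_norm unlock /Lnorm; case: ifPn => // _.
apply: (@le_lt_trans _ _ `|C|%:E); last exact: ltry.
apply/ess_supP.
(* The bound by [C] is written as the vanishing of a measurable function, the form that passes from
   slices to the product measure. *)
have Hn n : {ae (@lebesgue_measure R \x @lebesgue_measure R)%E, forall p : R * R,
    Q n p -> Num.max (`|theta p.1 p.2| - C) 0 = 0}.
  have [mth thC] := H n.+1%:R (ltr0Sn _ _).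
  apply: (ae_slices_product (H := fun t x => Num.max (`|theta t x| - C) 0)).
    apply: measurable_maxr => //; apply: measurable_funB => //.
    exact: measurableT_comp.
  apply: (ae_imp thC) => t Ht tI; apply: (ae_imp (Ht tI)) => x Hx xI.
  by rewrite max_r// subr_le0 Hx.
apply: (@filterS _ _ (ae_filter_ringOfSetsType _)) (ae_foralln Hn) => p Hp /=.
rewrite patchE; case: ifPn => [|_]; last by rewrite normr0 lee_fin.
rewrite inE => -[n _ /Hp] /eqP; rewrite eq_maxr subr_le0 => h.
by rewrite lee_fin; apply: le_trans h (ler_norm C).
Qed.
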